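(* (In ZFC.) Let $\alpha$ be a limit ordinal. If $\kappa$ is a $\ge\alpha$-Erdős cardinal, then there is $R$ such that $(V_\kappa,\in,R)$ satisfies B1–B7 (listed in the context) + ''there are $\alpha$ $\omega$-reflective cardinals''.
   Context: For a limit ordinal $\beta$, the $\beta$-Erdős cardinal is the least $\kappa$ with $\kappa\to(\beta)^{<\omega}_2$; $\kappa$ is a $\ge\alpha$-Erdős cardinal if it is the $\beta$-Erdős cardinal for some limit ordinal $\beta\ge\alpha$. ''There are $\alpha$ $\omega$-reflective cardinals'' means that the set of $\omega$-reflective cardinals has order type at least $\alpha$. The axioms are in the language of set theory with an additional binary predicate $R$; $R(n,a)$ is read ''$a$ is $n$-reflective'', $R_n=\{z:R(n,z)\}$. B1. ZFC. B2. For all $x$ there is the set $\{(y,z)\in x:R(y,z)\}$. B3. $R(y,z)\Rightarrow y$ and $z$ are ordinals. B4. $R(0,x)$ iff $x$ is a regular uncountable cardinal. B5. $R(n+1,a)\Rightarrow R(n,a)$. B6. For limit $n$, $R(n,a)\Leftrightarrow\forall m<n\ R(m,a)$. B7. For all ordinals $n,a$ and all $b,c$ with $R(n+1,b)$, $R(n+1,c)$ and $0<a<b<c$: $R(n+1,a)$ holds iff for all (codes of) formulas $\varphi$ with two free variables of set theory with a predicate for $R_n$ and all $s\in V_a$, $((V_b,\in,R_n)\models\varphi(a,s))\Leftrightarrow((V_c,\in,R_n)\models\varphi(b,s))$ (with $R_n$ restricted to $V_b$, $V_c$ respectively). *)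

(* Defs.v *)
Set Implicit Arguments.
Unset Strict Implicit.
Unset Printing Implicit Defensive.

(* Every set-theoretic notion below is the interpretation, in an arbitrary
   structure (S, ∈), of its usual definition; sets are elements of S, and
   functions are sets of Kuratowski pairs.  The same notions are used for the
   ambient universe V and for the structure (V_κ, ∈) inside it. *)

Record set_structure := SetStructure {
  carrier :> Type;
  mem : carrier -> carrier -> Prop
}.

Notation "x ∈ y" := (mem x y) (at level 70, no associativity).

Definition subset (S : set_structure) (x y : S) : Prop :=
  forall z, z ∈ x -> z ∈ y.

Notation "x ⊆ y" := (subset x y) (at level 70, no associativity).

(* The substructure whose domain is the extension of the set d. *)
Definition sub (S : set_structure) (d : S) : set_structure :=
  {| carrier := {x : S | x ∈ d};
     mem := fun x y => proj1_sig x ∈ proj1_sig y |}.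

Definition is_empty (S : set_structure) (x : S) : Prop :=
  forall y, ~ y ∈ x.

Definition is_upair (S : set_structure) (p x y : S) : Prop :=
  forall z, z ∈ p <-> z = x \/ z = y.

Definition is_pair (S : set_structure) (p x y : S) : Prop :=
  exists u v, is_upair u x x /\ is_upair v x y /\ is_upair p u v.

Definition is_succ (S : set_structure) (y x : S) : Prop :=
  forall z, z ∈ y <-> z ∈ x \/ z = x.

Definition maps (S : set_structure) (f x y : S) : Prop :=
  exists p, is_pair p x y /\ p ∈ f.

Definition is_relation (S : set_structure) (r x y : S) : Prop :=
  forall p, p ∈ r -> exists u v, u ∈ x /\ v ∈ y /\ is_pair p u v.

Definition is_function (S : set_structure) (f x y : S) : Prop :=
  is_relation f x y /\ forall u, u ∈ x -> exists! v, maps f u v.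

Definition bijection (S : set_structure) (f x y : S) : Prop :=
  is_function f x y /\ forall v, v ∈ y -> exists! u, maps f u v.

Definition equipotent (S : set_structure) (x y : S) : Prop :=
  exists f, bijection f x y.

Definition transitive (S : set_structure) (x : S) : Prop :=
  forall y, y ∈ x -> y ⊆ x.

(* Transitive and well-ordered by ∈. *)
Definition ordinal (S : set_structure) (x : S) : Prop :=
  transitive x /\
  (forall y z, y ∈ x -> z ∈ x -> y ∈ z \/ y = z \/ z ∈ y) /\
  (forall u, u ⊆ x -> (exists y, y ∈ u) ->
     exists y, y ∈ u /\ forall z, z ∈ u -> ~ z ∈ y).

Definition positive (S : set_structure) (x : S) : Prop :=
  exists z, is_empty z /\ z ∈ x.

(* 0 is not a limit ordinal. *)
Definition limit_ordinal (S : set_structure) (x : S) : Prop :=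
  ordinal x /\ positive x /\
  forall y, y ∈ x -> exists z, z ∈ x /\ y ∈ z.

Definition is_omega (S : set_structure) (w : S) : Prop :=
  limit_ordinal w /\ forall y, y ∈ w -> ~ limit_ordinal y.

Definition cardinal (S : set_structure) (x : S) : Prop :=
  ordinal x /\ forall y, y ∈ x -> ~ equipotent y x.

Definition regular_uncountable (S : set_structure) (x : S) : Prop :=
  cardinal x /\
  (exists w, is_omega w /\ w ∈ x) /\
  (forall y f, y ∈ x -> is_function f y x ->
     exists z, z ∈ x /\ forall u v, maps f u v -> v ∈ z).

Definition order_isomorphism (S : set_structure) (f x y : S) : Prop :=
  bijection f x y /\
  forall u u' v v', maps f u v -> maps f u' v' -> (u ∈ u' <-> v ∈ v').

(* x is a set of ordinals, ordered by ∈. *)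
Definition order_type (S : set_structure) (x a : S) : Prop :=
  ordinal a /\ exists f, order_isomorphism f a x.

Definition ordinal_le (S : set_structure) (a b : S) : Prop :=
  a ∈ b \/ a = b.

Definition order_type_at_least (S : set_structure) (x a : S) : Prop :=
  exists b, order_type x b /\ ordinal_le a b.

(* v = V_a: the last value of the sequence f of length a + 1 that satisfies
   f(b) = ⋃_{c < b} P(f(c)). *)
Definition is_stage (S : set_structure) (a v : S) : Prop :=
  ordinal a /\
  exists a' w f, is_succ a' a /\ is_function f a' w /\ maps f a v /\
    forall b y, maps f b y ->
      forall x, x ∈ y <-> exists c z, c ∈ b /\ maps f c z /\ x ⊆ z.

Definition is_two (S : set_structure) (t : S) : Prop :=
  exists z o, is_empty z /\ is_succ o z /\ is_succ t o.

Definition finite (S : set_structure) (x : S) : Prop :=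
  exists w n, is_omega w /\ n ∈ w /\ equipotent x n.

(* k → (b)^{<ω}_2; here d = [k]^{<ω}. *)
Definition arrow (S : set_structure) (k b : S) : Prop :=
  forall d t f,
    (forall x, x ∈ d <-> x ⊆ k /\ finite x) ->
    is_two t -> is_function f d t ->
    exists h, h ⊆ k /\ order_type h b /\
      forall w n, is_omega w -> n ∈ w ->
      forall x y, x ⊆ h -> y ⊆ h -> equipotent x n -> equipotent y n ->
      forall i j, maps f x i -> maps f y j -> i = j.

Definition Erdos (S : set_structure) (b k : S) : Prop :=
  cardinal k /\ arrow k b /\
  forall l, cardinal l -> l ∈ k -> ~ arrow l b.

Definition ge_Erdos (S : set_structure) (a k : S) : Prop :=
  exists b, limit_ordinal b /\ ordinal_le a b /\ Erdos b k.

(* Formulas of set theory with an extra unary predicate symbol for every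
   element of Q; variables are de Bruijn indices. *)
Inductive formula (Q : Type) : Type :=
| FIn (i j : nat)
| FEq (i j : nat)
| FPred (q : Q) (i : nat)
| FNot (φ : formula Q)
| FAnd (φ ψ : formula Q)
| FAll (φ : formula Q).

Definition scons (A : Type) (x : A) (e : nat -> A) (i : nat) : A :=
  match i with 0 => x | Datatypes.S j => e j end.

(* Satisfaction in the structure with domain {x | D x}, the membership
   relation of S, and the predicates P q. *)
Fixpoint sat (S : set_structure) (Q : Type) (D : S -> Prop)
    (P : Q -> S -> Prop) (e : nat -> S) (φ : formula Q) : Prop :=
  match φ with
  | FIn _ i j => e i ∈ e j
  | FEq _ i j => e i = e j
  | FPred q i => P q (e i)
  | FNot φ => ~ sat D P e φ
  | FAnd φ ψ => sat D P e φ /\ sat D P e ψ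
  | FAll φ => forall x, D x -> sat D P (scons x e) φ
  end.

Fixpoint free_below (Q : Type) (k : nat) (φ : formula Q) : Prop :=
  match φ with
  | FIn _ i j | FEq _ i j => i < k /\ j < k
  | FPred _ i => i < k
  | FNot φ => free_below k φ
  | FAnd φ ψ => free_below k φ /\ free_below k ψ
  | FAll φ => free_below (Datatypes.S k) φ
  end.

Definition sat_set (S : set_structure) (e : nat -> S) (φ : formula Empty_set) :=
  sat (fun _ => True) (fun (q : Empty_set) (_ : S) => match q with end) e φ.

(* The environment e supplies the parameters. *)
Definition definable1 (S : set_structure) (A : S -> Prop) : Prop :=
  exists (φ : formula Empty_set) (e : nat -> S),
    forall x, A x <-> sat_set (scons x e) φ.

Definition definable2 (S : set_structure) (A : S -> S -> Prop) : Prop :=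
  exists (φ : formula Empty_set) (e : nat -> S),
    forall x y, A x y <-> sat_set (scons x (scons y e)) φ.

(* ZFC, with separation for the classes in C1 and replacement for
   the class relations in C2. *)
Record ZFC_axioms (S : set_structure)
    (C1 : (S -> Prop) -> Prop) (C2 : (S -> S -> Prop) -> Prop) : Prop := {
  zfc_extensionality : forall x y : S, (forall z, z ∈ x <-> z ∈ y) -> x = y;
  zfc_foundation : forall x : S, (exists y, y ∈ x) ->
    exists y, y ∈ x /\ forall z, z ∈ x -> ~ z ∈ y;
  zfc_pairing : forall x y : S, exists p, is_upair p x y;
  zfc_union : forall x : S, exists u,
    forall z, z ∈ u <-> exists y, y ∈ x /\ z ∈ y;
  zfc_power : forall x : S, exists p, forall y, y ∈ p <-> y ⊆ x;
  zfc_infinity : exists x : S, (exists z, is_empty z /\ z ∈ x) /\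
    forall y, y ∈ x -> exists z, is_succ z y /\ z ∈ x;
  zfc_separation : forall A : S -> Prop, C1 A ->
    forall x, exists y, forall z, z ∈ y <-> z ∈ x /\ A z;
  zfc_replacement : forall A : S -> S -> Prop, C2 A ->
    forall x, (forall u, u ∈ x -> forall v v', A u v -> A u v' -> v = v') ->
    exists y, forall v, v ∈ y <-> exists u, u ∈ x /\ A u v;
  zfc_choice : forall x : S,
    (forall y, y ∈ x -> exists z, z ∈ y) ->
    (forall y y' z, y ∈ x -> y' ∈ x -> z ∈ y -> z ∈ y' -> y = y') ->
    exists c, forall y, y ∈ x -> exists! z, z ∈ y /\ z ∈ c
}.

Definition ZFC (S : set_structure) : Prop :=
  ZFC_axioms (@definable1 S) (@definable2 S).

(* The ambient universe of sets: separation and replacement hold for all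
   classes of the metatheory.  In particular ω is standard, so that codes of
   formulas amount to elements of [formula]. *)
Definition set_universe (V : set_structure) : Prop :=
  ZFC_axioms (fun _ : V -> Prop => True) (fun _ : V -> V -> Prop => True).

(* (v, ∈, R_n) ⊨ φ(x, y), where φ has its free variables among 0 and 1.
   R_n is restricted to v because [FPred] is only evaluated at elements of v. *)
Definition stage_sat (M : set_structure) (R : M -> M -> Prop) (n v : M)
    (φ : formula unit) (x y : M) : Prop :=
  sat (fun z => z ∈ v) (fun (_ : unit) z => R n z)
      (fun i => match i with 0 => x | _ => y end) φ.

(* B1 is ZFC in the language of ∈ alone, without R in the schemas; B2 adds
   what is needed about R. *)
Record B_axioms (M : set_structure) (R : M -> M -> Prop) : Prop := {
  B1 : ZFC M;
  B2 : forall x : M, exists w, forall p,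
    p ∈ w <-> p ∈ x /\ exists y z, is_pair p y z /\ R y z;
  B3 : forall y z, R y z -> ordinal y /\ ordinal z;
  B4 : forall o x, is_empty o -> (R o x <-> regular_uncountable x);
  B5 : forall n n' a, is_succ n' n -> R n' a -> R n a;
  B6 : forall n a, limit_ordinal n ->
    (R n a <-> forall m, m ∈ n -> R m a);
  B7 : forall n n' a b c va vb vc,
    ordinal n -> ordinal a -> is_succ n' n ->
    R n' b -> R n' c -> positive a -> a ∈ b -> b ∈ c ->
    is_stage a va -> is_stage b vb -> is_stage c vc ->
    (R n' a <->
     forall φ : formula unit, free_below 2 φ ->
     forall s, s ∈ va ->
       (stage_sat R n vb φ a s <-> stage_sat R n vc φ b s))
}.

Definition omega_reflective (M : set_structure) (R : M -> M -> Prop)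
    (a : M) : Prop :=
  exists w, is_omega w /\ R w a.

Definition coded_relation (S : set_structure) (d r : S) (x y : sub d) : Prop :=
  maps r (proj1_sig x) (proj1_sig y).

(* Main.v *)
(* Write κ → (β)^{<ω} with κ least, β ≥ α a limit ordinal.  A sequence h : β → κ that is
   homogeneous for sufficiently many colourings makes every function from a given family that
   is regressive on h constant on h, provided that h(0) is chosen minimal: otherwise the values
   of the function on consecutive blocks of h form a homogeneous sequence with a smaller first
   element.  Hence κ is inaccessible, and there is a β-sequence I of regular cardinals below κ
   that is indiscernible in V_κ with parameters below its elements.

   Let R_0 be the class of regular uncountable cardinals and let R_{n+1} consist of the a > 0
   that satisfy (V_i, R_n) ⊨ φ(a, s) ⟺ (V_j, R_n) ⊨ φ(i, s) for all φ and s ∈ V_a, where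
   a < i < j are in I; by indiscernibility the choice of i and j does not matter.  Then I ⊆ R_n
   for all n by induction, and R_ω is the intersection of the R_n; for n > ω let R_n be empty.
   For b ∈ R_{n+1} and b < i ∈ I, V_b and V_i satisfy the same formulas with parameters in V_b:
   that V_b ⊨ φ(x, y) is expressed in V_i by a formula about b and the pair (x, y), and the
   definition of b ∈ R_{n+1} allows one to replace b by i in it.  Axiom B7 for a < b < c
   therefore reduces to a < i < j. *)
Require Import Defs.
From Stdlib Require Import Classical ClassicalEpsilon FunctionalExtensionality PropExtensionality.
From Stdlib Require Import ProofIrrelevance List Sorted Arith Lia Cantor.
From Stdlib Require FinFun.
Import ListNotations.
Set Implicit Arguments.
Unset Strict Implicit.
#[local] Opaque Cantor.to_nat Cantor.of_nat.

(** * Countable types *)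

(** The definition of R_n refers to the sequence I, but the colourings for which I is to be
    homogeneous must be fixed before I exists. Hence R_n is given as a function of a finite
    increasing list ([reflective_below]), so that membership in it, and truth of formulas about it,
    become a countable family of conditions on a list and one parameter ([reflection_family]). One
    colouring can stand for countably many: the length of a list encodes which colouring is applied
    to which initial part of it.

    Besides regressive functions, a second kind must become constant on h: functions with a value
    below a constant value η of another function of the family. If one of them were not constant,
    its values on blocks would be an increasing sequence below η, homogeneous for a colouring chosen
    to have no such sequence below η; here the leastness of κ enters. This yields regularity and the
    strong limit property of κ. It also handles parameters: if a set s of rank below h(0) breaks
    indiscernibility, its rank is regressive, hence constant, and its code then lies below a
    constant bound, so that s itself is constant. *)

Definition countable (A : Type) : Prop :=
  exists e : nat -> A, forall a, exists n, e n = a.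

Lemma countable_nat : countable nat.
Proof. exists (fun n => n). intros a; exists a; reflexivity. Qed.

Lemma countable_prod (A B : Type) : countable A -> countable B -> countable (A * B).
Proof.
  intros [e He] [f Hf].
  exists (fun n => (e (fst (of_nat n)), f (snd (of_nat n)))).
  intros [a b]. destruct (He a) as [n Hn], (Hf b) as [m Hm].
  exists (to_nat (n, m)). rewrite cancel_of_to. simpl. now rewrite Hn, Hm.
Qed.

Lemma countable_list (A : Type) : countable A -> countable (list A).
Proof.
  intros [e He].
  pose (dec := fix dec (fuel c : nat) : list A :=
    match fuel with
    | 0 => []
    | Datatypes.S k => e (fst (of_nat c)) :: dec k (snd (of_nat c))
    end).
  exists (fun n => dec (fst (of_nat n)) (snd (of_nat n))).
  intros l.
  assert (H : exists k c, dec k c = l).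
  { induction l as [|a l (k & c & IH)].
    - exists 0, 0. reflexivity.
    - destruct (He a) as [n Hn].
      exists (Datatypes.S k), (to_nat (n, c)). simpl.
      rewrite cancel_of_to. simpl. now rewrite Hn, IH. }
  destruct H as (k & c & H). exists (to_nat (k, c)).
  now rewrite cancel_of_to.
Qed.

Lemma countable_option (A : Type) : countable A -> countable (option A).
Proof.
  intros [e He].
  exists (fun n => match n with 0 => None | Datatypes.S k => Some (e k) end).
  intros [a|]; [destruct (He a) as [n <-]; now exists (Datatypes.S n) | now exists 0].
Qed.

(** As for lists, a formula is decoded from a depth bound and a code made of nested pairs, whose
    first component selects the constructor. *)
Lemma countable_formula : countable (formula unit).
Proof.
  pose (dec := fix dec (fuel c : nat) : formula unit :=
    match fuel with
    | 0 => FIn _ 0 0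
    | Datatypes.S k =>
      let r := snd (of_nat c) in let a := fst (of_nat r) in let b := snd (of_nat r) in
      match fst (of_nat c) with
      | 0 => FIn _ a b
      | 1 => FEq _ a b
      | 2 => FPred tt a
      | 3 => FNot (dec k a)
      | 4 => FAnd (dec k a) (dec k b)
      | _ => FAll (dec k a)
      end
    end).
  exists (fun n => dec (fst (of_nat n)) (snd (of_nat n))).
  intros φ.
  (* The claim covers all larger depth bounds, because both halves of a conjunction are decoded with
     the same one. *)
  assert (H : exists k c, forall k', k <= k' -> dec k' c = φ).
  { induction φ as [i j|i j|[] i|φ (k & c & IH)|φ (k & c & IH) ψ (k2 & c2 & IH2)|φ (k & c & IH)].
    - exists 1, (to_nat (0, to_nat (i, j))).
      intros [|k'] H; [lia|]. simpl. now rewrite !cancel_of_to; simpl; rewrite !cancel_of_to.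
    - exists 1, (to_nat (1, to_nat (i, j))).
      intros [|k'] H; [lia|]. simpl. now rewrite !cancel_of_to; simpl; rewrite !cancel_of_to.
    - exists 1, (to_nat (2, to_nat (i, 0))).
      intros [|k'] H; [lia|]. simpl. now rewrite !cancel_of_to; simpl; rewrite !cancel_of_to.
    - exists (Datatypes.S k), (to_nat (3, to_nat (c, 0))).
      intros [|k'] H; [lia|]. simpl. rewrite !cancel_of_to; simpl; rewrite !cancel_of_to.
      simpl. rewrite IH; [reflexivity | lia].
    - exists (Datatypes.S (k + k2)), (to_nat (4, to_nat (c, c2))).
      intros [|k'] H; [lia|]. simpl. rewrite !cancel_of_to; simpl; rewrite !cancel_of_to.
      simpl. rewrite IH, IH2; [reflexivity | lia | lia].
    - exists (Datatypes.S k), (to_nat (5, to_nat (c, 0))).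
      intros [|k'] H; [lia|]. simpl. rewrite !cancel_of_to; simpl; rewrite !cancel_of_to.
      simpl. rewrite IH; [reflexivity | lia]. }
  destruct H as (k & c & H). exists (to_nat (k, c)).
  rewrite cancel_of_to. now apply H.
Qed.

(** * Well-orders and increasing lists *)

Record well_order (A : Type) (lt : A -> A -> Prop) : Prop := {
  wo_wf : well_founded lt;
  wo_trans : forall x y z, lt x y -> lt y z -> lt x z;
  wo_total : forall x y, lt x y \/ x = y \/ lt y x
}.

Lemma wf_min (A : Type) (lt : A -> A -> Prop) (P : A -> Prop) :
  well_founded lt -> (exists x, P x) -> exists x, P x /\ forall y, P y -> ~ lt y x.
Proof.
  intros wf [x Hx]. apply NNPP. intros N.
  revert Hx. induction (wf x) as [x _ IH]. intros Hx.
  apply N. exists x. split; [exact Hx|]. intros y Hy L. exact (IH y L Hy).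
Qed.

Lemma wo_irrefl (A : Type) (lt : A -> A -> Prop) (W : well_order lt) x : ~ lt x x.
Proof. intros L. induction (wo_wf W x) as [x _ IH]. exact (IH x L L). Qed.

Notation sorted := StronglySorted.

Definition all_lt (A : Type) (lt : A -> A -> Prop) (l l' : list A) : Prop :=
  forall x y, In x l -> In y l' -> lt x y.

Lemma sorted_app (A : Type) (lt : A -> A -> Prop) l l' :
  sorted lt (l ++ l') <-> sorted lt l /\ sorted lt l' /\ all_lt lt l l'.
Proof.
  induction l as [|a l IH]; simpl.
  - split; [|tauto]. intros H; repeat split; auto using SSorted_nil. intros x y [].
  - split.
    + intros H. inversion H as [|? ? H1 H2]; subst. apply IH in H1 as (A1 & A2 & A3).
      rewrite Forall_app in H2. destruct H2 as [F1 F2].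
      split; [now constructor|]. split; [assumption|].
      intros x y [<-|Hx] Hy; [|now apply A3].
      now apply (proj1 (Forall_forall _ _) F2).
    + intros (H & H1 & H2). inversion H as [|? ? H3 H4]; subst.
      constructor.
      * apply IH. repeat split; auto. intros x y Hx Hy. apply H2; simpl; auto.
      * apply Forall_app. split; [assumption|]. apply Forall_forall.
        intros y Hy. apply H2; simpl; auto.
Qed.

Lemma sorted_single (A : Type) (lt : A -> A -> Prop) x : sorted lt [x].
Proof. repeat constructor. Qed.

Lemma sorted_pair (A : Type) (lt : A -> A -> Prop) x y : lt x y -> sorted lt [x; y].
Proof. repeat constructor; assumption. Qed.

(** This is what lets a colouring of finite sets be read as a colouring of increasing lists. *)
Lemma sorted_unique (A : Type) (lt : A -> A -> Prop) (W : well_order lt) l l' :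
  sorted lt l -> sorted lt l' -> (forall x, In x l <-> In x l') -> l = l'.
Proof.
  intros H; revert l'. induction H as [|a l H IH Ha]; intros l' H' E.
  - destruct l' as [|b l']; [reflexivity|]. exfalso. apply (E b). now left.
  - destruct H' as [|b l' H' Hb]; [exfalso; apply (E a); now left|].
    rewrite Forall_forall in Ha, Hb.
    assert (a = b).
    { destruct (proj1 (E a) (or_introl eq_refl)) as [->|Ia]; [reflexivity|].
      destruct (proj2 (E b) (or_introl eq_refl)) as [->|Ib]; [reflexivity|].
      exfalso. apply (wo_irrefl W (x := a)). eapply wo_trans; eauto. }
    subst b. f_equal. apply IH; [exact H'|]. intros x. split; intros Hx.
    + destruct (proj1 (E x) (or_intror Hx)) as [<-|]; [|assumption].
      exfalso. apply (wo_irrefl W (x := a)). auto.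
    + destruct (proj2 (E x) (or_intror Hx)) as [<-|]; [|assumption].
      exfalso. apply (wo_irrefl W (x := a)). auto.
Qed.

Lemma sort_exists (A : Type) (lt : A -> A -> Prop) (W : well_order lt) l :
  NoDup l -> exists l', sorted lt l' /\ length l' = length l /\ forall x, In x l' <-> In x l.
Proof.
  assert (ins : forall a l, sorted lt l -> ~ In a l ->
    exists l', sorted lt l' /\ length l' = Datatypes.S (length l) /\
      forall x, In x l' <-> x = a \/ In x l).
  { clear l. intros a l H. induction H as [|b l H IH Hb]; intros N.
    - exists [a]. split; [repeat constructor|]. split; [reflexivity|]. simpl. intuition auto.
    - destruct (wo_total W a b) as [L|[E|L]].
      + exists (a :: b :: l). split; [|split; [reflexivity|simpl; intuition auto]].
        constructor; [now constructor|]. constructor; [assumption|].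
        eapply Forall_impl; [|exact Hb]. intros y Hy. eapply wo_trans; eauto.
      + subst. exfalso. apply N. now left.
      + destruct IH as (l' & S1 & S2 & S3); [intros I; apply N; now right|].
        exists (b :: l'). split; [|split].
        * constructor; [assumption|]. apply Forall_forall. intros x Hx.
          apply S3 in Hx as [->|Hx]; [assumption|]. now apply (proj1 (Forall_forall _ _) Hb).
        * simpl. now rewrite S2.
        * intros x. simpl. rewrite S3. intuition auto. }
  induction 1 as [|a l N H (l' & S1 & S2 & S3)].
  - exists []. split; [constructor|]. split; [reflexivity|tauto].
  - destruct (ins a l' S1) as (l2 & T1 & T2 & T3); [now rewrite S3|].
    exists l2. split; [assumption|]. split; [simpl; lia|].
    intros x. rewrite T3, S3. simpl. intuition auto.
Qed.

Definition increasing (A B : Type) (ltA : A -> A -> Prop) (ltB : B -> B -> Prop)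
    (h : A -> B) : Prop :=
  forall x y, ltA x y -> ltB (h x) (h y).

Lemma sorted_map (A B : Type) (ltA : A -> A -> Prop) (ltB : B -> B -> Prop) (h : A -> B) l :
  increasing ltA ltB h -> sorted ltA l -> sorted ltB (map h l).
Proof.
  intros I H. induction H as [|a l H IH Ha]; simpl; constructor; [assumption|].
  rewrite Forall_map. eapply Forall_impl; [|exact Ha]. intros b; apply I.
Qed.

Lemma app_inj_length (A : Type) (u v u' v' : list A) :
  u ++ v = u' ++ v' -> length u = length u' -> u = u' /\ v = v'.
Proof.
  revert u'. induction u as [|a u IH]; intros [|b u'] E L; simpl in *; try lia; [now split|].
  injection E as -> E. destruct (IH u' E) as [-> ->]; [lia|]. now split.
Qed.

(** Empty blocks would leave no trace in the concatenation, hence [0 < m]. *)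
Lemma concat_inj_length (A : Type) m (ls ls' : list (list A)) : 0 < m ->
  Forall (fun l => length l = m) ls -> Forall (fun l => length l = m) ls' ->
  concat ls = concat ls' -> ls = ls'.
Proof.
  intros Hm H. revert ls'. induction H as [|a l Ha H IH]; intros ls' H' E.
  - destruct H' as [|b l' Hb H']; [reflexivity|]. simpl in E.
    apply (f_equal (@length A)) in E. rewrite length_app in E. simpl in E. lia.
  - destruct H' as [|b l' Hb H'].
    + apply (f_equal (@length A)) in E. simpl in E. rewrite length_app in E. lia.
    + simpl in E. apply app_inj_length in E as [-> E]; [|congruence]. f_equal. now apply IH.
Qed.

Lemma length_concat_const (A : Type) m (ls : list (list A)) :
  Forall (fun l => length l = m) ls -> length (concat ls) = length ls * m.
Proof.
  induction 1 as [|a l Ha H IH]; [reflexivity|]. simpl. rewrite length_app. lia.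
Qed.

(** * Well-orders of limit type *)

Section Limit_order.
Context (B : Type) (ltB : B -> B -> Prop) (WB : well_order ltB).
Context (b0 : B) (limB : forall x, exists y, ltB x y).

Lemma finite_bound (l : list B) : exists x, forall y, In y l -> ltB y x.
Proof.
  induction l as [|a l [x IH]]; [exists b0; intros y []|].
  destruct (limB a) as [c Hc]. destruct (wo_total WB c x) as [L|[L|L]].
  - exists x. intros y [<-|Hy]; [eapply wo_trans; eauto|auto].
  - subst. exists x. intros y [<-|Hy]; auto.
  - exists c. intros y [<-|Hy]; [assumption|]. eapply wo_trans; [exact WB| |exact L]. auto.
Qed.

Lemma sorted_from (x : B) n : exists t, length t = n /\ sorted ltB (x :: t).
Proof.
  revert x. induction n as [|n IH]; intros x.
  - exists []. split; [reflexivity|apply sorted_single].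
  - destruct (limB x) as [y Hy]. destruct (IH y) as (t & Ht & S1).
    exists (y :: t). split; [simpl; lia|]. constructor; [assumption|].
    inversion S1 as [|? ? S2 S3]; subst. constructor; [assumption|].
    eapply Forall_impl; [|exact S3]. intros z Hz. eapply wo_trans; eauto.
Qed.

Lemma sorted_beyond (l : list B) n :
  exists t, length t = n /\ sorted ltB t /\ all_lt ltB l t.
Proof.
  destruct (finite_bound l) as [x Hx]. destruct (sorted_from x n) as (t & Ht & S1).
  exists t. inversion S1 as [|? ? S2 S3]; subst. repeat split; auto.
  intros y z Hy Hz. apply (wo_trans WB) with x; auto.
  now apply (proj1 (Forall_forall _ _) S3).
Qed.

Lemma sorted_extend (l : list B) n :
  sorted ltB l -> exists t, length t = n /\ sorted ltB (l ++ t).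
Proof.
  intros H. destruct (sorted_beyond l n) as (t & H1 & H2 & H3).
  exists t. split; [assumption|]. apply sorted_app. auto.
Qed.

Lemma bottom_exists : exists b, forall x, ~ ltB x b.
Proof.
  destruct (wf_min (P := fun _ : B => True) (wo_wf WB)) as (b & _ & H); [now exists b0|].
  exists b. intros x. now apply H.
Qed.

Definition le_of (x y : B) : Prop := ~ ltB y x.

Lemma le_of_iff x y : le_of x y <-> ltB x y \/ x = y.
Proof.
  unfold le_of. split.
  - intros H. destruct (wo_total WB x y) as [L|[L|L]]; auto. contradiction.
  - intros [H| ->]; [|apply (wo_irrefl WB)]. intros H'.
    apply (wo_irrefl WB (x := x)). eapply wo_trans; eauto.
Qed.

Lemma le_of_trans x y z : le_of x y -> le_of y z -> le_of x z.
Proof.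
  rewrite !le_of_iff. intros [H| ->] [H'|E]; subst; auto. left. eapply wo_trans; eauto.
Qed.

Lemma lt_le_trans x y z : ltB x y -> le_of y z -> ltB x z.
Proof. rewrite le_of_iff. intros H [H'|E]; subst; auto. eapply wo_trans; eauto. Qed.

Lemma le_lt_trans x y z : le_of x y -> ltB y z -> ltB x z.
Proof. rewrite le_of_iff. intros [H| ->] H'; auto. eapply wo_trans; eauto. Qed.

Lemma succ_exists : exists sc : B -> B, forall x, ltB x (sc x) /\ forall y, ltB x y -> le_of (sc x) y.
Proof.
  assert (H : forall x, exists z, ltB x z /\ forall y, ltB x y -> le_of z y).
  { intros x. apply (wf_min (P := fun y => ltB x y) (wo_wf WB)). apply limB. }
  exists (fun x => proj1_sig (constructive_indefinite_description _ (H x))).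
  intros x. exact (proj2_sig (constructive_indefinite_description _ (H x))).
Qed.

(* Blocks start as early as possible; the block of x then starts finitely many steps
   above x, so that the construction does not run out of B. *)
Lemma blocks_exist (k m : nat) : exists (w : list B) (z : B -> list B),
  length w = k /\ sorted ltB w /\
  (forall x, length (z x) = m /\ sorted ltB (z x) /\ all_lt ltB w (z x)) /\
  (forall x y, ltB x y -> all_lt ltB (z x) (z y)) /\
  (k = 0 -> 0 < m -> exists b t, z b = b :: t /\ forall x, ~ ltB x b).
Proof.
  destruct succ_exists as [sc Hsc]. destruct bottom_exists as [bot Hbot].
  pose (it := fun n x => Nat.iter n sc x).
  assert (sc_mono : forall x y, le_of x y -> le_of (sc x) (sc y)).
  { intros x y H. apply (proj2 (Hsc x)). apply le_lt_trans with y; [assumption|apply Hsc]. }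
  assert (it_mono : forall n x y, le_of x y -> le_of (it n x) (it n y)).
  { intros n x y H. induction n; simpl; auto. }
  assert (it_ge : forall n x, le_of x (it n x)).
  { intros n x. induction n as [|n IH]; simpl; [apply (wo_irrefl WB)|].
    apply le_of_trans with (it n x); [assumption|]. apply le_of_iff. left. apply Hsc. }
  assert (it_lt : forall n p x, n < p -> ltB (it n x) (it p x)).
  { intros n p x H. induction H as [|p H IH]; simpl; [apply Hsc|].
    eapply wo_trans; [exact WB|exact IH|apply Hsc]. }
  pose (win := fun x n => map (fun i => it i x) (seq 0 n)).
  assert (win_sorted : forall x n a, sorted ltB (map (fun i => it i x) (seq a n))).
  { intros x n. induction n as [|n IH]; intros a; simpl; constructor; [apply IH|].
    rewrite Forall_map. apply Forall_forall. intros i Hi. apply in_seq in Hi. apply it_lt. lia. }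
  pose (ρ0 := it k bot).
  (* A block may start at ρ if ρ is past the initial run of k elements, which ends before [ρ0], and
     past all earlier blocks; [st x] is the least such ρ. *)
  pose (ok := fun (x : B) (rec : forall y, ltB y x -> B) (ρ : B) =>
    le_of ρ0 ρ /\ forall y (L : ltB y x), le_of (it m (rec y L)) ρ).
  pose (st := Fix (wo_wf WB) (fun _ => B)
    (fun x rec => epsilon (inhabits b0)
       (fun ρ => ok x rec ρ /\ forall ρ', ok x rec ρ' -> le_of ρ ρ'))).
  assert (st_eq : forall x, st x = epsilon (inhabits b0)
       (fun ρ => ok x (fun y _ => st y) ρ /\ forall ρ', ok x (fun y _ => st y) ρ' -> le_of ρ ρ')).
  { intros x. unfold st at 1. rewrite Fix_eq; [reflexivity|].
    intros x' f g E. replace g with f; [reflexivity|].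
    apply functional_extensionality_dep; intros y.
    apply functional_extensionality_dep; intros p. apply E. }
  assert (st_spec : forall x, (exists ρ, ok x (fun y _ => st y) ρ) ->
     ok x (fun y _ => st y) (st x) /\ forall ρ', ok x (fun y _ => st y) ρ' -> le_of (st x) ρ').
  { intros x E. rewrite st_eq. apply epsilon_spec.
    destruct (wf_min (wo_wf WB) E) as (ρ & H1 & H2). exists ρ. split; [assumption|].
    intros ρ' H. now apply H2. }
  (* That an admissible start exists at all is proved together with the bound, by exhibiting one
     finitely many steps above x. *)
  assert (st_ok : forall x, ok x (fun y _ => st y) (st x) /\ exists p, le_of (st x) (it p x)).
  { intros x. induction (wo_wf WB x) as [x _ IH].
    assert (C : exists p, ok x (fun y _ => st y) (it p x)).
    { assert (R : forall p x, k <= p -> le_of ρ0 (it p x)).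
      { intros p y H. apply le_of_trans with (it k y); [apply it_mono, Hbot|].
        apply le_of_iff. destruct (Nat.eq_dec k p) as [->|]; [now right|left].
        apply it_lt. lia. }
      (* Either x is the successor of some y, and the block of x fits after that of y; or finite
         successors of elements below x stay below x, and with them all earlier blocks. *)
      destruct (classic (exists y, ltB y x /\ le_of x (sc y))) as [(y & L & E)|N].
      - destruct (IH y L) as [[_ O2] [p Hp]].
        exists (k + (m + p)). split; [apply R; lia|]. intros y' L'.
        assert (A1 : le_of (st y') (st y)).
        { destruct (wo_total WB y' y) as [T|[T|T]].
          - apply le_of_trans with (it m (st y')); [apply it_ge|now apply O2].
          - subst. apply (wo_irrefl WB).
          - exfalso. apply (proj2 (Hsc y)) in T. apply T.
            apply lt_le_trans with x; assumption. }
        apply le_of_trans with (it m (it p x)).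
        + apply it_mono. apply le_of_trans with (st y); [assumption|].
          apply le_of_trans with (it p y); [assumption|]. apply it_mono.
          apply le_of_iff; now left.
        + unfold it. rewrite <- Nat.iter_add. fold (it (m + p) x). rewrite Nat.iter_add.
          apply it_ge.
      - exists k. split; [apply R; lia|]. intros y L.
        destruct (IH y L) as [_ [p Hp]].
        apply le_of_trans with (it (m + p) y).
        + unfold it at 2. rewrite Nat.iter_add. now apply it_mono.
        + apply le_of_trans with x; [|apply it_ge].
          apply le_of_iff. left. clear Hp. generalize (m + p). intros q.
          induction q as [|q IHq]; simpl; [assumption|].
          apply NNPP. intros N'. apply N. now exists (it q y). }
    destruct C as [p Hp].
    destruct (st_spec x) as [S1 S2]; [now exists (it p x)|].
    split; [assumption|]. exists p. now apply S2. }
  assert (in_win : forall x n y, In y (win x n) -> exists i, i < n /\ y = it i x).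
  { intros x n y H. unfold win in H. apply in_map_iff in H as (i & <- & Hi).
    apply in_seq in Hi. exists i. split; [lia|reflexivity]. }
  exists (win bot k), (fun x => win (st x) m).
  split; [unfold win; now rewrite length_map, length_seq|].
  split; [apply win_sorted|].
  split; [|split].
  - intros x. split; [unfold win; now rewrite length_map, length_seq|].
    split; [apply win_sorted|].
    intros y z Hy Hz. apply in_win in Hy as (i & Hi & ->), Hz as (j & Hj & ->).
    apply lt_le_trans with ρ0; [now apply it_lt|].
    apply le_of_trans with (st x); [apply (proj1 (st_ok x))|apply it_ge].
  - intros x y L u v Hu Hv. apply in_win in Hu as (i & Hi & ->), Hv as (j & Hj & ->).
    apply lt_le_trans with (it m (st x)); [now apply it_lt|].
    apply le_of_trans with (st y); [|apply it_ge].
    now apply (proj2 (proj1 (st_ok y))).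
  (* Without an initial run the first block starts at the least element, so that its value can be
     compared with h at that element. *)
  - intros -> Hm. exists bot.
    assert (E : st bot = bot).
    { assert (L : le_of (st bot) bot).
      { apply (st_spec bot); [exists (st bot); apply st_ok|].
        split; [apply (wo_irrefl WB)|]. intros y L. exfalso. now apply (Hbot y). }
      apply le_of_iff in L as [L|L]; [|assumption]. exfalso. now apply Hbot in L. }
    destruct m as [|m']; [lia|].
    exists (map (fun i => it i bot) (seq 1 m')). split; [|assumption].
    unfold win. rewrite E. reflexivity.
Qed.

End Limit_order.

(** * Partition relations between well-orders *)

Definition homogeneous (O B : Type) (ltB : B -> B -> Prop) (c : list O -> Prop)
    (h : B -> O) : Prop :=
  forall l l', sorted ltB l -> sorted ltB l' -> length l = length l' ->
    (c (map h l) <-> c (map h l')).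

Definition partition_arrow (O B : Type) (ltO : O -> O -> Prop) (ltB : B -> B -> Prop) : Prop :=
  forall c : list O -> Prop, exists h, increasing ltB ltO h /\ homogeneous ltB c h.

(* O plays the role of the β-Erdős cardinal, B that of β. *)
Section Erdos_order.
Context (O B : Type) (ltO : O -> O -> Prop) (ltB : B -> B -> Prop).
Context (WO : well_order ltO) (WB : well_order ltB).
Context (b0 : B) (limB : forall x, exists y, ltB x y).
Context (arrowO : partition_arrow ltO ltB).
(** Leastness of κ in the form in which it is used: the bad colouring for η is one of lists over O,
    tested only on sequences that stay below η. *)
Context (minO : forall η, exists c, forall h,
  increasing ltB ltO h -> (forall x, ltO (h x) η) -> ~ homogeneous ltB c h).

(** A list whose length is the Cantor code of (n, i) receives the colour that [c (e i)] gives to its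
    first n entries. Every increasing list of length n can be prolonged to that length because B has
    no last element, so homogeneity for the long lists is homogeneity of [c (e i)] on the short
    ones. *)
Lemma arrow_countable (J : Type) (c : J -> list O -> Prop) : countable J ->
  exists h, increasing ltB ltO h /\ forall j, homogeneous ltB (c j) h.
Proof.
  intros [e He].
  destruct (arrowO (fun l => let p := of_nat (length l) in
    c (e (snd p)) (firstn (fst p) l))) as (h & Hh & H).
  exists h. split; [assumption|]. intros j l l' S1 S2 E.
  destruct (He j) as [i <-].
  pose (q := to_nat (length l, i)).
  (* The Cantor code of (n, i) is at least n, so the list of length q has room for the n entries. *)
  assert (Q : length l <= q) by (pose proof (to_nat_non_decreasing (length l) i); unfold q; lia).
  destruct (sorted_extend WB b0 limB (q - length l) S1) as (t & T1 & T2).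
  destruct (sorted_extend WB b0 limB (q - length l) S2) as (t' & T1' & T2').
  assert (F : forall l1 t1, length l1 = length l -> length t1 = q - length l ->
     (let p := of_nat (length (map h (l1 ++ t1))) in
      c (e (snd p)) (firstn (fst p) (map h (l1 ++ t1)))) <-> c (e i) (map h l1)).
  { intros l1 t1 E1 E2. cbv zeta. rewrite length_map, length_app, E1, E2.
    replace (length l + (q - length l)) with q by lia.
    unfold q. rewrite cancel_of_to. simpl. rewrite map_app, firstn_app, <- E1.
    rewrite length_map, Nat.sub_diag. simpl. rewrite app_nil_r.
    rewrite firstn_all2; [tauto|]. rewrite length_map; lia. }
  rewrite <- (F l t), <- (F l' t'); auto.
  apply H; auto. rewrite !length_app. lia.
Qed.

(** * Canonical sequences and regressive functions *)

Definition constant_on (h : B -> O) (n : nat) (f : list O -> O) : Prop :=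
  forall z z', sorted ltB z -> sorted ltB z' -> length z = n -> length z' = n ->
    f (map h z) = f (map h z').

Section Canonical_sequences.
Context (J : Type) (HJ : countable J) (F : J -> list O -> O).

(* Closure under this operation makes the values of F on the blocks of a homogeneous
   sequence homogeneous as well. *)
Definition blockwise (p : J * nat) (c : list O -> Prop) (x : list O) : Prop :=
  exists ls, Forall (fun l => length l = snd p) ls /\ x = concat ls /\ c (map (F (fst p)) ls).

(** The number t selects the use. Colours 0 and 1 compare [F i] on two consecutive blocks of length
    m; colour 2 tells whether [F i] is regressive at x; colour 3 compares [F i] on a block with
    [F j] on a later one; colour 4 reads an ordinal η as the value of [F j] on the first k entries
    and applies [g η] to the values of [F i] on the remaining blocks. *)
Definition base_color (g : O -> list O -> Prop) (p : nat * (J * nat) * (J * nat)) (x : list O) : Prop :=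
  let '(t, (i, m), (j, k)) := p in
  match t with
  | 0 => exists u v, length u = m /\ length v = m /\ x = u ++ v /\ ltO (F i u) (F i v)
  | 1 => exists u v, length u = m /\ length v = m /\ x = u ++ v /\ F i u = F i v
  | 2 => exists a t, x = a :: t /\ ltO (F i x) a
  | 3 => exists u w, length u = m /\ length w = k /\ x = u ++ w /\ ltO (F i u) (F j w)
  | _ => exists w ls, length w = k /\ Forall (fun l => length l = m) ls /\
           x = w ++ concat ls /\ g (F j w) (map (F i) ls)
  end.

Definition iterated_color g (p : list (J * nat) * (nat * (J * nat) * (J * nat))) : list O -> Prop :=
  fold_right blockwise (base_color g (snd p)) (fst p).

Definition canonical g h : Prop :=
  increasing ltB ltO h /\ forall p, homogeneous ltB (iterated_color g p) h.

Lemma blocks_length (z : B -> list B) m (h : B -> O) l :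
  (forall x, length (z x) = m) ->
  Forall (fun l => length l = m) (map (fun x => map h (z x)) l).
Proof. intros H. rewrite Forall_map. apply Forall_forall. intros x _. now rewrite length_map. Qed.

Lemma blocks_sorted (z : B -> list B) l :
  (forall x, sorted ltB (z x)) -> (forall x y, ltB x y -> all_lt ltB (z x) (z y)) ->
  sorted ltB l -> sorted ltB (concat (map z l)).
Proof.
  intros H1 H2 H. induction H as [|a l H IH Ha]; simpl; [constructor|].
  apply sorted_app. repeat split; auto.
  intros x y Hx Hy. apply in_concat in Hy as (ys & Hys & Hy).
  apply in_map_iff in Hys as (b & <- & Hb).
  apply (H2 a b); auto. now apply (proj1 (Forall_forall _ _) Ha).
Qed.

Lemma blocks_map (z : B -> list B) (h : B -> O) l :
  map h (concat (map z l)) = concat (map (fun x => map h (z x)) l).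
Proof. now rewrite concat_map, map_map. Qed.

(** The colour [c] of the block values along l is the colour [blockwise (i, m) c] of the
    concatenated blocks, since the splitting into blocks of length m is unique. *)
Lemma blockwise_homogeneous c i m (z : B -> list B) h : 0 < m ->
  (forall x, length (z x) = m) -> (forall x, sorted ltB (z x)) ->
  (forall x y, ltB x y -> all_lt ltB (z x) (z y)) ->
  homogeneous ltB (blockwise (i, m) c) h ->
  homogeneous ltB c (fun x => F i (map h (z x))).
Proof.
  intros Hm Z1 Z2 Z3 H.
  assert (G : forall l, c (map (fun x => F i (map h (z x))) l) <->
                 blockwise (i, m) c (map h (concat (map z l)))).
  { intros l. rewrite blocks_map. unfold blockwise; simpl. split.
    - intros C. exists (map (fun x => map h (z x)) l).
      split; [now apply blocks_length|]. split; [reflexivity|]. now rewrite map_map.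
    - intros (ls & L1 & L2 & C).
      assert (ls = map (fun x => map h (z x)) l) as ->.
      { apply (concat_inj_length Hm); auto. now apply blocks_length. }
      now rewrite map_map in C. }
  intros l l' S1 S2 E. rewrite !G. apply H; try now apply blocks_sorted.
  rewrite !(length_concat_const (m := m)), !length_map; [now rewrite E| |];
    rewrite Forall_map; apply Forall_forall; intros x _; apply Z1.
Qed.

(** The colour with operations [ops] for the new sequence is the colour with operations
    [(i, m) :: ops] for h. Closing the colours under finite iteration is what preserves
    canonicity. *)
Lemma canonical_blocks g i m (z : B -> list B) h : 0 < m ->
  (forall x, length (z x) = m) -> (forall x, sorted ltB (z x)) ->
  (forall x y, ltB x y -> all_lt ltB (z x) (z y)) ->
  canonical g h ->
  (forall x y, ltB x y -> ltO (F i (map h (z x))) (F i (map h (z y)))) ->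
  canonical g (fun x => F i (map h (z x))).
Proof.
  intros Hm Z1 Z2 Z3 [_ Hh] I. split; [exact I|].
  intros [ops b]. apply blockwise_homogeneous with (m := m); auto.
  exact (Hh ((i, m) :: ops, b)).
Qed.

Lemma canonical_exists g : exists h, canonical g h.
Proof.
  destruct (@arrow_countable (list (J * nat) * (nat * (J * nat) * (J * nat))) (iterated_color g))
    as (h & H1 & H2).
  - pose proof countable_nat. repeat (apply countable_prod || apply countable_list); auto.
  - exists h. now split.
Qed.

(* If F i is regressive but not constant on h, then its values on consecutive blocks
   form another canonical sequence, with a smaller first element. *)
Theorem canonical_regressive : exists h, increasing ltB ltO h /\
  (forall i z, sorted ltB z ->
    (exists a t, z = a :: t /\ ltO (F i (map h z)) (h a)) -> constant_on h (length z) (F i)) /\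
  (forall i j z w, sorted ltB z -> sorted ltB w -> constant_on h (length w) (F j) ->
    ltO (F i (map h z)) (F j (map h w)) -> constant_on h (length z) (F i)).
Proof.
  pose (g := fun η => proj1_sig (constructive_indefinite_description _ (minO η))).
  assert (Hg : forall η h, increasing ltB ltO h -> (forall x, ltO (h x) η) ->
    ~ homogeneous ltB (g η) h).
  { intros η. exact (proj2_sig (constructive_indefinite_description _ (minO η))). }
  clearbody g.
  destruct (bottom_exists WB b0) as [bot Hbot].
  destruct (wf_min (P := fun o => exists h, canonical g h /\ h bot = o) (wo_wf WO))
    as (o & (h & [Hi Hh] & <-) & Hmin).
  { destruct (canonical_exists g) as [h Hh]. exists (h bot), h. now split. }
  exists h. split; [assumption|].
  assert (Hbase : forall b, homogeneous ltB (base_color g b) h).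
  { intros b. exact (Hh ([], b)). }
  (* By colours 0 and 1, comparing [F i] on two consecutive blocks always has the same outcome.
     Equality would make [F i] constant, since any two lists can be compared with a common later
     one; a decrease would give an infinite descent along the blocks. *)
  assert (dich : forall i m, 0 < m -> ~ constant_on h m (F i) ->
    forall u v, sorted ltB (u ++ v) -> length u = m -> length v = m ->
      ltO (F i (map h u)) (F i (map h v))).
  { intros i m Hm NC.
    assert (use0 : forall t (R : O -> O -> Prop),
      (forall x, base_color g (t, (i, m), (i, 0)) x <->
         exists u v, length u = m /\ length v = m /\ x = u ++ v /\ R (F i u) (F i v)) ->
      forall u v u' v', sorted ltB (u ++ v) -> length u = m -> length v = m ->
        sorted ltB (u' ++ v') -> length u' = m -> length v' = m ->
        R (F i (map h u)) (F i (map h v)) -> R (F i (map h u')) (F i (map h v'))).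
    { intros t R E u v u' v' S1 L1 L2 S2 L3 L4 HR.
      assert (C : base_color g (t, (i, m), (i, 0)) (map h (u' ++ v'))).
      { apply (Hbase _ (u ++ v) (u' ++ v')); auto; [rewrite !length_app; lia|].
        apply E. exists (map h u), (map h v). rewrite !length_map, map_app. auto. }
      apply E in C as (u2 & v2 & M1 & M2 & M3 & M4). rewrite map_app in M3.
      apply app_inj_length in M3 as [-> ->]; [assumption|]. rewrite length_map. lia. }
    intros u v S1 L1 L2.
    destruct (wo_total WO (F i (map h u)) (F i (map h v))) as [L|[E|L]]; [assumption| |].
    - exfalso. apply NC. intros z z' Sz Sz' Lz Lz'.
      destruct (sorted_beyond WB b0 limB (z ++ z') m) as (t & T1 & T2 & T3).
      assert (A1 : forall y, incl y (z ++ z') -> length y = m -> sorted ltB y ->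
        F i (map h y) = F i (map h t)).
      { intros y Iy Ly Sy. eapply (use0 1 eq); [reflexivity|exact S1| | | | | |exact E]; auto.
        apply sorted_app. repeat split; auto. intros a b Ha Hb. apply T3; auto. }
      rewrite (A1 z), (A1 z'); auto; intros a Ha; apply in_or_app; auto.
    - exfalso. destruct (blocks_exist WB b0 limB 0 m) as (w00 & z & _ & _ & Z1 & Z2 & _).
      destruct (wf_min (P := fun o => exists x, F i (map h (z x)) = o) (wo_wf WO))
        as (o & (x & <-) & Hx); [now exists (F i (map h (z b0))), b0|].
      destruct (limB x) as [y Hy]. apply (Hx (F i (map h (z y)))); [now exists y|].
      apply NNPP. intros N.
      destruct (wo_total WO (F i (map h (z x))) (F i (map h (z y)))) as [L'|[L'|L']];
        [| |contradiction].
      + apply (wo_irrefl WO (x := F i (map h u))).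
        eapply wo_trans; [exact WO| |exact L].
        eapply (use0 0 ltO); [reflexivity| | | | | | |exact L']; auto; try apply Z1.
        apply sorted_app. repeat split; try apply Z1. now apply Z2.
      + apply (wo_irrefl WO (x := F i (map h u))).
        assert (E : F i (map h u) = F i (map h v)).
        { eapply (use0 1 eq); [reflexivity| | | | | | |exact L']; auto; try apply Z1.
          apply sorted_app. repeat split; try apply Z1. now apply Z2. }
        rewrite E in L at 1. now rewrite E. }
  split.
  (* The first block starts at [bot], so by colour 2 its value is below [h bot], against the minimal
     choice of [h bot]. *)
  - intros i z Sz (a & t & Ez & L). apply NNPP. intros NC.
    assert (Hm : 0 < length z) by (subst; simpl; lia).
    destruct (blocks_exist WB b0 limB 0 (length z)) as (w00 & y & _ & _ & Y1 & Y2 & Y3).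
    destruct (Y3 eq_refl Hm) as (b & t' & Eb & Hb).
    assert (bot = b) as <-.
    { destruct (wo_total WB bot b) as [T|[T|T]]; [now apply Hb in T|assumption|now apply Hbot in T]. }
    apply (Hmin (F i (map h (y bot)))).
    + exists (fun x => F i (map h (y x))). split; [|reflexivity].
      apply canonical_blocks with (m := length z); auto; try apply Y1.
      * split; assumption.
      * intros u v Huv. apply (dich i (length z)); auto; try apply Y1.
        apply sorted_app. repeat split; try apply Y1. now apply Y2.
    + assert (C : base_color g (2, (i, 0), (i, 0)) (map h (y bot))).
      { apply (Hbase _ z (y bot)); auto; try (apply Y1 || (symmetry; apply Y1)).
        exists (h a), (map h t). split; [now rewrite Ez|assumption]. }
      destruct C as (a' & t2 & E2 & L2). rewrite Eb in E2 at 1. injection E2 as <- _. assumption.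
  - intros i j z w Sz Sw CF L. apply NNPP. intros NC.
    assert (Hm : 0 < length z).
    { destruct z as [|x z]; [|simpl; lia]. exfalso. apply NC.
      intros [|] [|]; simpl; intros; (reflexivity || lia). }
    set (m := length z) in *. set (k := length w) in *.
    (* The constant value of [F j] is also taken on lists that come after z or after u, so colour 3
       transfers the inequality from z to u. *)
    assert (below : forall u, sorted ltB u -> length u = m ->
       ltO (F i (map h u)) (F j (map h w))).
    { assert (A1 : forall u, sorted ltB u -> length u = m -> exists w', sorted ltB (u ++ w') /\
        length w' = k /\ F j (map h w) = F j (map h w')).
      { intros u Su Lu. destruct (sorted_extend WB b0 limB k Su) as (w' & W1 & W2).
        exists w'. split; [assumption|]. split; [assumption|].
        apply sorted_app in W2. apply CF; auto; apply W2. }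
      intros u Su Lu.
      destruct (A1 z Sz eq_refl) as (w1 & W1 & W2 & W3).
      destruct (A1 u Su Lu) as (w2 & W4 & W5 & W6).
      assert (C : base_color g (3, (i, m), (j, k)) (map h (u ++ w2))).
      { apply (Hbase _ (z ++ w1) (u ++ w2)); auto; [rewrite !length_app; fold m; lia|].
        exists (map h z), (map h w1). rewrite !length_map, map_app, <- W3. auto. }
      destruct C as (u' & w' & C1 & C2 & C3 & C4). rewrite map_app in C3.
      apply app_inj_length in C3 as [<- <-]; [|rewrite length_map; lia].
      now rewrite W6. }
    (* The k elements [w0] in front of all blocks supply η, the constant value of [F j], to colour
       4. The block values then form a sequence below η that is homogeneous for [g η], contrary to
       the choice of g. *)
    destruct (blocks_exist WB b0 limB k m) as (w0 & y & W1 & W2 & Y1 & Y2 & _).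
    apply (Hg (F j (map h w)) (fun x => F i (map h (y x)))).
    + intros u v Huv. apply (dich i m); auto; try apply Y1.
      apply sorted_app. repeat split; try apply Y1. now apply Y2.
    + intros x. apply below; apply Y1.
    + assert (G : forall l, g (F j (map h w)) (map (fun x => F i (map h (y x))) l) <->
        base_color g (4, (i, m), (j, k)) (map h (w0 ++ concat (map y l)))).
      { assert (E0 : F j (map h w) = F j (map h w0)) by (apply CF; auto).
        intros l. simpl. split.
        - intros C. exists (map h w0), (map (fun x => map h (y x)) l).
          rewrite length_map, map_app, blocks_map, <- E0, map_map.
          repeat split; auto. apply blocks_length. apply Y1.
        - intros (w' & ls & C1 & C2 & C3 & C4). rewrite map_app, blocks_map in C3.
          apply app_inj_length in C3 as [<- C3]; [|rewrite length_map; lia].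
          apply (concat_inj_length Hm) in C3; auto; [|apply blocks_length; apply Y1].
          subst ls. rewrite map_map, <- E0 in C4. assumption. }
      intros l l' S1 S2 E. rewrite !G. apply Hbase.
      * apply sorted_app. split; [assumption|]. split; [apply blocks_sorted; auto; apply Y1|].
        intros a b Ha Hb. apply in_concat in Hb as (ys & Hys & Hb).
        apply in_map_iff in Hys as (x & <- & _). now apply (proj2 (proj2 (Y1 x))).
      * apply sorted_app. split; [assumption|]. split; [apply blocks_sorted; auto; apply Y1|].
        intros a b Ha Hb. apply in_concat in Hb as (ys & Hys & Hb).
        apply in_map_iff in Hys as (x & <- & _). now apply (proj2 (proj2 (Y1 x))).
      * rewrite !length_app, !(length_concat_const (m := m)), !length_map; [now rewrite E| |];
          rewrite Forall_map; apply Forall_forall; intros x _; apply Y1.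
Qed.

End Canonical_sequences.

(** * Regularity, the strong limit property and uncountability *)

Lemma O_inhabited : inhabited O.
Proof. destruct (arrowO (fun _ => True)) as (h & _). exact (inhabits (h b0)). Qed.

(** If f is unbounded on γ, pick p(x) < γ with x ≤ f(p(x)). On h, the function p is below the
    constant γ and therefore constant; so f(p(x)) is constant as well, and the identity, which lies
    below this value at [b0], would have to be constant too. *)
Theorem Erdos_regular (f : O -> O) γ : exists δ, forall ξ, ltO ξ γ -> ltO (f ξ) δ.
Proof.
  apply NNPP. intros N.
  assert (N' : forall δ, exists ξ, ltO ξ γ /\ ~ ltO (f ξ) δ).
  { intros δ. apply NNPP. intros M. apply N. exists δ. intros ξ L.
    apply NNPP. intros L'. apply M. now exists ξ. }
  pose (p := fun x => epsilon O_inhabited (fun ξ => ltO ξ γ /\ ~ ltO (f ξ) x)).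
  assert (Hp : forall x, ltO (p x) γ /\ ~ ltO (f (p x)) x).
  { intros x. unfold p. apply epsilon_spec. apply N'. }
  destruct (canonical_regressive countable_nat (fun j l =>
    match j with 0 => γ | 1 => p (hd γ l) | 2 => f (p (hd γ l)) | _ => hd γ l end))
    as (h & I & _ & C2).
  assert (P : constant_on h 1 (fun l => p (hd γ l))).
  { apply (C2 1 0 [b0] []); [apply sorted_single|constructor| |simpl; apply Hp].
    intros z z' _ _ _ _. reflexivity. }
  assert (E : forall x y, p (h x) = p (h y)).
  { intros x y. apply (P [x] [y]); auto using sorted_single. }
  destruct (limB b0) as [b1 L]. destruct (limB b1) as [b2 L2].
  assert (Q : constant_on h 1 (fun l => hd γ l)).
  { apply (C2 3 2 [b0] [b0]); auto using sorted_single.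
    - intros z z' S1 S2 L1 L1'. simpl. f_equal. now apply P.
    (* Passing from b0 to b2 turns the weak inequality x ≤ f(p(x)) into a strict one. *)
    - simpl. rewrite (E b0 b2). apply (lt_le_trans WO) with (h b2); [|apply Hp].
      apply I. eapply wo_trans; eauto. }
  specialize (Q [b0] [b1]). simpl in Q. apply I in L. rewrite Q in L; auto using sorted_single.
  now apply (wo_irrefl WO) in L.
Qed.

(** With A x read as a subset of γ, this says that O does not inject into the power set of γ. If all
    these sets differ, let p(x, y) < γ be a point that separates those of x and y; it is constant on
    pairs from h. Three elements of h would then have pairwise different truth values at a single
    point. *)
Theorem Erdos_strong_limit (A : O -> O -> Prop) γ :
  exists x y, ltO x y /\ forall ξ, ltO ξ γ -> (A x ξ <-> A y ξ).
Proof.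
  apply NNPP. intros N.
  assert (N' : forall x y, ltO x y -> exists ξ, ltO ξ γ /\ ~ (A x ξ <-> A y ξ)).
  { intros x y L. apply NNPP. intros M. apply N. exists x, y. split; [assumption|].
    intros ξ L'. apply NNPP. intros L2. apply M. now exists ξ. }
  pose (p := fun x y => epsilon O_inhabited (fun ξ => ltO ξ γ /\ ~ (A x ξ <-> A y ξ))).
  assert (Hp : forall x y, ltO x y -> ltO (p x y) γ /\ ~ (A x (p x y) <-> A y (p x y))).
  { intros x y L. unfold p. apply epsilon_spec. now apply N'. }
  destruct (canonical_regressive countable_nat (fun j l =>
    match j with 0 => γ | _ => p (nth 0 l γ) (nth 1 l γ) end)) as (h & I & _ & C2).
  destruct (limB b0) as [b1 L1]. destruct (limB b1) as [b2 L2].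
  assert (L3 : ltB b0 b2) by (eapply wo_trans; eauto).
  assert (P : constant_on h 2 (fun l => p (nth 0 l γ) (nth 1 l γ))).
  { apply (C2 1 0 [b0; b1] []); [now apply sorted_pair|constructor| |].
    - intros z z' _ _ _ _. reflexivity.
    - simpl. now apply Hp, I. }
  assert (E1 := P [b0; b1] [b1; b2] (sorted_pair L1) (sorted_pair L2) eq_refl eq_refl).
  assert (E2 := P [b0; b1] [b0; b2] (sorted_pair L1) (sorted_pair L3) eq_refl eq_refl).
  simpl in E1, E2.
  destruct (Hp _ _ (I _ _ L1)) as [_ D1]. destruct (Hp _ _ (I _ _ L2)) as [_ D2].
  destruct (Hp _ _ (I _ _ L3)) as [_ D3]. rewrite <- E1 in D2. rewrite <- E2 in D3.
  destruct (classic (A (h b0) (p (h b0) (h b1)))), (classic (A (h b1) (p (h b0) (h b1)))),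
    (classic (A (h b2) (p (h b0) (h b1)))); tauto.
Qed.

(** Ask of a list whether r of its first entry is less than its length, and code the answer by two
    elements of O below a third. The answer is constant on lists from h of length r(h b0) + 1,
    although it tells [b0] from any c with r(h c) > r(h b0). *)
Theorem Erdos_uncountable (r : O -> nat) : ~ forall x y, ltO x y -> r x < r y.
Proof.
  intros Hr. destruct (limB b0) as [b1 L1]. destruct (limB b1) as [b2 L2].
  (* The trivial colouring provides three increasing elements of O. *)
  destruct (arrowO (fun _ => True)) as (h0 & I0 & _).
  destruct (canonical_regressive countable_nat (fun j l =>
    match j with 0 => h0 b2 | _ =>
      if r (hd (h0 b0) l) <? length l then h0 b0 else h0 b1 end)) as (h & I & _ & C2).
  pose (n := Datatypes.S (r (h b0))).
  assert (G : forall k, exists b, k <= r (h b)).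
  { induction k as [|k [b IH]]; [exists b0; lia|].
    destruct (limB b) as [c L]. exists c. apply I, Hr in L. lia. }
  destruct (G n) as [c Hc].
  destruct (sorted_from WB limB b0 (r (h b0))) as (t & T1 & T2).
  destruct (sorted_from WB limB c (r (h b0))) as (t' & T1' & T2').
  assert (P := C2 1 0 (b0 :: t) [] T2 (SSorted_nil _) ltac:(intros z z' _ _ _ _; reflexivity)).
  simpl in P. rewrite length_map, T1 in P.
  assert (Q : constant_on h n (fun l =>
     if r (hd (h0 b0) l) <? length l then h0 b0 else h0 b1)).
  { apply P. destruct (_ <? _); apply I0; [eapply wo_trans; eauto|assumption]. }
  specialize (Q (b0 :: t) (c :: t') T2 T2').
  simpl in Q. rewrite !length_map, T1, T1' in Q. specialize (Q eq_refl eq_refl).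
  replace (r (h b0) <? Datatypes.S (r (h b0))) with true in Q by (symmetry; apply Nat.ltb_lt; lia).
  replace (r (h c) <? Datatypes.S (r (h b0))) with false in Q
    by (symmetry; apply Nat.ltb_ge; unfold n in Hc; lia).
  apply I0 in L1. rewrite Q in L1. now apply (wo_irrefl WO) in L1.
Qed.

(** * Indiscernible regular points *)

Definition regular_at (x : O) : Prop :=
  forall (f : O -> O) γ, ltO γ x -> (forall ζ, ltO ζ γ -> ltO (f ζ) x) ->
    exists δ, ltO δ x /\ forall ζ, ltO ζ γ -> ltO (f ζ) δ.

(* T is intended to be V_κ, and bd an upper bound for the number of sets of a given rank. *)
Section Indiscernibles.
Context (K T : Type) (HK : countable K) (t0 : T) (rk code : T -> O) (bd : O -> O).
Context (Hcode : forall s, ltO (code s) (bd (rk s))).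
Context (Hinj : forall s s', rk s = rk s' -> code s = code s' -> s = s').

(** All properties come from one family of functions. Where the exceptional case (singularity, or a
    parameter that breaks indiscernibility) does not occur, functions 2 and 5 return the first entry
    of the list. A value below an earlier term of h can therefore be constant only if the
    exceptional case persists on all later lists. *)
Theorem good_indiscernibles (u0 : O) (Ψ : K -> list O -> T -> Prop) :
  exists h, increasing ltB ltO h /\ (forall x, ~ ltO (h x) u0) /\
    (forall x, regular_at (h x)) /\
    forall i a t a' t' s, sorted ltB (a :: t) -> sorted ltB (a' :: t') -> length t = length t' ->
      ltO (rk s) (h a) -> ltO (rk s) (h a') ->
      (Ψ i (map h (a :: t)) s <-> Ψ i (map h (a' :: t')) s).
Proof.
  (* The pair p = (γ, f) consists of some γ < x and a map f of γ cofinally into x. *)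
  pose (sing := fun x (p : O * (O -> O)) =>
    ltO (fst p) x /\ (forall ζ, ltO ζ (fst p) -> ltO (snd p ζ) x) /\
    forall δ, ltO δ x -> exists ζ, ltO ζ (fst p) /\ ~ ltO (snd p ζ) δ).
  pose (cg := fun x => epsilon (inhabits (u0, fun y : O => y)) (sing x)).
  assert (Hcg : forall x, ~ regular_at x -> sing x (cg x)).
  { intros x N. unfold cg. apply epsilon_spec. apply NNPP. intros M. apply N.
    intros f γ L1 L2. apply NNPP. intros M'. apply M. exists (γ, f).
    split; [assumption|]. split; [assumption|]. intros δ Lδ.
    apply NNPP. intros M2. apply M'. exists δ. split; [assumption|]. intros ζ Lζ.
    apply NNPP. intros M3. apply M2. exists ζ. now split. }
  (* An index at which the chosen cofinal map into y reaches x. *)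
  pose (cut := fun x y => epsilon (inhabits u0)
    (fun ζ => ltO ζ (fst (cg y)) /\ ~ ltO (snd (cg y) ζ) x)).
  (* The list l is meant to be a concatenation of two lists of equal length; s is a parameter on
     which they disagree. *)
  pose (bad := fun i (l : list O) s => ltO (rk s) (hd u0 l) /\
    ~ (Ψ i (firstn (Nat.div2 (length l)) l) s <-> Ψ i (skipn (Nat.div2 (length l)) l) s)).
  pose (wit := fun i l => epsilon (inhabits t0) (bad i l)).
  destruct HK as [enum _]. pose (k0 := enum 0).
  destruct (@canonical_regressive (nat * K) (countable_prod countable_nat HK) (fun j l =>
    match fst j with
    | 0 => u0
    | 1 => hd u0 l
    | 2 => if excluded_middle_informative (regular_at (hd u0 l)) then hd u0 l
           else fst (cg (hd u0 l))
    | 3 => cut (nth 0 l u0) (nth 1 l u0)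
    | 4 => snd (cg (nth 0 l u0)) (cut (nth 0 l u0) (nth 1 l u0))
    | 5 => if excluded_middle_informative (exists s, bad (snd j) l s)
           then rk (wit (snd j) l) else hd u0 l
    | 6 => bd (if excluded_middle_informative (exists s, bad (snd j) l s)
           then rk (wit (snd j) l) else hd u0 l)
    | _ => code (wit (snd j) l)
    end)) as (h & I & C1 & C2).
  exists h. split; [assumption|].
  assert (NC : forall x y, ltB x y -> h x = h y -> False).
  { intros x y L E. apply I in L. rewrite E in L. now apply (wo_irrefl WO) in L. }
  split; [|split].
  - intros x L. destruct (limB x) as [y Hy]. apply (NC x y Hy).
    assert (Q := C2 (1, k0) (0, k0) [x] [] (sorted_single _ _) (SSorted_nil _)
      ltac:(intros z z' _ _ _ _; reflexivity) L).
    apply (Q [x] [y]); auto using sorted_single.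
  - intros x0. apply NNPP. intros N.
    set (F2 := fun l => if excluded_middle_informative (regular_at (hd u0 l)) then hd u0 l
           else fst (cg (hd u0 l))).
    assert (F2x : F2 [h x0] = fst (cg (h x0))).
    { unfold F2; simpl. destruct (excluded_middle_informative _); [contradiction|reflexivity]. }
    (* The length of the cofinal map into h x0 is a regressive value. Hence all later terms are
       singular too, with cofinal maps of this same length. *)
    assert (P2 : constant_on h 1 F2).
    { apply (C1 (2, k0) [x0]); [apply sorted_single|]. exists x0, []. split; [reflexivity|].
      change (ltO (F2 [h x0]) (h x0)). rewrite F2x. apply (Hcg _ N). }
    assert (Hx : forall x, x = x0 \/ ltB x0 x -> ~ regular_at (h x) /\ fst (cg (h x)) = fst (cg (h x0))).
    { intros x Ex. assert (E := P2 [x0] [x] (sorted_single _ _) (sorted_single _ _) eq_refl eq_refl).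
      change (F2 [h x0] = F2 [h x]) in E. rewrite F2x in E.
      unfold F2 in E; simpl in E. destruct (excluded_middle_informative (regular_at (h x))) as [R|R].
      - exfalso. destruct (Hcg _ N) as [L _]. rewrite E in L.
        destruct Ex as [->|Ex]; [contradiction|]. apply I in Ex.
        apply (wo_irrefl WO (x := h x)). eapply wo_trans; eauto.
      - now split. }
    destruct (limB x0) as [x1 L1]. destruct (limB x1) as [x2 L2]. destruct (limB x2) as [x3 L3].
    assert (L02 : ltB x0 x2) by (eapply wo_trans; eauto).
    assert (Hcut : forall x y, ltB x0 x -> ltB x y ->
      ltO (cut (h x) (h y)) (fst (cg (h y))) /\ ~ ltO (snd (cg (h y)) (cut (h x) (h y))) (h x)).
    { intros x y Lx Ly. unfold cut. apply epsilon_spec.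
      destruct (Hx y) as [Ry _]; [right; eapply wo_trans; eauto|].
      destruct (Hcg _ Ry) as (_ & _ & S3). apply S3. now apply I. }
    (* The cut index lies below the common length, which is constant, so the cut index is constant
       on pairs. *)
    assert (P3 : constant_on h 2 (fun l => cut (nth 0 l u0) (nth 1 l u0))).
    { apply (C2 (3, k0) (2, k0) [x1; x2] [x0]); auto using sorted_single, sorted_pair.
      change (ltO (cut (h x1) (h x2)) (F2 [h x0])). rewrite F2x.
      rewrite <- (proj2 (Hx x2 (or_intror L02))). now apply Hcut. }
    assert (E3 := P3 [x1; x2] [x2; x3] (sorted_pair L2) (sorted_pair L3) eq_refl eq_refl).
    simpl in E3.
    (* At the common cut index the map into h x1 has a value below h x1. This value is regressive,
       so the map into h x2 has the same value there; but by the choice of the index that map has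
       reached h x1. *)
    assert (Lc : ltO (snd (cg (h x1)) (cut (h x1) (h x2))) (h x1)).
    { destruct (Hx x1 (or_intror L1)) as [R1 E1]. destruct (Hcg _ R1) as (_ & S2 & _).
      apply S2. rewrite E1. rewrite <- (proj2 (Hx x2 (or_intror L02))). now apply Hcut. }
    assert (P4 : constant_on h 2 (fun l => snd (cg (nth 0 l u0)) (cut (nth 0 l u0) (nth 1 l u0)))).
    { apply (C1 (4, k0) [x1; x2]); [now apply sorted_pair|]. exists x1, [x2]. now split. }
    assert (E4 := P4 [x1; x2] [x2; x3] (sorted_pair L2) (sorted_pair L3) eq_refl eq_refl).
    simpl in E4. rewrite E4, <- E3 in Lc.
    now apply (proj2 (Hcut x1 x2 L1 L2)).
  - intros i.
    assert (half : forall u v : list O, length u = length v ->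
      firstn (Nat.div2 (length (u ++ v))) (u ++ v) = u /\
      skipn (Nat.div2 (length (u ++ v))) (u ++ v) = v).
    { intros u v E. rewrite length_app.
      replace (Nat.div2 (length u + length v)) with (length u).
      - rewrite firstn_app, skipn_app, Nat.sub_diag, firstn_all, skipn_all. simpl.
        now rewrite app_nil_r.
      - rewrite <- E. replace (length u + length u) with (2 * length u) by lia.
        now rewrite Nat.div2_double. }
    assert (bad_iff : forall u v a t s, u = a :: t -> length u = length v ->
      (bad i (map h (u ++ v)) s <-> ltO (rk s) (h a) /\ ~ (Ψ i (map h u) s <-> Ψ i (map h v) s))).
    { intros u v a t s E El. unfold bad. rewrite map_app.
      destruct (half (map h u) (map h v)) as [-> ->]; [now rewrite !length_map|].
      subst u. simpl. tauto. }
    assert (none : forall u v a t s, u = a :: t -> length u = length v -> sorted ltB (u ++ v) ->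
      ltO (rk s) (h a) -> (Ψ i (map h u) s <-> Ψ i (map h v) s)).
    { intros u v a t s Eu El Suv Ls. apply NNPP. intros D.
      assert (Bad : exists s, bad i (map h (u ++ v)) s).
      { exists s. apply (bad_iff u v a t); auto. }
      set (n := length u) in *.
      assert (Luv : length (u ++ v) = n + n) by (rewrite length_app; lia).
      set (F5 := fun l => if excluded_middle_informative (exists s, bad i l s)
           then rk (wit i l) else hd u0 l).
      assert (F5b : forall l, (exists s, bad i l s) -> F5 l = rk (wit i l) /\ bad i l (wit i l)).
      { intros l E. unfold F5. destruct (excluded_middle_informative _); [|contradiction].
        split; [reflexivity|]. unfold wit. apply epsilon_spec. assumption. }
      destruct (F5b _ Bad) as [E5 B5].
      assert (L5 : ltO (F5 (map h (u ++ v))) (h a)).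
      { rewrite E5. now apply (bad_iff u v a t) in B5. }
      assert (P5 : constant_on h (n + n) F5).
      { rewrite <- Luv. apply (C1 (5, i)); [assumption|].
        exists a, (t ++ v). split; [now rewrite Eu|exact L5]. }
      assert (P6 : constant_on h (n + n) (fun l => bd (F5 l))).
      { intros z z' S1 S2 H1 H2. f_equal. now apply P5. }
      (* The code of the witness lies below a bound that depends only on its rank and is constant
         with it. Rank and code together determine the witness. *)
      assert (P7 : constant_on h (n + n) (fun l => code (wit i l))).
      { rewrite <- Luv. apply (C2 (7, i) (6, i) (u ++ v) (u ++ v)); auto.
        - rewrite Luv. exact P6.
        - change (ltO (code (wit i (map h (u ++ v)))) (bd (F5 (map h (u ++ v))))).
          rewrite E5. apply Hcode. }
      assert (all_bad : forall u' v' a' t', u' = a' :: t' -> length u' = n -> length v' = n ->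
        sorted ltB (u' ++ v') -> ltB a a' ->
        wit i (map h (u' ++ v')) = wit i (map h (u ++ v)) /\
        ~ (Ψ i (map h u') (wit i (map h (u ++ v))) <-> Ψ i (map h v') (wit i (map h (u ++ v))))).
      { intros u' v' a' t' Eu' L1 L2 S' La.
        assert (L' : length (u' ++ v') = n + n) by (rewrite length_app; lia).
        assert (E1 := P5 _ _ Suv S' Luv L').
        assert (Bad' : exists s, bad i (map h (u' ++ v')) s).
        { apply NNPP. intros NB. unfold F5 in E1 at 2.
          destruct (excluded_middle_informative _); [contradiction|].
          rewrite Eu' in E1. simpl in E1. rewrite E1 in L5.
          apply (wo_irrefl WO (x := h a)). eapply wo_trans; [exact WO|apply I, La|exact L5]. }
        destruct (F5b _ Bad') as [E5' B5'].
        assert (W : wit i (map h (u' ++ v')) = wit i (map h (u ++ v))).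
        { apply Hinj; [congruence|]. now apply P7. }
        split; [assumption|]. apply (bad_iff u' v' a' t') in B5'; auto; [|lia].
        rewrite W in B5'. apply B5'. }
      (* On three blocks of length n above u and v, the truth values of Ψ at the one common witness
         would be pairwise different. *)
      destruct (sorted_beyond WB b0 limB (u ++ v) (n + (n + n))) as (w & W1 & W2 & W3).
      rewrite <- (firstn_skipn n w) in W2, W3.
      assert (Lw1 : length (firstn n w) = n) by (rewrite length_firstn; lia).
      assert (Lw2 : length (skipn n w) = n + n) by (rewrite length_skipn; lia).
      remember (firstn n w) as x eqn:Ex. remember (skipn n w) as w' eqn:Ew.
      rewrite <- (firstn_skipn n w') in W2, W3.
      assert (Ly : length (firstn n w') = n) by (rewrite length_firstn; lia).
      assert (Lz : length (skipn n w') = n) by (rewrite length_skipn; lia).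
      remember (firstn n w') as y eqn:Ey. remember (skipn n w') as z eqn:Ez.
      assert (Hn : 0 < n) by (unfold n; rewrite Eu; simpl; lia).
      destruct x as [|ax tx]; [simpl in Lw1; lia|]. destruct y as [|ay ty]; [simpl in Ly; lia|].
      assert (Ha : In a (u ++ v)) by (rewrite Eu; simpl; auto).
      apply sorted_app in W2 as (X1 & X2 & X3). apply sorted_app in X2 as (X2 & X4 & X5).
      destruct (all_bad (ax :: tx) (ay :: ty) ax tx eq_refl Lw1 Ly) as [_ D1].
      { apply sorted_app. repeat split; auto. intros b c Hb Hc. apply X3; auto.
        apply in_or_app; auto. }
      { apply W3; auto. simpl; auto. }
      destruct (all_bad (ax :: tx) z ax tx eq_refl Lw1 Lz) as [_ D2].
      { apply sorted_app. repeat split; auto. intros b c Hb Hc. apply X3; auto.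
        apply in_or_app; auto. }
      { apply W3; auto. simpl; auto. }
      destruct (all_bad (ay :: ty) z ay ty eq_refl Ly Lz) as [_ D3].
      { apply sorted_app. repeat split; auto. }
      { apply W3; auto. apply in_or_app. right. simpl; auto. }
      clear - D1 D2 D3. tauto. }
    intros a t a' t' s S1 S2 El La La'.
    (* The two lists may interleave, so each is compared with a common later list. *)
    destruct (sorted_beyond WB b0 limB ((a :: t) ++ (a' :: t')) (length (a :: t))) as (w & W1 & W2 & W3).
    rewrite (none (a :: t) w a t s), (none (a' :: t') w a' t' s); auto; try reflexivity.
    + simpl in *. lia.
    + apply sorted_app. repeat split; auto. intros b c Hb Hc. apply W3; auto.
      apply in_or_app; auto.
    + apply sorted_app. repeat split; auto. intros b c Hb Hc. apply W3; auto.
      apply in_or_app; auto.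
Qed.

End Indiscernibles.

End Erdos_order.

(** * Set theory in a universe with full separation and replacement *)

Section Universe.
Context (U : set_structure) (hU : set_universe U).

Lemma set_ext (x y : U) : (forall z, z ∈ x <-> z ∈ y) -> x = y.
Proof. apply (zfc_extensionality hU). Qed.

Definition sep (A : U -> Prop) (x : U) : U :=
  proj1_sig (constructive_indefinite_description _ (zfc_separation hU (A := A) I x)).

Lemma in_sep A x z : z ∈ sep A x <-> z ∈ x /\ A z.
Proof. exact (proj2_sig (constructive_indefinite_description _ (zfc_separation hU (A := A) I x)) z). Qed.

Definition upr (x y : U) : U :=
  proj1_sig (constructive_indefinite_description _ (zfc_pairing hU x y)).

Lemma in_upr x y z : z ∈ upr x y <-> z = x \/ z = y.
Proof. exact (proj2_sig (constructive_indefinite_description _ (zfc_pairing hU x y)) z). Qed.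

Definition union (x : U) : U :=
  proj1_sig (constructive_indefinite_description _ (zfc_union hU x)).

Lemma in_union x z : z ∈ union x <-> exists y, y ∈ x /\ z ∈ y.
Proof. exact (proj2_sig (constructive_indefinite_description _ (zfc_union hU x)) z). Qed.

Definition power (x : U) : U :=
  proj1_sig (constructive_indefinite_description _ (zfc_power hU x)).

Lemma in_power x z : z ∈ power x <-> z ⊆ x.
Proof. exact (proj2_sig (constructive_indefinite_description _ (zfc_power hU x)) z). Qed.

Lemma image_exists (g : U -> U) (x : U) : exists y, forall v, v ∈ y <-> exists u, u ∈ x /\ v = g u.
Proof. apply (zfc_replacement hU (A := fun u v => v = g u) I). intros u _ v v' -> ->. reflexivity. Qed.

Definition image (g : U -> U) (x : U) : U :=
  proj1_sig (constructive_indefinite_description _ (image_exists g x)).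

Lemma in_image g x v : v ∈ image g x <-> exists u, u ∈ x /\ v = g u.
Proof. exact (proj2_sig (constructive_indefinite_description _ (image_exists g x)) v). Qed.

Definition empty : U :=
  sep (fun _ => False) (proj1_sig (constructive_indefinite_description _ (zfc_infinity hU))).

Lemma in_empty z : ~ z ∈ empty.
Proof. unfold empty. rewrite in_sep. tauto. Qed.

Lemma empty_unique (z : U) : is_empty z <-> z = empty.
Proof.
  split; [|intros ->; exact in_empty]. intros H. apply set_ext. intros w.
  split; intros Hw; [now apply H in Hw|now apply in_empty in Hw].
Qed.

Definition cup (x y : U) : U := union (upr x y).

Lemma in_cup x y z : z ∈ cup x y <-> z ∈ x \/ z ∈ y.
Proof.
  unfold cup. rewrite in_union. split.
  - intros (w & Hw & Hz). apply in_upr in Hw as [->| ->]; auto.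
  - intros [H|H]; [exists x|exists y]; rewrite in_upr; auto.
Qed.

Definition suc (x : U) : U := cup x (upr x x).

Lemma in_suc x z : z ∈ suc x <-> z ∈ x \/ z = x.
Proof. unfold suc. rewrite in_cup, in_upr. tauto. Qed.

Lemma is_succ_iff x y : is_succ y x <-> y = suc x.
Proof.
  split; [|intros ->; exact (in_suc x)].
  intros H. apply set_ext. intros z. rewrite in_suc. apply H.
Qed.

Lemma is_upair_iff (p x y : U) : is_upair p x y <-> p = upr x y.
Proof.
  split; [|intros ->; exact (in_upr x y)].
  intros H. apply set_ext. intros z. rewrite in_upr. apply H.
Qed.

Definition opair (x y : U) : U := upr (upr x x) (upr x y).

Lemma is_pair_iff (p x y : U) : is_pair p x y <-> p = opair x y.
Proof.
  unfold is_pair. split.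
  - intros (u & v & H1 & H2 & H3). apply is_upair_iff in H1, H2, H3. now subst.
  - intros ->. exists (upr x x), (upr x y). now rewrite !is_upair_iff.
Qed.

Lemma upr_inj x y x' y' : upr x y = upr x' y' -> (x = x' /\ y = y') \/ (x = y' /\ y = x').
Proof.
  intros E.
  assert (H : forall z, z = x \/ z = y <-> z = x' \/ z = y').
  { intros z. rewrite <- !in_upr, E. tauto. }
  destruct (proj1 (H x) (or_introl eq_refl)) as [->| ->];
  destruct (proj1 (H y) (or_intror eq_refl)) as [->| ->]; auto;
  [destruct (proj2 (H y') (or_intror eq_refl)) as [->| ->]
  |destruct (proj2 (H x') (or_introl eq_refl)) as [->| ->]]; auto.
Qed.

Lemma opair_inj x y x' y' : opair x y = opair x' y' -> x = x' /\ y = y'.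
Proof.
  unfold opair. intros E. apply upr_inj in E as [[E1 E2]|[E1 E2]].
  - apply upr_inj in E1 as [[-> _]|[-> _]]; apply upr_inj in E2 as [[_ ->]|[E2 ->]]; auto.
  - apply upr_inj in E1, E2. intuition congruence.
Qed.

(** * Relations and functions as sets *)

Definition rel (R : U -> U -> Prop) (X Y : U) : U :=
  sep (fun p => exists x y, x ∈ X /\ y ∈ Y /\ R x y /\ p = opair x y) (power (power (cup X Y))).

Lemma in_rel R X Y p :
  p ∈ rel R X Y <-> exists x y, x ∈ X /\ y ∈ Y /\ R x y /\ p = opair x y.
Proof.
  unfold rel. rewrite in_sep. split; [tauto|]. intros H. split; [|exact H].
  destruct H as (x & y & Hx & Hy & _ & ->). apply in_power. intros z Hz.
  apply in_power. intros w Hw. apply in_cup. apply in_upr in Hz as [->| ->];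
    apply in_upr in Hw as [->| ->]; auto.
Qed.

Lemma maps_iff (f x y : U) : maps f x y <-> opair x y ∈ f.
Proof.
  unfold maps. split.
  - intros (p & Hp & H). apply is_pair_iff in Hp. now subst.
  - intros H. exists (opair x y). now rewrite is_pair_iff.
Qed.

Lemma maps_rel R X Y x y : maps (rel R X Y) x y <-> x ∈ X /\ y ∈ Y /\ R x y.
Proof.
  rewrite maps_iff, in_rel. split.
  - intros (x' & y' & H1 & H2 & H3 & E). apply opair_inj in E as [-> ->]. auto.
  - intros (H1 & H2 & H3). exists x, y. auto.
Qed.

Lemma is_relation_rel R X Y : is_relation (rel R X Y) X Y.
Proof.
  intros p Hp. apply in_rel in Hp as (x & y & Hx & Hy & _ & ->).
  exists x, y. now rewrite is_pair_iff.
Qed.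

Definition graph (g : U -> U) (X Y : U) : U := rel (fun x y => y = g x) X Y.

Lemma maps_graph g X Y x y : maps (graph g X Y) x y <-> x ∈ X /\ y ∈ Y /\ y = g x.
Proof. exact (maps_rel (fun x y => y = g x) X Y x y). Qed.

Lemma is_function_graph g (X Y : U) : (forall x, x ∈ X -> g x ∈ Y) -> is_function (graph g X Y) X Y.
Proof.
  intros H. split; [apply is_relation_rel|]. intros u Hu. exists (g u).
  split; [rewrite maps_graph; auto|]. intros v Hv. apply maps_graph in Hv. symmetry; apply Hv.
Qed.

Lemma maps_dom (f X Y u v : U) : is_relation f X Y -> maps f u v -> u ∈ X /\ v ∈ Y.
Proof.
  intros H (p & Hp & Hf). apply is_pair_iff in Hp. subst.
  apply H in Hf as (u' & v' & Hu & Hv & E). apply is_pair_iff, opair_inj in E as [-> ->]. auto.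
Qed.

Definition fapp (f u : U) : U := epsilon (inhabits empty) (fun v => maps f u v).

Lemma fapp_maps (f X Y u : U) : is_function f X Y -> u ∈ X -> maps f u (fapp f u).
Proof.
  intros [_ H] Hu. unfold fapp. apply epsilon_spec. destruct (H u Hu) as (v & Hv & _). now exists v.
Qed.

Lemma fapp_in (f X Y u : U) : is_function f X Y -> u ∈ X -> fapp f u ∈ Y.
Proof. intros H Hu. apply (maps_dom (proj1 H) (fapp_maps H Hu)). Qed.

Lemma fapp_unique (f X Y u v : U) : is_function f X Y -> maps f u v -> v = fapp f u.
Proof.
  intros H Hv. destruct (maps_dom (proj1 H) Hv) as [Hu _].
  destruct (proj2 H u Hu) as (w & _ & Hw). rewrite <- (Hw v Hv). apply Hw.
  apply (fapp_maps H Hu).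
Qed.

(** * Foundation and ordinals *)

Lemma not_self (x : U) : ~ x ∈ x.
Proof.
  intros H. destruct (zfc_foundation hU (x := upr x x)) as (y & Hy & N).
  - exists x. apply in_upr. auto.
  - apply in_upr in Hy. assert (y = x) as -> by tauto. apply (N x); [apply in_upr; auto|assumption].
Qed.

Lemma not_cycle3 (x y z : U) : x ∈ y -> y ∈ z -> z ∈ x -> False.
Proof.
  intros H1 H2 H3. destruct (zfc_foundation hU (x := cup (upr x y) (upr z z))) as (w & Hw & N).
  - exists x. rewrite in_cup, in_upr. auto.
  - assert (I : forall w, w = x \/ w = y \/ w = z -> w ∈ cup (upr x y) (upr z z)).
    { intros v. rewrite in_cup, !in_upr. tauto. }
    rewrite in_cup, !in_upr in Hw.
    destruct Hw as [[->| ->]|[->| ->]]; [apply (N z)|apply (N x)|apply (N y)|apply (N y)]; auto.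
Qed.

Lemma not_cycle2 (x y : U) : x ∈ y -> y ∈ x -> False.
Proof.
  intros H1 H2. destruct (zfc_foundation hU (x := upr x y)) as (w & Hw & N).
  - exists x. rewrite in_upr. auto.
  - apply in_upr in Hw as [->| ->]; [apply (N y)|apply (N x)]; auto; apply in_upr; auto.
Qed.

Lemma ordinal_elem (x y : U) : ordinal x -> y ∈ x -> ordinal y.
Proof.
  intros (T & L & W) Hy. split; [|split].
  - intros z Hz w Hw. assert (z ∈ x) by (eapply T; eauto). assert (w ∈ x) by (eapply T; eauto).
    destruct (L w y) as [H1|[H1|H1]]; auto; exfalso.
    + subst w. exact (not_cycle2 Hz Hw).
    + exact (not_cycle3 H1 Hw Hz).
  - intros u v Hu Hv. apply L; eapply T; eauto.
  - intros u Hu. apply W. intros z Hz. eapply T; eauto.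
Qed.

(** A minimal element of a outside x has the same elements as x. *)
Lemma transitive_initial (x a : U) : ordinal a -> transitive x -> x ⊆ a -> x = a \/ x ∈ a.
Proof.
  intros Oa T I. destruct (classic (x = a)) as [|N]; [now left|right].
  destruct (zfc_foundation hU (x := sep (fun z => ~ z ∈ x) a)) as (y & Hy & M).
  - apply NNPP. intros N'. apply N. apply set_ext. intros z. split; [apply I|].
    intros Hz. apply NNPP. intros N2. apply N'. exists z. now apply in_sep.
  - apply in_sep in Hy as [Hy Ny]. assert (x = y) as ->; [|assumption].
    apply set_ext. intros z. split; intros Hz.
    + destruct (proj1 (proj2 Oa) z y) as [H|[->|H]]; auto; [contradiction|].
      exfalso. apply Ny. now apply (T z).
    + apply NNPP. intros N2. apply (M z); [|assumption]. apply in_sep. split; [|assumption].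
      now apply (proj1 Oa y).
Qed.

(** The intersection of x and y is transitive, so it equals x or belongs to x, and likewise for y.
    It cannot belong to both, for then it would be an element of itself. *)
Lemma ordinal_trichotomy (x y : U) : ordinal x -> ordinal y -> x ∈ y \/ x = y \/ y ∈ x.
Proof.
  intros Ox Oy. set (c := sep (fun z => z ∈ y) x).
  assert (Tc : transitive c).
  { intros z Hz w Hw. apply in_sep in Hz as [H1 H2]. apply in_sep. split.
    - now apply (proj1 Ox z).
    - now apply (proj1 Oy z). }
  destruct (transitive_initial Ox Tc) as [E1|E1]; [intros z Hz; now apply in_sep in Hz| |];
  (destruct (transitive_initial Oy Tc) as [E2|E2]; [intros z Hz; now apply in_sep in Hz| |]).
  - right; left. congruence.
  - left. now rewrite <- E1.
  - right; right. now rewrite <- E2.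
  - exfalso. apply (not_self (x := c)). apply in_sep. auto.
Qed.

Lemma transitive_ordinals (x : U) : transitive x -> (forall y, y ∈ x -> ordinal y) -> ordinal x.
Proof.
  intros T H. split; [assumption|]. split.
  - intros y z Hy Hz. now apply ordinal_trichotomy; apply H.
  - intros u _ E. destruct (zfc_foundation hU E) as (y & H1 & H2). now exists y.
Qed.

Lemma ordinal_subset (x y : U) : ordinal x -> ordinal y -> (x ⊆ y <-> x ∈ y \/ x = y).
Proof.
  intros Ox Oy. split.
  - intros I. destruct (transitive_initial Oy (proj1 Ox) I); auto.
  - intros [H| ->]; [now apply (proj1 Oy)|now intros z].
Qed.

Lemma ordinal_not_in (x y : U) : ordinal x -> ordinal y -> ~ x ∈ y -> y ⊆ x.
Proof.
  intros Ox Oy N. apply ordinal_subset; auto.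
  destruct (ordinal_trichotomy Ox Oy) as [H|[H|H]]; auto. contradiction.
Qed.

Lemma ordinal_suc (x : U) : ordinal x -> ordinal (suc x).
Proof.
  intros Ox. apply transitive_ordinals.
  - intros y Hy z Hz. apply in_suc in Hy as [Hy| ->]; apply in_suc; left; [|assumption].
    now apply (proj1 Ox y).
  - intros y Hy. apply in_suc in Hy as [Hy| ->]; [|assumption]. eapply ordinal_elem; eauto.
Qed.

Lemma ordinal_ind (P : U -> Prop) :
  (forall a, ordinal a -> (forall b, b ∈ a -> P b) -> P a) -> forall a, ordinal a -> P a.
Proof.
  intros H a Oa. apply NNPP. intros N.
  destruct (zfc_foundation hU (x := sep (fun b => ~ P b) (suc a))) as (b & Hb & M).
  - exists a. apply in_sep. rewrite in_suc. auto.
  - apply in_sep in Hb as [Hb Nb]. apply Nb.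
    assert (Ob : ordinal b) by (eapply ordinal_elem; [apply (ordinal_suc Oa)|assumption]).
    apply H; [assumption|].
    intros c Hc. apply NNPP. intros Nc. apply (M c); [|assumption]. apply in_sep.
    split; [|assumption]. now apply (proj1 (ordinal_suc Oa) b).
Qed.

Lemma ordinal_least (P : U -> Prop) : (exists a, ordinal a /\ P a) ->
  exists a, ordinal a /\ P a /\ forall b, b ∈ a -> ~ P b.
Proof.
  intros (a & Oa & Pa). apply NNPP. intros N. revert Pa. pattern a. apply ordinal_ind; [|assumption].
  clear a Oa. intros a Oa IH Pa. apply N. exists a. auto.
Qed.

Lemma no_set_of_ordinals (X : U) : ~ forall a, ordinal a -> a ∈ X.
Proof.
  intros H. set (Y := sep (@ordinal U) X).
  assert (O : ordinal Y).
  { apply transitive_ordinals.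
    - intros y Hy z Hz. apply in_sep in Hy as [_ Hy]. apply in_sep.
      assert (ordinal z) by (eapply ordinal_elem; eauto). auto.
    - intros y Hy. now apply in_sep in Hy. }
  apply (not_self (x := Y)). apply in_sep. auto.
Qed.

Lemma sub_eq (d : U) (x y : sub d) : proj1_sig x = proj1_sig y -> x = y.
Proof.
  destruct x as [x Hx], y as [y Hy]; simpl. intros ->. f_equal. apply proof_irrelevance.
Qed.

Lemma sub_well_order (a : U) : ordinal a -> well_order (@mem (sub a)).
Proof.
  intros Oa. split.
  - intros [x Hx]. assert (Ox := ordinal_elem Oa Hx). revert Hx. pattern x. apply ordinal_ind; [|assumption].
    clear x Ox. intros x Ox IH Hx. constructor. intros [y Hy] L. simpl in L. now apply IH.
  - intros [x Hx] [y Hy] [z Hz]; simpl. intros H1 H2. now apply (proj1 (ordinal_elem Oa Hz) y).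
  - intros x y. destruct (proj1 (proj2 Oa) _ _ (proj2_sig x) (proj2_sig y)) as [H|[H|H]]; auto.
    right; left. now apply sub_eq.
Qed.

Lemma limit_no_max (a : U) : limit_ordinal a -> forall x : sub a, exists y, x ∈ y.
Proof.
  intros (_ & _ & L) [x Hx]. destruct (L x Hx) as (z & Hz & H). now exists (exist _ z Hz).
Qed.

Lemma limit_suc (a x : U) : limit_ordinal a -> x ∈ a -> suc x ∈ a.
Proof.
  intros (Oa & _ & L) Hx. destruct (L x Hx) as (z & Hz & H).
  assert (Oz := ordinal_elem Oa Hz). assert (Ox := ordinal_elem Oa Hx).
  assert (I : suc x ⊆ z).
  { intros w Hw. apply in_suc in Hw as [Hw| ->]; [|assumption]. now apply (proj1 Oz x). }
  apply (ordinal_subset (ordinal_suc Ox) Oz) in I as [I| ->]; [|assumption].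
  now apply (proj1 Oa z).
Qed.

(** * Natural numbers *)

Definition num (n : nat) : U := Nat.iter n suc empty.

Lemma num_ordinal n : ordinal (num n).
Proof.
  induction n as [|n IH]; [|now apply ordinal_suc].
  apply transitive_ordinals; intros x Hx; now apply in_empty in Hx.
Qed.

Lemma in_num n x : x ∈ num n <-> exists m, m < n /\ x = num m.
Proof.
  induction n as [|n IH].
  - split; [intros H; now apply in_empty in H|]. intros (m & H & _); lia.
  - change (num (Datatypes.S n)) with (suc (num n)). rewrite in_suc, IH. split.
    + intros [(m & H & ->)| ->]; [exists m|exists n]; split; (lia || reflexivity).
    + intros (m & H & ->). destruct (Nat.eq_dec m n) as [->|]; [now right|left].
      exists m. split; [lia|reflexivity].
Qed.

Lemma num_inj n m : num n = num m -> n = m.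
Proof.
  intros E. destruct (lt_eq_lt_dec n m) as [[L|L]|L]; [|assumption|]; exfalso.
  - apply (not_self (x := num m)). apply in_num. exists n. auto.
  - apply (not_self (x := num n)). apply in_num. exists m. auto.
Qed.

Lemma omega_exists : exists w, forall x, x ∈ w <-> exists n, x = num n.
Proof.
  destruct (zfc_infinity hU) as (x & (z & Hz & Hzx) & H).
  exists (sep (fun y => exists n, y = num n) x). intros y. rewrite in_sep.
  split; [tauto|]. intros [n ->]. split; [|now exists n].
  induction n as [|n IH].
  - apply empty_unique in Hz. now subst.
  - destruct (H _ IH) as (s & Hs & Hsx). apply is_succ_iff in Hs. now subst.
Qed.

Definition omega : U := proj1_sig (constructive_indefinite_description _ omega_exists).

Lemma in_omega x : x ∈ omega <-> exists n, x = num n.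
Proof. exact (proj2_sig (constructive_indefinite_description _ omega_exists) x). Qed.

Lemma omega_ordinal : ordinal omega.
Proof.
  apply transitive_ordinals.
  - intros x Hx y Hy. apply in_omega in Hx as [n ->]. apply in_num in Hy as (m & _ & ->).
    apply in_omega. now exists m.
  - intros x Hx. apply in_omega in Hx as [n ->]. apply num_ordinal.
Qed.

Lemma positive_iff (x : U) : positive x <-> empty ∈ x.
Proof.
  unfold positive. split.
  - intros (z & Hz & H). apply empty_unique in Hz. now subst.
  - intros H. exists empty. split; [exact in_empty|assumption].
Qed.

Lemma omega_limit : limit_ordinal omega.
Proof.
  split; [apply omega_ordinal|]. split.
  - apply positive_iff, in_omega. now exists 0.
  - intros x Hx. apply in_omega in Hx as [n ->]. exists (num (Datatypes.S n)). split.
    + apply in_omega. now eexists.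
    + apply in_num. exists n. auto.
Qed.

Lemma num_not_limit n : ~ limit_ordinal (num n).
Proof.
  intros (_ & P & L). apply positive_iff, in_num in P as (m & Hm & _).
  destruct n as [|n]; [lia|]. destruct (L (num n)) as (z & Hz & H).
  - apply in_num. exists n. auto.
  - apply in_num in Hz as (k & Hk & ->). apply in_num in H as (p & Hp & E).
    apply num_inj in E. lia.
Qed.

Lemma is_omega_iff (w : U) : is_omega w <-> w = omega.
Proof.
  split.
  - intros [L N]. destruct (ordinal_trichotomy (proj1 L) omega_ordinal) as [H|[H|H]]; [|assumption|].
    + apply in_omega in H as [n ->]. exfalso. now apply (num_not_limit (n := n)).
    + exfalso. apply (N _ H omega_limit).
  - intros ->. split; [apply omega_limit|]. intros y Hy. apply in_omega in Hy as [n ->].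
    apply num_not_limit.
Qed.

Lemma limit_omega_le (x : U) : limit_ordinal x -> x = omega \/ omega ∈ x.
Proof.
  intros L. destruct (ordinal_trichotomy (proj1 L) omega_ordinal) as [H|[H|H]]; auto.
  apply in_omega in H as [n ->]. exfalso. now apply (num_not_limit (n := n)).
Qed.

Lemma is_two_iff (t : U) : is_two t <-> t = num 2.
Proof.
  unfold is_two. split.
  - intros (z & o & Hz & Ho & Ht). apply empty_unique in Hz. apply is_succ_iff in Ho, Ht.
    now subst.
  - intros ->. exists (num 0), (num 1). rewrite !is_succ_iff. split; [exact in_empty|now split].
Qed.

(** * Bijections, finite sets and order types *)

Lemma bijection_graph (g : U -> U) (X Y : U) : (forall x, x ∈ X -> g x ∈ Y) ->
  (forall x x', x ∈ X -> x' ∈ X -> g x = g x' -> x = x') ->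
  (forall y, y ∈ Y -> exists x, x ∈ X /\ g x = y) -> bijection (graph g X Y) X Y.
Proof.
  intros H1 H2 H3. split; [now apply is_function_graph|].
  intros v Hv. destruct (H3 v Hv) as (x & Hx & <-). exists x. split.
  - apply maps_graph. auto.
  - intros x' Hx'. apply maps_graph in Hx' as (A1 & A2 & A3). now apply H2.
Qed.

Lemma bijection_app (f X Y : U) : bijection f X Y ->
  (forall x, x ∈ X -> fapp f x ∈ Y) /\
  (forall x x', x ∈ X -> x' ∈ X -> fapp f x = fapp f x' -> x = x') /\
  (forall y, y ∈ Y -> exists x, x ∈ X /\ fapp f x = y).
Proof.
  intros [Hf H]. split; [|split].
  - intros x. now apply fapp_in.
  - intros x x' Hx Hx' E.
    destruct (H (fapp f x)) as (w & _ & Hw); [eapply fapp_in; eauto|].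
    transitivity w; [symmetry|]; apply Hw; [|rewrite E]; eapply fapp_maps; eauto.
  - intros y Hy. destruct (H y Hy) as (x & Hx & _). exists x.
    split; [apply (maps_dom (proj1 Hf) Hx)|]. symmetry. eapply fapp_unique; eauto.
Qed.

Lemma equipotent_num (x : U) n : equipotent x (num n) <->
  exists l, NoDup l /\ length l = n /\ forall u, u ∈ x <-> In u l.
Proof.
  split.
  - intros [f Hf]. apply bijection_app in Hf as (F1 & F2 & F3).
    pose (g := fun i => epsilon (inhabits empty) (fun u => u ∈ x /\ fapp f u = num i)).
    assert (Hg : forall i, i < n -> g i ∈ x /\ fapp f (g i) = num i).
    { intros i Hi. unfold g. apply epsilon_spec. apply F3. apply in_num. now exists i. }
    exists (map g (seq 0 n)). split; [|split].
    + assert (G : forall a m, a + m <= n -> NoDup (map g (seq a m))).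
      { intros a m; revert a. induction m as [|m IH]; intros a H; simpl; constructor; [|apply IH; lia].
        intros I. apply in_map_iff in I as (i & E & Hi). apply in_seq in Hi.
        assert (E' : num i = num a).
        { destruct (Hg i) as [_ <-]; [lia|]. destruct (Hg a) as [_ <-]; [lia|]. congruence. }
        apply num_inj in E'. lia. }
      apply G. lia.
    + now rewrite length_map, length_seq.
    + intros u. rewrite in_map_iff. split.
      * intros Hu. pose proof (F1 u Hu) as Hi. apply in_num in Hi as (i & Hi & E).
        exists i. split; [|apply in_seq; lia]. destruct (Hg i Hi) as [G1 G2].
        apply F2; auto. congruence.
      * intros (i & <- & Hi). apply in_seq in Hi. apply Hg. lia.
  - intros (l & N & L & H).
    assert (P : forall u, exists i, u ∈ x -> nth_error l i = Some u).
    { intros u. destruct (classic (u ∈ x)) as [Hu|Hu]; [|exists 0; tauto].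
      apply H, In_nth_error in Hu as [i Hi]. now exists i. }
    pose (g := fun u => proj1_sig (constructive_indefinite_description _ (P u))).
    assert (Hg : forall u, u ∈ x -> nth_error l (g u) = Some u).
    { intros u. exact (proj2_sig (constructive_indefinite_description _ (P u))). }
    exists (graph (fun u => num (g u)) x (num n)). apply bijection_graph.
    + intros u Hu. apply in_num. exists (g u). split; [|reflexivity].
      rewrite <- L. apply nth_error_Some. rewrite (Hg u Hu). discriminate.
    + intros u u' Hu Hu' E. apply num_inj in E. apply Hg in Hu, Hu'. congruence.
    + intros y Hy. apply in_num in Hy as (i & Hi & ->).
      rewrite <- L in Hi. destruct (nth_error l i) as [u|] eqn:E;
        [|apply nth_error_Some in Hi; contradiction].
      assert (Hu : u ∈ x) by (apply H; eapply nth_error_In; eauto).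
      exists u. split; [assumption|]. f_equal. eapply (proj1 (NoDup_nth_error l) N).
      * apply nth_error_Some. now rewrite (Hg u Hu).
      * now rewrite (Hg u Hu).
Qed.

Lemma order_type_iff (h b : U) : order_type h b <-> ordinal b /\ exists g : U -> U,
  (forall ξ, ξ ∈ b -> g ξ ∈ h) /\
  (forall ξ ζ, ξ ∈ b -> ζ ∈ b -> ξ ∈ ζ -> g ξ ∈ g ζ) /\
  (forall v, v ∈ h -> exists ξ, ξ ∈ b /\ g ξ = v).
Proof.
  unfold order_type. split.
  - intros (Ob & f & Hf & Hiso). split; [assumption|]. exists (fapp f).
    destruct (bijection_app Hf) as (F1 & F2 & F3). split; [assumption|]. split; [|assumption].
    intros ξ ζ H1 H2 H. apply (Hiso ξ ζ); auto; apply (fapp_maps (proj1 Hf)); assumption.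
  - intros (Ob & g & G1 & G2 & G3). split; [assumption|]. exists (graph g b h).
    assert (G4 : forall x x', x ∈ b -> x' ∈ b -> g x ∈ g x' -> x ∈ x').
    { intros x x' Hx Hx' E. destruct (proj1 (proj2 Ob) x x' Hx Hx') as [L|[L|L]]; [assumption| |].
      - subst. now apply not_self in E.
      - exfalso. exact (not_cycle2 E (G2 _ _ Hx' Hx L)). }
    split.
    + apply bijection_graph; auto.
      intros x x' Hx Hx' E. destruct (proj1 (proj2 Ob) x x' Hx Hx') as [L|[L|L]]; [|assumption|];
        apply G2 in L; auto; rewrite E in L; now apply not_self in L.
    + intros u u' v v' H1 H2. apply maps_graph in H1 as (A1 & A2 & ->), H2 as (A3 & A4 & ->).
      split; auto.
Qed.


(** * Partition relations in the universe *)

Definition list_set (l : list U) : U := fold_right (fun x s => cup (upr x x) s) empty l.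

Lemma in_list_set l z : z ∈ list_set l <-> In z l.
Proof.
  induction l as [|a l IH]; simpl; [split; [apply in_empty|tauto]|].
  rewrite in_cup, in_upr, IH. intuition auto.
Qed.

Lemma finite_iff (x : U) : finite x <-> exists n, equipotent x (num n).
Proof.
  split.
  - intros (w & n & Hw & Hn & E). apply is_omega_iff in Hw. subst.
    apply in_omega in Hn as [m ->]. now exists m.
  - intros [n E]. exists omega, (num n). rewrite is_omega_iff, in_omega. eauto.
Qed.

Definition vals (d : U) (l : list (sub d)) : list U := map (@proj1_sig U _) l.

Lemma in_vals (d : U) (l : list (sub d)) (x : sub d) : In (proj1_sig x) (vals l) <-> In x l.
Proof.
  unfold vals. rewrite in_map_iff. split.
  - intros (y & E & Hy). apply sub_eq in E. now subst.
  - intros H. now exists x.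
Qed.

Lemma sorted_NoDup (d : U) (l : list (sub d)) : sorted (@mem (sub d)) l -> NoDup l.
Proof.
  induction 1 as [|a l H IH Ha]; constructor; [|assumption].
  intros I. apply (proj1 (Forall_forall _ _) Ha) in I. now apply not_self in I.
Qed.

Lemma list_set_equipotent (d : U) (l : list (sub d)) : NoDup l ->
  equipotent (list_set (vals l)) (num (length l)).
Proof.
  intros N. apply equipotent_num. exists (vals l). split; [|split].
  - apply FinFun.Injective_map_NoDup; [|assumption]. intros x y. apply sub_eq.
  - apply length_map.
  - apply in_list_set.
Qed.

(** A finite subset of k is identified with its increasing enumeration, which is unique; so a
    colouring of lists induces the colouring χ of sets. Conversely, a colouring f of sets has only
    two values, so it suffices that the condition f(x) = 0 is homogeneous. *)
Lemma arrow_partition (k b : U) : ordinal k -> ordinal b ->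
  (arrow k b <-> partition_arrow (@mem (sub k)) (@mem (sub b))).
Proof.
  intros Ok Ob. pose proof (sub_well_order Ok) as Wk. pose proof (sub_well_order Ob) as Wb. split.
  - intros H c.
    pose (P := fun x => exists l : list (sub k), sorted (@mem (sub k)) l /\ x = list_set (vals l) /\ c l).
    pose (χ := fun x => if excluded_middle_informative (P x) then num 1 else num 0).
    assert (Hχ : forall l, sorted (@mem (sub k)) l -> (χ (list_set (vals l)) = num 1 <-> c l)).
    { intros l Sl. unfold χ. destruct (excluded_middle_informative _) as [(l' & S' & E & C)|N].
      - split; [intros _|reflexivity]. replace l with l'; [assumption|].
        apply (sorted_unique Wk); auto. intros x.
        rewrite <- !in_vals, <- !in_list_set, E. tauto.
      - split; [intros E; now apply num_inj in E|]. intros C. exfalso. apply N. now exists l. }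
    set (d := sep (@finite U) (power k)).
    destruct (H d (num 2) (graph χ d (num 2))) as (h & Hk & Ht & Hh).
    { intros x. unfold d. now rewrite in_sep, in_power. }
    { now apply is_two_iff. }
    { apply is_function_graph. intros x _. unfold χ. apply in_num.
      destruct (excluded_middle_informative _); eexists; (split; [|reflexivity]); lia. }
    apply order_type_iff in Ht as (_ & g & G1 & G2 & _).
    pose (hh := fun ξ : sub b =>
      exist (fun x => x ∈ k) (g (proj1_sig ξ)) (Hk _ (G1 _ (proj2_sig ξ))) : sub k).
    assert (I : increasing (@mem (sub b)) (@mem (sub k)) hh).
    { intros [ξ Hξ] [ζ Hζ]; simpl. now apply G2. }
    exists hh. split; [assumption|]. intros l l' Sl Sl' El.
    assert (A1 : forall l, sorted (@mem (sub b)) l ->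
       list_set (vals (map hh l)) ⊆ h /\ equipotent (list_set (vals (map hh l))) (num (length l)) /\
       maps (graph χ d (num 2)) (list_set (vals (map hh l))) (χ (list_set (vals (map hh l))))).
    { intros m Sm.
      assert (I1 : list_set (vals (map hh m)) ⊆ h).
      { intros z Hz. apply in_list_set in Hz. unfold vals in Hz. rewrite map_map in Hz.
        apply in_map_iff in Hz as ([ξ Hξ] & <- & _). simpl. now apply G1. }
      assert (I2 : equipotent (list_set (vals (map hh m))) (num (length m))).
      { rewrite <- (length_map hh m). apply list_set_equipotent, sorted_NoDup.
        eapply sorted_map; eauto. }
      split; [assumption|]. split; [assumption|]. apply maps_graph. split; [|split; [|reflexivity]].
      - apply in_sep. split; [|apply finite_iff; eauto].
        apply in_power. intros z Hz. auto.
      - unfold χ. apply in_num.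
        destruct (excluded_middle_informative _); eexists; (split; [|reflexivity]); lia. }
    destruct (A1 l Sl) as (B1 & B2 & B3), (A1 l' Sl') as (B4 & B5 & B6). rewrite <- El in B5.
    assert (E : χ (list_set (vals (map hh l))) = χ (list_set (vals (map hh l')))).
    { apply (Hh omega (num (length l))) with (x := list_set (vals (map hh l)))
        (y := list_set (vals (map hh l'))); auto; [now apply is_omega_iff|apply in_omega; eauto]. }
    rewrite <- !Hχ, E; [tauto| |]; eapply sorted_map; eauto.
  - intros H d t f Hd Ht Hf. apply is_two_iff in Ht. subst t.
    destruct (H (fun l => maps f (list_set (vals l)) (num 0))) as (h & I & Hh).
    pose (g := fun x => match excluded_middle_informative (x ∈ b) with
       | left p => proj1_sig (h (exist _ x p)) | right _ => empty end).
    assert (Hg : forall x (Hx : x ∈ b), g x = proj1_sig (h (exist _ x Hx))).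
    { intros x Hx. unfold g. destruct (excluded_middle_informative _); [|contradiction].
      f_equal. f_equal. now apply sub_eq. }
    exists (image g b). split; [|split].
    + intros v Hv. apply in_image in Hv as (u & Hu & ->).
      rewrite (Hg u Hu). apply proj2_sig.
    + apply order_type_iff. split; [assumption|]. exists g. split; [|split].
      * intros ξ Hξ. apply in_image. eauto.
      * intros ξ ζ Hξ Hζ L. rewrite (Hg ξ Hξ), (Hg ζ Hζ). now apply I.
      * intros v Hv. apply in_image in Hv as (u & Hu & ->). eauto.
    + intros w n Hw Hn x y Hx Hy Ex Ey i j Hi Hj.
      apply is_omega_iff in Hw. subst w. apply in_omega in Hn as [m ->].
      assert (A1 : forall x, x ⊆ image g b -> equipotent x (num m) ->
        exists l, sorted (@mem (sub b)) l /\ length l = m /\ x = list_set (vals (map h l))).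
      { clear x y Hx Hy Ex Ey Hi Hj. intros x Hx Ex. apply equipotent_num in Ex as (l & N & L & E).
        assert (M : exists l0 : list (sub b), l = vals (map h l0)).
        { assert (Hl : forall u, In u l -> exists ξ, u = proj1_sig (h ξ)).
          { intros u Hu. apply E, Hx, in_image in Hu as (ξ & Hξ & ->).
            exists (exist _ ξ Hξ). apply Hg. }
          clear - Hl. induction l as [|a l IH]; [now exists []|].
          destruct IH as [l0 E]; [intros u Hu; apply Hl; now right|].
          destruct (Hl a) as [ξ Eξ]; [now left|]. exists (ξ :: l0). simpl. now rewrite E, Eξ. }
        destruct M as [l0 ->]. unfold vals in N, L. rewrite !length_map in L.
        apply NoDup_map_inv, NoDup_map_inv in N.
        destruct (sort_exists Wb N) as (l1 & S1 & L1 & E1).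
        exists l1. split; [assumption|]. split; [congruence|]. apply set_ext. intros z.
        rewrite E, in_list_set. unfold vals. rewrite !map_map, !in_map_iff.
        split; intros (ξ & Hξ & Iξ); exists ξ; (split; [assumption|]); now apply E1. }
      destruct (A1 x Hx Ex) as (l & S1 & L1 & E1), (A1 y Hy Ey) as (l' & S2 & L2 & E2).
      assert (C := Hh l l' S1 S2 ltac:(congruence)). cbv beta in C. rewrite <- E1, <- E2 in C.
      assert (V : forall x i, maps f x i -> i = num 0 \/ i = num 1).
      { intros x' i' M. apply (maps_dom (proj1 Hf)) in M as [_ M].
        apply in_num in M as (q & Hq & ->). destruct q as [|[|q]]; auto; lia. }
      destruct (V _ _ Hi) as [->| ->], (V _ _ Hj) as [->| ->]; auto.
      * apply C in Hi. rewrite (fapp_unique Hf Hi). symmetry. now apply (fapp_unique Hf).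
      * apply C in Hj. rewrite (fapp_unique Hf Hi). symmetry. now apply (fapp_unique Hf).
Qed.

(** * The cumulative hierarchy *)

(* in_stage a x means x ∈ V_a. *)
Inductive in_stage : U -> U -> Prop :=
| in_stage_intro a x c : c ∈ a -> (forall y, y ∈ x -> in_stage c y) -> in_stage a x.

Lemma in_stage_iff a x : in_stage a x <-> exists c, c ∈ a /\ forall y, y ∈ x -> in_stage c y.
Proof.
  split; [intros H; inversion H; subst; eauto|]. intros (c & H1 & H2). econstructor; eauto.
Qed.

Lemma in_stage_subset a x y : in_stage a x -> y ⊆ x -> in_stage a y.
Proof. rewrite !in_stage_iff. intros (c & H1 & H2) I. exists c. auto. Qed.

Lemma in_stage_mono a b x : a ⊆ b -> in_stage a x -> in_stage b x.
Proof. rewrite !in_stage_iff. intros I (c & H1 & H2). exists c. auto. Qed.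

Lemma in_stage_trans a x y : ordinal a -> in_stage a x -> y ∈ x -> in_stage a y.
Proof.
  intros Oa Hx Hy. apply in_stage_iff in Hx as (c & H1 & H2).
  apply in_stage_mono with c; [|auto]. now apply (proj1 Oa).
Qed.

(** If b ∈ V_a with a ≤ b, then b ∈ V_b; and a least ordinal c with c ∈ V_c would have an element e
    with e ∈ V_e. *)
Lemma in_stage_ordinal (a b : U) : ordinal a -> ordinal b -> (in_stage a b <-> b ∈ a).
Proof.
  intros Oa Ob.
  assert (H1 : forall b, ordinal b -> forall a, b ∈ a -> in_stage a b).
  { apply (ordinal_ind (P := fun b => forall a, b ∈ a -> in_stage a b)).
    intros c _ IH d Hd. apply in_stage_iff. exists c. auto. }
  split; [|now apply H1]. intros H. apply NNPP. intros N.
  apply (ordinal_not_in Ob Oa) in N.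
  assert (K : forall a, ordinal a -> ~ in_stage a a).
  { apply (ordinal_ind (P := fun a => ~ in_stage a a)). intros c _ IH Hc.
    apply in_stage_iff in Hc as (e & He & Hc). apply (IH e He). auto. }
  apply (K b Ob). now apply in_stage_mono with a.
Qed.

Lemma stage_exists (a : U) : ordinal a -> exists v, forall x, x ∈ v <-> in_stage a x.
Proof.
  revert a. apply ordinal_ind. intros a Oa IH.
  pose (g := fun c => epsilon (inhabits empty) (fun v => forall x, x ∈ v <-> in_stage c x)).
  assert (Hg : forall c, c ∈ a -> forall x, x ∈ g c <-> in_stage c x).
  { intros c Hc. unfold g. apply epsilon_spec. now apply IH. }
  exists (union (image (fun c => power (g c)) a)). intros x. rewrite in_union, in_stage_iff. split.
  - intros (y & Hy & Hx). apply in_image in Hy as (c & Hc & ->). apply in_power in Hx.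
    exists c. split; [assumption|]. intros z Hz. now apply Hg, Hx.
  - intros (c & Hc & H). exists (power (g c)). split; [apply in_image; eauto|].
    apply in_power. intros z Hz. now apply Hg, H.
Qed.

Definition stage (a : U) : U := epsilon (inhabits empty) (fun v => forall x, x ∈ v <-> in_stage a x).

Lemma in_stage_set a x : ordinal a -> (x ∈ stage a <-> in_stage a x).
Proof. intros Oa. revert x. unfold stage. apply epsilon_spec. now apply stage_exists. Qed.

Lemma is_stage_iff (a v : U) : is_stage a v <-> ordinal a /\ v = stage a.
Proof.
  split.
  - intros (Oa & a' & w & f & Ha' & Hf & Hv & Hrec). split; [assumption|].
    apply is_succ_iff in Ha'. subst a'.
    assert (H : forall b, ordinal b -> b ∈ suc a -> forall y, maps f b y ->
       forall x, x ∈ y <-> in_stage b x).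
    { apply (ordinal_ind (P := fun b => b ∈ suc a -> forall y, maps f b y ->
         forall x, x ∈ y <-> in_stage b x)).
      intros b Ob IH Hb y Hy x. rewrite (Hrec b y Hy), in_stage_iff.
      assert (Hc : forall c, c ∈ b -> c ∈ suc a).
      { intros c Hc. now apply (proj1 (ordinal_suc Oa) b). }
      split.
      - intros (c & z & H1 & H2 & H3). exists c. split; [assumption|]. intros u Hu.
        apply (IH c H1 (Hc c H1) z H2). now apply H3.
      - intros (c & H1 & H2). exists c, (fapp f c). split; [assumption|].
        assert (M := fapp_maps Hf (Hc c H1)). split; [assumption|].
        intros u Hu. apply (IH c H1 (Hc c H1) _ M). now apply H2. }
    apply set_ext. intros x. rewrite in_stage_set; [|assumption].
    apply H; auto. apply in_suc. auto.
  - intros [Oa ->]. split; [assumption|].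
    exists (suc a), (image stage (suc a)), (graph stage (suc a) (image stage (suc a))).
    split; [now apply is_succ_iff|]. split; [|split].
    + apply is_function_graph. intros x Hx. apply in_image. eauto.
    + apply maps_graph. assert (a ∈ suc a) by (apply in_suc; auto).
      split; [assumption|]. split; [apply in_image; eauto|reflexivity].
    + intros b y Hy x. apply maps_graph in Hy as (Hb & _ & ->).
      assert (Ob : ordinal b) by (eapply ordinal_elem; [apply (ordinal_suc Oa)|assumption]).
      rewrite in_stage_set, in_stage_iff; [|assumption]. split.
      * intros (c & Hc & H). assert (Oc := ordinal_elem Ob Hc).
        assert (Sc : c ∈ suc a) by now apply (proj1 (ordinal_suc Oa) b).
        exists c, (stage c). split; [assumption|]. split.
        -- apply maps_graph. split; [assumption|]. split; [apply in_image; eauto|reflexivity].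
        -- intros u Hu. apply in_stage_set; auto.
      * intros (c & z & Hc & Hz & H). apply maps_graph in Hz as (_ & _ & ->).
        exists c. split; [assumption|]. intros u Hu.
        apply in_stage_set; [eapply ordinal_elem; eauto|]. now apply H.
Qed.

Lemma in_stage_level (a x : U) : limit_ordinal a -> in_stage a x -> exists c, c ∈ a /\ in_stage c x.
Proof.
  intros La Hx. apply in_stage_iff in Hx as (c & H1 & H2). exists (suc c).
  split; [now apply limit_suc|]. apply in_stage_iff. exists c. split; [apply in_suc; auto|assumption].
Qed.

Lemma in_stage_upr (a x y : U) : limit_ordinal a -> in_stage a x -> in_stage a y -> in_stage a (upr x y).
Proof.
  intros La Hx Hy. assert (Oa := proj1 La).
  apply (in_stage_level La) in Hx as (c & Hc & Hx), Hy as (d & Hd & Hy).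
  apply in_stage_iff.
  destruct (classic (c ∈ d)) as [L|L].
  - exists d. split; [assumption|]. intros z Hz. apply in_upr in Hz as [->| ->]; [|assumption].
    apply in_stage_mono with c; [|assumption]. now apply (proj1 (ordinal_elem Oa Hd)).
  - exists c. split; [assumption|]. intros z Hz. apply in_upr in Hz as [->| ->]; [assumption|].
    apply in_stage_mono with d; [|assumption].
    apply ordinal_not_in; try assumption; eapply ordinal_elem; eauto.
Qed.

Lemma in_stage_opair (a x y : U) : limit_ordinal a -> in_stage a x -> in_stage a y ->
  in_stage a (opair x y).
Proof. intros. unfold opair. now repeat apply in_stage_upr. Qed.

(** That x is a cardinal is a consequence: a bijection from some y ∈ x onto x would be an unbounded
    function. *)
Lemma regular_uncountable_intro (x : U) : ordinal x -> omega ∈ x ->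
  (forall y f, y ∈ x -> is_function f y x ->
     exists z, z ∈ x /\ forall u v, maps f u v -> v ∈ z) -> regular_uncountable x.
Proof.
  intros Ox Hw H. split; [split; [assumption|]|split; [|assumption]].
  - intros y Hy [f Hf]. destruct (H y f Hy (proj1 Hf)) as (z & Hz & B).
    destruct (proj2 Hf z Hz) as (u & Hu & _). apply B in Hu. now apply not_self in Hu.
  - exists omega. now rewrite is_omega_iff.
Qed.

Lemma regular_uncountable_limit (x : U) : regular_uncountable x -> limit_ordinal x.
Proof.
  intros ([Ox _] & (w & Hw & Hwx) & H). apply is_omega_iff in Hw. subst w.
  assert (I : forall n, num n ∈ x).
  { intros n. apply (proj1 Ox omega); [assumption|]. apply in_omega. eauto. }
  split; [assumption|]. split; [apply positive_iff, (I 0)|].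
  (* A bound in x for the function on 1 with value y is an element of x above y. *)
  intros y Hy. destruct (H (num 1) (graph (fun _ => y) (num 1) x)) as (z & Hz & B); [apply I| |].
  - apply is_function_graph. auto.
  - exists z. split; [assumption|]. apply (B (num 0)). apply maps_graph.
    split; [apply in_num; exists 0; auto|]. auto.
Qed.

(** * Transfinite enumerations *)

(** G(a) is chosen by [sel] among the elements of X that are not yet listed. The process stops,
    since otherwise G would inject the class of all ordinals into X. With an arbitrary choice for
    [sel] this well-orders X; with the choice of the least element it computes the order type of a
    set of ordinals. *)
Lemma enumeration (X : U) (sel : (U -> Prop) -> U) :
  (forall A : U -> Prop, (exists x, A x) -> (forall x, A x -> x ∈ X) -> A (sel A)) ->
  exists (θ : U) (G : U -> U), ordinal θ /\
    (forall a, a ∈ θ -> G a = sel (fun x => x ∈ X /\ ~ exists b, b ∈ a /\ x = G b)) /\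
    (forall a, a ∈ θ -> G a ∈ X /\ ~ exists b, b ∈ a /\ G a = G b) /\
    (forall x, x ∈ X -> exists b, b ∈ θ /\ x = G b).
Proof.
  intros Hsel.
  set (fresh := fun (A : U -> Prop) x => x ∈ X /\ ~ A x).
  assert (E : exists G : U -> U, forall a, ordinal a ->
     G a = sel (fresh (fun x => exists b, b ∈ a /\ x = G b))).
  { pose (D := {a : U | ordinal a}).
    assert (W : well_founded (fun x y : D => proj1_sig x ∈ proj1_sig y)).
    { assert (K : forall a, ordinal a -> forall Oa : ordinal a,
        Acc (fun x y : D => proj1_sig x ∈ proj1_sig y) (exist _ a Oa)).
      { apply (ordinal_ind (P := fun a => forall Oa : ordinal a,
          Acc (fun x y : D => proj1_sig x ∈ proj1_sig y) (exist _ a Oa))).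
        intros b Ob IH Ob'. constructor. intros [c Oc] L. simpl in L. now apply IH. }
      intros [a Oa]. now apply K. }
    pose (G0 := Fix W (fun _ => U) (fun a rec => sel
       (fresh (fun x => exists b (L : proj1_sig b ∈ proj1_sig a), x = rec b L)))).
    assert (G0_eq : forall a, G0 a = sel
       (fresh (fun x => exists b (L : proj1_sig b ∈ proj1_sig a), x = G0 b))).
    { intros a. unfold G0 at 1. rewrite Fix_eq; [reflexivity|].
      intros a' f g Efg. replace g with f; [reflexivity|].
      apply functional_extensionality_dep; intros y.
      apply functional_extensionality_dep; intros p. apply Efg. }
    pose (G := fun a => match excluded_middle_informative (ordinal a) with
       | left p => G0 (exist _ a p) | right _ => empty end).
    assert (HG : forall a (Oa : ordinal a), G a = G0 (exist _ a Oa)).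
    { intros a Oa. unfold G. destruct (excluded_middle_informative _); [|contradiction].
      do 2 f_equal. apply proof_irrelevance. }
    exists G. intros a Oa.
    assert (P : (fun x => exists b, b ∈ a /\ x = G b) =
       (fun x => exists (b : D) (L : proj1_sig b ∈ a), x = G0 b)).
    { apply functional_extensionality. intros x. apply propositional_extensionality. split.
      - intros (b & Hb & ->). exists (exist _ b (ordinal_elem Oa Hb)), Hb. apply HG.
      - intros ([b Ob] & Hb & ->). exists b. split; [assumption|]. symmetry. apply HG. }
    rewrite P. rewrite (HG a Oa), G0_eq. reflexivity. }
  destruct E as [G HG].
  assert (HF : forall a, ordinal a -> (exists x, fresh (fun x => exists b, b ∈ a /\ x = G b) x) ->
    fresh (fun x => exists b, b ∈ a /\ x = G b) (G a)).
  { intros a Oa Ex. rewrite (HG a Oa). apply Hsel; [assumption|]. now intros x []. }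
  assert (St : exists a, ordinal a /\ ~ exists x, fresh (fun x => exists b, b ∈ a /\ x = G b) x).
  { apply NNPP. intros N.
    assert (HQ : forall a, ordinal a -> fresh (fun x => exists b, b ∈ a /\ x = G b) (G a)).
    { intros a Oa. apply HF; [assumption|]. apply NNPP. intros M. apply N. eauto. }
    assert (Inj : forall a b, ordinal a -> ordinal b -> G a = G b -> a = b).
    { assert (K : forall a b, ordinal b -> a ∈ b -> G a <> G b).
      { intros a b Ob L E. apply (HQ b Ob). eauto. }
      intros a b Oa Ob E. destruct (ordinal_trichotomy Oa Ob) as [L|[L|L]]; [|assumption|].
      - exfalso. now apply (K a b).
      - exfalso. now apply (K b a). }
    apply (no_set_of_ordinals (X := image (fun x => epsilon (inhabits empty)
       (fun a => ordinal a /\ G a = x)) X)).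
    intros a Oa. apply in_image. exists (G a). split; [apply (HQ a Oa)|].
    assert (S1 : let b := epsilon (inhabits empty) (fun b => ordinal b /\ G b = G a) in
      ordinal b /\ G b = G a) by (apply epsilon_spec; eauto).
    destruct S1 as [S1 S2]. symmetry. now apply Inj. }
  destruct (ordinal_least St) as (θ & Oθ & Hθ & Mθ).
  exists θ, G. split; [assumption|]. split; [|split].
  - intros a Ha. apply HG. exact (ordinal_elem Oθ Ha).
  - intros a Ha. apply HF; [exact (ordinal_elem Oθ Ha)|]. apply NNPP. now apply Mθ.
  - intros x Hx. apply NNPP. intros N. apply Hθ. exists x. now split.
Qed.

Lemma well_ordering (X : U) : exists (θ : U) (j : U -> U), ordinal θ /\
  (forall x, x ∈ X -> j x ∈ θ) /\
  (forall x y, x ∈ X -> y ∈ X -> j x = j y -> x = y) /\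
  (forall ξ, ξ ∈ θ -> exists x, x ∈ X /\ j x = ξ).
Proof.
  destruct (enumeration (X := X) (sel := epsilon (inhabits empty))) as (θ & G & Oθ & _ & HQ & Cov).
  { intros A E _. now apply epsilon_spec. }
  assert (K : forall a b, a ∈ θ -> b ∈ θ -> G a = G b -> a = b).
  { assert (K : forall a b, b ∈ θ -> a ∈ b -> G a <> G b).
    { intros a b Hb L E. apply (HQ b Hb). eauto. }
    intros a b Ha Hb E. destruct (proj1 (proj2 Oθ) a b Ha Hb) as [L|[L|L]]; [|assumption|].
    - exfalso. now apply (K a b).
    - exfalso. now apply (K b a). }
  pose (j := fun x => epsilon (inhabits empty) (fun b => b ∈ θ /\ x = G b)).
  assert (Hj : forall x, x ∈ X -> j x ∈ θ /\ x = G (j x)).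
  { intros x Hx. unfold j. apply epsilon_spec. now apply Cov. }
  exists θ, j. split; [assumption|]. split; [|split].
  - intros x Hx. now apply Hj.
  - intros x y Hx Hy E. destruct (Hj x Hx) as [_ ->]. destruct (Hj y Hy) as [_ ->]. now rewrite E.
  - intros ξ Hξ. destruct (HQ ξ Hξ) as [HX _]. exists (G ξ). split; [assumption|].
    destruct (Hj _ HX) as [J1 J2]. symmetry. now apply K.
Qed.

Lemma order_type_exists (X : U) : (forall x, x ∈ X -> ordinal x) -> exists δ, order_type X δ.
Proof.
  intros OX.
  pose (sel := fun A : U -> Prop => epsilon (inhabits empty) (fun x => A x /\ forall y, y ∈ x -> ~ A y)).
  assert (Hsel : forall A : U -> Prop, (exists x, A x) -> (forall x, A x -> x ∈ X) ->
    A (sel A) /\ forall y, y ∈ sel A -> ~ A y).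
  { intros A [x Ax] HA. unfold sel. apply epsilon_spec.
    destruct (ordinal_least (P := A)) as (y & _ & H); [|now exists y].
    exists x. split; [apply OX, HA, Ax|assumption]. }
  destruct (enumeration (X := X) (sel := sel)) as (δ & G & Oδ & EG & HG & Cov).
  { intros A E HA. now apply Hsel. }
  exists δ. apply order_type_iff. split; [assumption|]. exists G. split; [|split].
  - intros ξ Hξ. now apply HG.
  - intros ξ ζ Hξ Hζ L. destruct (HG ζ Hζ) as [X1 N1].
    assert (Fζ : (fun x => x ∈ X /\ ~ exists b, b ∈ ξ /\ x = G b) (G ζ)).
    { split; [assumption|]. intros (b & Hb & E). apply N1. exists b. split; [|assumption].
      exact (proj1 (ordinal_elem Oδ Hζ) _ L _ Hb). }
    (* G ζ was still available at ξ, so the least choice G ξ is not above it. *)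
    destruct (ordinal_trichotomy (OX _ (proj1 (HG ξ Hξ))) (OX _ X1)) as [H|[H|H]]; [assumption| |].
    + exfalso. apply N1. exists ξ. auto.
    + exfalso. rewrite (EG ξ Hξ) in H. revert Fζ. apply Hsel; [|tauto|assumption].
      exists (G ξ). now apply HG.
  - intros v Hv. destruct (Cov v Hv) as (b & Hb & ->). eauto.
Qed.

(** Composed with the collapse of X to its order type δ, g becomes an increasing map e from b to δ.
    Then e(ξ) ≥ ξ for all ξ, whence b ⊆ δ. *)
Lemma order_type_ge (X b : U) (g : U -> U) : ordinal b -> (forall x, x ∈ X -> ordinal x) ->
  (forall ξ, ξ ∈ b -> g ξ ∈ X) -> (forall ξ ζ, ξ ∈ b -> ζ ∈ b -> ξ ∈ ζ -> g ξ ∈ g ζ) ->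
  order_type_at_least X b.
Proof.
  intros Ob OX G1 G2. destruct (order_type_exists OX) as [δ Hδ]. exists δ. split; [assumption|].
  apply order_type_iff in Hδ as (Oδ & f & F1 & F2 & F3).
  pose (e := fun ξ => epsilon (inhabits empty) (fun η => η ∈ δ /\ f η = g ξ)).
  assert (He : forall ξ, ξ ∈ b -> e ξ ∈ δ /\ f (e ξ) = g ξ).
  { intros ξ Hξ. unfold e. apply epsilon_spec. apply F3. auto. }
  assert (Ie : forall ξ ζ, ξ ∈ b -> ζ ∈ b -> ξ ∈ ζ -> e ξ ∈ e ζ).
  { intros ξ ζ Hξ Hζ L. destruct (He ξ Hξ) as [A1 A2], (He ζ Hζ) as [B1 B2].
    assert (L' := G2 ξ ζ Hξ Hζ L). rewrite <- A2, <- B2 in L'.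
    destruct (proj1 (proj2 Oδ) _ _ A1 B1) as [H|[H|H]]; [assumption| |].
    - rewrite H in L'. exfalso. now apply not_self in L'.
    - exfalso. exact (not_cycle2 L' (F2 _ _ B1 A1 H)). }
  assert (Ge : forall ξ, ordinal ξ -> ξ ∈ b -> ~ e ξ ∈ ξ).
  { apply (ordinal_ind (P := fun ξ => ξ ∈ b -> ~ e ξ ∈ ξ)). intros ξ Oξ IH Hξ H.
    assert (Hb := proj1 Ob _ Hξ _ H). apply (IH _ H Hb). auto. }
  apply (ordinal_subset Ob Oδ). intros ξ Hξ. assert (Oξ := ordinal_elem Ob Hξ).
  destruct (He ξ Hξ) as [A1 _]. assert (Oe := ordinal_elem Oδ A1).
  destruct (ordinal_trichotomy Oξ Oe) as [H|[->|H]]; [|assumption|].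
  - exact (proj1 Oδ _ A1 _ H).
  - exfalso. exact (Ge ξ Oξ Hξ H).
Qed.

End Universe.

(** * Erdős cardinals are inaccessible *)

Section Erdos_cardinal.
Context (V : set_structure) (hV : set_universe V).

(** This is the assumption [minO] of the abstract part. A colouring of lists over η is moved to
    lists over λ by taking the images of the coloured lists under the inclusion. *)
Lemma not_arrow_coloring (λ β : V) : ordinal λ -> limit_ordinal β ->
  (forall μ, μ ∈ λ -> ~ arrow μ β) ->
  forall η : sub λ, exists c : list (sub λ) -> Prop, forall h : sub β -> sub λ,
    increasing (@mem (sub β)) (@mem (sub λ)) h -> (forall ξ, h ξ ∈ η) ->
    ~ homogeneous (@mem (sub β)) c h.
Proof.
  intros Oλ Lβ H [η Hη]. specialize (H η Hη).
  assert (Oη := ordinal_elem hV Oλ Hη).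
  rewrite (arrow_partition hV Oη (proj1 Lβ)) in H. apply NNPP. intros N. apply H. intros c.
  pose (e := fun x : sub η => exist (fun x => x ∈ λ) (proj1_sig x)
    (proj1 Oλ _ Hη _ (proj2_sig x)) : sub λ).
  apply NNPP. intros N2. apply N.
  exists (fun l => exists l0, l = map e l0 /\ c l0). intros h Ih Bh Hh. apply N2.
  exists (fun ξ => exist (fun x => x ∈ η) (proj1_sig (h ξ)) (Bh ξ) : sub η).
  split; [intros x y L; now apply Ih|].
  assert (E : forall l, map h l = map e (map (fun ξ => exist (fun x => x ∈ η) (proj1_sig (h ξ)) (Bh ξ) : sub η) l)).
  { intros l. rewrite map_map. apply map_ext. intros ξ. now apply sub_eq. }
  assert (Ie : forall l l', map e l = map e l' -> l = l').
  { induction l as [|a l IH]; intros [|b l'] E'; try discriminate; [reflexivity|].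
    simpl in E'. injection E' as E1 E2. f_equal; [now apply sub_eq|now apply IH]. }
  intros l l' Sl Sl' El. specialize (Hh l l' Sl Sl' El). cbv beta in Hh.
  split; intros C.
  - destruct (proj1 Hh) as (l0 & E0 & C0); [rewrite E; eauto|].
    rewrite E in E0. apply Ie in E0. now subst.
  - destruct (proj2 Hh) as (l0 & E0 & C0); [rewrite E; eauto|].
    rewrite E in E0. apply Ie in E0. now subst.
Qed.

Lemma limit_inhabited (β : V) : limit_ordinal β -> exists b0 : sub β, True.
Proof. intros (_ & (z & _ & Hz) & _). now exists (exist _ z Hz). Qed.

(* The least ordinal λ with λ → (β) is regular, hence a cardinal, hence κ. *)
Lemma Erdos_least (β κ : V) : limit_ordinal β -> Erdos β κ ->
  ordinal κ /\ arrow κ β /\ forall μ, μ ∈ κ -> ~ arrow μ β.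
Proof.
  intros Lβ ([Oκ _] & Aκ & Mκ). split; [assumption|]. split; [assumption|].
  destruct (ordinal_least hV (P := fun μ => arrow μ β)) as (λ & Oλ & Aλ & Mλ); [eauto|].
  assert (Cλ : cardinal λ).
  { split; [assumption|]. intros y Hy [f Hf].
    destruct (bijection_app hV Hf) as (F1 & F2 & F3).
    destruct (limit_inhabited Lβ) as [b0 _].
    assert (Aλ' := Aλ). apply (arrow_partition hV Oλ (proj1 Lβ)) in Aλ'.
    (* f is made a function on all of λ by a default off y. It has no bound on y, because it maps y
       onto λ. *)
    pose (g := fun ξ : sub λ => match excluded_middle_informative (proj1_sig ξ ∈ y) with
      | left p => exist (fun x => x ∈ λ) (fapp hV f (proj1_sig ξ)) (F1 _ p) | right _ => ξ end : sub λ).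
    destruct (Erdos_regular (sub_well_order hV Oλ) (sub_well_order hV (proj1 Lβ)) b0
      (limit_no_max Lβ) Aλ' (not_arrow_coloring Oλ Lβ Mλ) g (exist _ y Hy)) as [[δ Hδ] B].
    destruct (F3 δ Hδ) as (x & Hx & E).
    specialize (B (exist _ x (proj1 Oλ _ Hy _ Hx)) Hx). unfold g in B. simpl in B.
    destruct (excluded_middle_informative _); [|contradiction]. simpl in B.
    rewrite E in B. now apply (not_self hV) in B. }
  destruct (ordinal_trichotomy hV Oλ Oκ) as [L|[->|L]]; [|assumption|].
  - exfalso. now apply (Mκ λ).
  - exfalso. now apply (Mλ κ).
Qed.

Section Inaccessible.
Context (β κ : V) (Lβ : limit_ordinal β) (Oκ : ordinal κ) (Aκ : arrow κ β)
  (Mκ : forall μ, μ ∈ κ -> ~ arrow μ β).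

Lemma κ_arrow : partition_arrow (@mem (sub κ)) (@mem (sub β)).
Proof. now apply (arrow_partition hV Oκ (proj1 Lβ)). Qed.

Lemma κ_regular (f : V -> V) γ : γ ∈ κ -> (forall ξ, ξ ∈ γ -> f ξ ∈ κ) ->
  exists δ, δ ∈ κ /\ forall ξ, ξ ∈ γ -> f ξ ∈ δ.
Proof.
  intros Hγ Hf. destruct (limit_inhabited Lβ) as [b0 _].
  pose (g := fun ξ : sub κ => match excluded_middle_informative (proj1_sig ξ ∈ γ) with
      | left p => exist (fun x => x ∈ κ) (f (proj1_sig ξ)) (Hf _ p) | right _ => ξ end : sub κ).
  destruct (Erdos_regular (sub_well_order hV Oκ) (sub_well_order hV (proj1 Lβ)) b0
      (limit_no_max Lβ) κ_arrow (not_arrow_coloring Oκ Lβ Mκ) g (exist _ γ Hγ)) as [[δ Hδ] B].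
  exists δ. split; [assumption|]. intros ξ Hξ.
  specialize (B (exist _ ξ (proj1 Oκ _ Hγ _ Hξ)) Hξ). unfold g in B. simpl in B.
  destruct (excluded_middle_informative _); [|contradiction]. exact B.
Qed.

Lemma κ_strong_limit (A : V -> V -> Prop) γ : γ ∈ κ ->
  exists x y, x ∈ κ /\ y ∈ κ /\ x <> y /\ forall ξ, ξ ∈ γ -> (A x ξ <-> A y ξ).
Proof.
  intros Hγ. destruct (limit_inhabited Lβ) as [b0 _].
  destruct (Erdos_strong_limit (sub_well_order hV Oκ) (sub_well_order hV (proj1 Lβ)) b0
      (limit_no_max Lβ) κ_arrow (not_arrow_coloring Oκ Lβ Mκ)
      (fun x y => A (proj1_sig x) (proj1_sig y)) (exist _ γ Hγ)) as ([x Hx] & [y Hy] & L & B).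
  exists x, y. split; [assumption|]. split; [assumption|]. split.
  - intros ->. now apply (not_self hV) in L.
  - intros ξ Hξ. exact (B (exist _ ξ (proj1 Oκ _ Hγ _ Hξ)) Hξ).
Qed.

Lemma κ_uncountable : omega hV ∈ κ.
Proof.
  apply NNPP. intros N. apply (ordinal_not_in hV (omega_ordinal hV) Oκ) in N as I.
  - destruct (limit_inhabited Lβ) as [b0 _].
    assert (R : forall x : sub κ, exists n, proj1_sig x = num hV n).
    { intros [x Hx]. now apply in_omega, I. }
    pose (r := fun x => proj1_sig (constructive_indefinite_description _ (R x))).
    assert (Hr : forall x, proj1_sig x = num hV (r x)).
    { intros x. exact (proj2_sig (constructive_indefinite_description _ (R x))). }
    apply (Erdos_uncountable (sub_well_order hV Oκ) (sub_well_order hV (proj1 Lβ)) b0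
      (limit_no_max Lβ) κ_arrow (not_arrow_coloring Oκ Lβ Mκ) (r := r)).
    intros x y L. simpl in L. rewrite (Hr x), (Hr y) in L.
    apply in_num in L as (m & Hm & E). apply num_inj in E. lia.
Qed.

End Inaccessible.
End Erdos_cardinal.

(** * V_κ for inaccessible κ *)

Section Stage_universe.
Context (V : set_structure) (hV : set_universe V).
Context (κ : V) (Oκ : ordinal κ).
Context (κ_reg : forall (f : V -> V) γ, γ ∈ κ -> (forall ξ, ξ ∈ γ -> f ξ ∈ κ) ->
  exists δ, δ ∈ κ /\ forall ξ, ξ ∈ γ -> f ξ ∈ δ).
Context (κ_slim : forall (A : V -> V -> Prop) γ, γ ∈ κ ->
  exists x y, x ∈ κ /\ y ∈ κ /\ x <> y /\ forall ξ, ξ ∈ γ -> (A x ξ <-> A y ξ)).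
Context (κ_unc : omega hV ∈ κ).

(** For regular κ this means |X| < κ: it is equivalent to an injection of X into some η < κ, by the
    two lemmas on injections below. The form with bounded maps is the one that replacement in V_κ
    uses. *)
Definition small (X : V) : Prop := forall G : V -> V,
  (forall x, x ∈ X -> G x ∈ κ) -> exists δ, δ ∈ κ /\ forall x, x ∈ X -> G x ∈ δ.

Lemma κ_limit : limit_ordinal κ.
Proof.
  assert (I : forall n, num hV n ∈ κ).
  { intros n. apply (proj1 Oκ _ κ_unc). apply in_omega. eauto. }
  split; [assumption|]. split; [apply (positive_iff hV), (I 0)|].
  intros y Hy. destruct (κ_reg (f := fun _ => y) (I 1)) as (δ & Hδ & B); [auto|].
  exists δ. split; [assumption|]. apply (B (num hV 0)). apply in_num. exists 0. auto.
Qed.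

Lemma small_of_injection (X η : V) (j : V -> V) : η ∈ κ ->
  (forall x, x ∈ X -> j x ∈ η) ->
  (forall x y, x ∈ X -> y ∈ X -> j x = j y -> x = y) -> small X.
Proof.
  intros Hη J1 J2 G HG.
  pose (g := fun ξ => epsilon (inhabits (empty hV)) (fun v => v ∈ κ /\ forall x, x ∈ X -> j x = ξ -> v = G x)).
  assert (Hg : forall ξ, g ξ ∈ κ /\ forall x, x ∈ X -> j x = ξ -> g ξ = G x).
  { intros ξ. unfold g. apply epsilon_spec.
    destruct (classic (exists x, x ∈ X /\ j x = ξ)) as [(x & Hx & E)|N].
    - exists (G x). split; [auto|]. intros y Hy E'. f_equal. apply J2; congruence.
    - exists (omega hV). split; [assumption|]. intros x Hx E. exfalso. eauto. }
  destruct (κ_reg (f := g) Hη) as (δ & Hδ & B); [intros; apply Hg|].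
  exists δ. split; [assumption|]. intros x Hx.
  rewrite <- (proj2 (Hg (j x)) x Hx eq_refl). auto.
Qed.

(** Well-order X in type θ. If κ ≤ θ, the order map cut off at κ takes every value below κ and has
    no bound. *)
Lemma small_injection (X : V) : small X -> exists (η : V) (j : V -> V), η ∈ κ /\
  (forall x, x ∈ X -> j x ∈ η) /\ (forall x y, x ∈ X -> y ∈ X -> j x = j y -> x = y).
Proof.
  intros SX. destruct (well_ordering hV X) as (θ & j & Oθ & J1 & J2 & J3).
  exists θ, j. split; [|split; assumption]. apply NNPP. intros N.
  apply (ordinal_not_in hV Oθ Oκ) in N.
  destruct (SX (fun x => if excluded_middle_informative (j x ∈ κ) then j x else omega hV))
    as (δ & Hδ & B).
  { intros x _. destruct (excluded_middle_informative _); assumption. }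
  destruct (J3 δ (N δ Hδ)) as (x & Hx & E). specialize (B x Hx). cbv beta in B.
  rewrite E in B. destruct (excluded_middle_informative _); [|contradiction].
  now apply (not_self hV) in B.
Qed.

(** Otherwise there are κ distinct subsets of X. An injection of X into some η < κ turns them into κ
    subsets of η, two of which must coincide. *)
Lemma small_power (X : V) : small X -> small (power hV X).
Proof.
  intros SX. destruct (small_injection SX) as (η & j & Hη & J1 & J2).
  destruct (well_ordering hV (power hV X)) as (θ & i & Oθ & I1 & I2 & I3).
  destruct (classic (θ ∈ κ)) as [Hθ|N]; [exact (small_of_injection Hθ I1 I2)|].
  exfalso. apply (ordinal_not_in hV Oθ Oκ) in N.
  pose (S := fun ξ => epsilon (inhabits (empty hV)) (fun x => x ∈ power hV X /\ i x = ξ)).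
  assert (HS : forall ξ, ξ ∈ κ -> S ξ ∈ power hV X /\ i (S ξ) = ξ).
  { intros ξ Hξ. unfold S. apply epsilon_spec. apply I3. auto. }
  destruct (κ_slim (fun ξ ρ => exists x, x ∈ S ξ /\ j x = ρ) Hη) as (ξ & ζ & Hξ & Hζ & Ne & E).
  apply Ne. destruct (HS ξ Hξ) as [S1 <-], (HS ζ Hζ) as [S2 <-]. f_equal.
  apply in_power in S1, S2. apply (set_ext hV).
  intros z. split; intros Hz.
  - destruct (proj1 (E (j z) (J1 z (S1 z Hz)))) as (x & Hx & Ex); [eauto|].
    replace z with x; [assumption|]. apply J2; auto.
  - destruct (proj2 (E (j z) (J1 z (S2 z Hz)))) as (x & Hx & Ex); [eauto|].
    replace z with x; [assumption|]. apply J2; auto.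
Qed.

Lemma small_subset (X Y : V) : small X -> Y ⊆ X -> small Y.
Proof.
  intros SX I G HG.
  destruct (SX (fun x => if excluded_middle_informative (x ∈ Y) then G x else omega hV)) as (δ & Hδ & B).
  - intros x _. destruct (excluded_middle_informative _); auto.
  - exists δ. split; [assumption|]. intros x Hx. specialize (B x (I x Hx)). cbv beta in B.
    destruct (excluded_middle_informative _); [assumption|contradiction].
Qed.

(** V_b is the union of the power sets of V_c for c < b. Each of these is small by induction, and
    regularity of κ bounds the b-many bounds. *)
Lemma small_stage (b : V) : b ∈ κ -> small (stage hV b).
Proof.
  intros Hb. assert (Ob := ordinal_elem hV Oκ Hb). revert Hb. pattern b.
  apply (ordinal_ind hV); [|assumption]. clear b Ob. intros b Ob IH Hb G HG.
  assert (Hc : forall c, c ∈ b -> c ∈ κ) by (intros c Hc; now apply (proj1 Oκ b)).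
  assert (P : forall c, exists δ, c ∈ b -> δ ∈ κ /\ forall x, x ∈ power hV (stage hV c) -> G x ∈ δ).
  { intros c. destruct (classic (c ∈ b)) as [Hcb|N]; [|exists b; tauto].
    destruct (small_power (IH c Hcb (Hc c Hcb)) (G := G)) as (δ & Hδ & B); [|exists δ; auto].
    intros x Hx. apply HG. apply in_stage_set; [assumption|]. apply in_stage_iff.
    exists c. split; [assumption|]. intros y Hy. apply in_power in Hx. apply Hx in Hy.
    apply in_stage_set in Hy; [assumption|]. eapply (ordinal_elem hV); eauto. }
  pose (g := fun c => proj1_sig (constructive_indefinite_description _ (P c))).
  assert (Hg : forall c, c ∈ b -> g c ∈ κ /\ forall x, x ∈ power hV (stage hV c) -> G x ∈ g c).
  { intros c. exact (proj2_sig (constructive_indefinite_description _ (P c))). }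
  destruct (κ_reg (f := g) Hb) as (δ & Hδ & B); [intros; now apply Hg|].
  exists δ. split; [assumption|]. intros x Hx. apply in_stage_set, in_stage_iff in Hx; [|assumption].
  destruct Hx as (c & Hcb & Hx).
  assert (Oδ := ordinal_elem hV Oκ Hδ).
  apply (proj1 Oδ (g c)); [now apply B|]. apply Hg; [assumption|]. apply in_power.
  intros y Hy. apply in_stage_set; [exact (ordinal_elem hV Ob Hcb)|auto].
Qed.

(** * V_κ as a universe of sets *)

Definition Vκ : V := stage hV κ.
Definition stage_structure : set_structure := sub Vκ.

Lemma in_Vκ x : x ∈ Vκ <-> in_stage κ x.
Proof. now apply in_stage_set. Qed.

Lemma Vκ_trans x y : x ∈ Vκ -> y ∈ x -> y ∈ Vκ.
Proof. rewrite !in_Vκ. intros H1 H2. exact (in_stage_trans Oκ H1 H2). Qed.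

Lemma small_of_Vκ x : x ∈ Vκ -> small x.
Proof.
  intros Hx. apply in_Vκ, in_stage_iff in Hx as (c & Hc & Hx).
  apply (small_subset (small_stage Hc)). intros y Hy. apply in_stage_set; [|auto].
  eapply (ordinal_elem hV); eauto.
Qed.

Definition to_Vκ (x : V) (Hx : x ∈ Vκ) : stage_structure := exist _ x Hx.

Lemma Vκ_subset (x y : stage_structure) : x ⊆ y <-> proj1_sig x ⊆ proj1_sig y.
Proof.
  split.
  - intros H z Hz. exact (H (to_Vκ (Vκ_trans (proj2_sig x) Hz)) Hz).
  - intros H z Hz. now apply H.
Qed.

(** Separation and replacement hold here for all classes, not only for definable ones, so everything
    proved for a universe can be applied inside V_κ. The required sets are formed in V and placed in
    V_κ by a bound on their rank. *)
Lemma Vκ_universe : set_universe stage_structure.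
Proof.
  pose proof κ_limit as Lκ.
  split.
  - intros x y H. apply sub_eq. apply (set_ext hV). intros z. split; intros Hz.
    + exact (proj1 (H (to_Vκ (Vκ_trans (proj2_sig x) Hz))) Hz).
    + exact (proj2 (H (to_Vκ (Vκ_trans (proj2_sig y) Hz))) Hz).
  - intros [x Hx] ([y Hy] & L). simpl in L.
    destruct (zfc_foundation hV (x := x)) as (z & Hz & N); [eauto|].
    exists (to_Vκ (Vκ_trans Hx Hz)). split; [exact Hz|]. intros w Hw. now apply N.
  - intros [x Hx] [y Hy].
    assert (H : upr hV x y ∈ Vκ).
    { apply in_Vκ, (in_stage_upr hV Lκ); now apply in_Vκ. }
    exists (to_Vκ H). intros z. simpl. rewrite in_upr.
    split; (intros [E|E]; [left|right]); try (now apply sub_eq); now rewrite E.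
  - intros [x Hx].
    assert (H : union hV x ∈ Vκ).
    { apply in_Vκ, in_stage_iff in Hx as (c & Hc & Hx). apply in_Vκ, in_stage_iff. exists c.
      split; [assumption|]. intros z Hz. apply in_union in Hz as (y & Hy & Hz).
      exact (in_stage_trans (ordinal_elem hV Oκ Hc) (Hx y Hy) Hz). }
    exists (to_Vκ H). intros z. simpl. rewrite in_union. split.
    + intros (y & Hy & Hz). exists (to_Vκ (Vκ_trans Hx Hy)). now split.
    + intros ([y Hy] & H1 & H2). exists y. now split.
  - intros [x Hx].
    assert (H : power hV x ∈ Vκ).
    { apply in_Vκ in Hx. apply (in_stage_level hV Lκ) in Hx as (c & Hc & Hx).
      apply in_Vκ, in_stage_iff. exists c. split; [assumption|]. intros y Hy.
      apply in_power in Hy. now apply in_stage_subset with x. }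
    exists (to_Vκ H). intros y. rewrite Vκ_subset. simpl. apply in_power.
  - assert (H : omega hV ∈ Vκ).
    { apply in_Vκ, (in_stage_ordinal hV); auto. apply omega_ordinal. }
    exists (to_Vκ H).
    assert (Hn : forall n, num hV n ∈ Vκ).
    { intros n. apply (Vκ_trans H). apply in_omega. eauto. }
    split.
    + exists (to_Vκ (Hn 0)). split; [|apply in_omega; now exists 0].
      intros y Hy. now apply (in_empty) in Hy.
    + intros [y Hy] L. simpl in L. apply in_omega in L as [n E].
      exists (to_Vκ (Hn (Datatypes.S n))). split; [|apply in_omega; now exists (Datatypes.S n)].
      intros z. simpl. rewrite in_suc. fold (num hV n). rewrite <- E. split; (intros [L|L]; [now left|right]).
      * now apply sub_eq.
      * now rewrite L.
  - intros A _ [x Hx].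
    assert (H : sep hV (fun z => exists Hz : z ∈ Vκ, A (to_Vκ Hz)) x ∈ Vκ).
    { apply in_Vκ. apply in_stage_subset with x; [now apply in_Vκ|].
      intros z Hz. now apply in_sep in Hz. }
    exists (to_Vκ H). intros [z Hz]. simpl. rewrite in_sep. split.
    + intros [L [Hz' HA]]. split; [assumption|]. now rewrite (proof_irrelevance _ Hz Hz').
    + intros [L HA]. split; [assumption|]. now exists Hz.
  - intros A _ [x Hx] F.
    pose (Y := fun v => exists u (Hu : u ∈ Vκ) (Hv : v ∈ Vκ), u ∈ x /\ A (to_Vκ Hu) (to_Vκ Hv)).
    (* G(u) bounds the rank of the value at u; since x is small, all these bounds lie below one δ <
       κ. *)
    pose (G := fun u => epsilon (inhabits (empty hV)) (fun c => c ∈ κ /\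
      forall (Hu : u ∈ Vκ) v (Hv : v ∈ Vκ), A (to_Vκ Hu) (to_Vκ Hv) -> forall y, y ∈ v -> in_stage c y)).
    assert (HG : forall u, u ∈ x -> G u ∈ κ /\
      forall (Hu : u ∈ Vκ) v (Hv : v ∈ Vκ), A (to_Vκ Hu) (to_Vκ Hv) -> forall y, y ∈ v -> in_stage (G u) y).
    { intros u Hux. unfold G. apply epsilon_spec.
      destruct (classic (exists (Hu : u ∈ Vκ) v (Hv : v ∈ Vκ), A (to_Vκ Hu) (to_Vκ Hv)))
        as [(Hu & v & Hv & HA)|N].
      - assert (Hv' := Hv). apply in_Vκ, in_stage_iff in Hv' as (c & Hc & H).
        exists c. split; [assumption|]. intros Hu' v' Hv' HA'.
        rewrite (proof_irrelevance _ Hu' Hu) in HA'.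
        assert (E := F (to_Vκ Hu) Hux _ _ HA HA'). injection E as <-. assumption.
      - exists (omega hV). split; [assumption|]. intros Hu v Hv HA. exfalso. eauto. }
    destruct (small_of_Vκ Hx (G := G)) as (δ & Hδ & B); [intros; now apply HG|].
    assert (H : sep hV Y Vκ ∈ Vκ).
    { apply in_Vκ, in_stage_iff. exists δ. split; [assumption|]. intros v Hv.
      apply in_sep in Hv as [_ (u & Hu & Hv & Hux & HA)].
      apply in_stage_iff. exists (G u). split; [now apply B|]. now apply (proj2 (HG u Hux) Hu v Hv). }
    exists (to_Vκ H). intros [v Hv]. simpl. rewrite in_sep. split.
    + intros [_ (u & Hu & Hv' & Hux & HA)]. exists (to_Vκ Hu). split; [assumption|].
      now rewrite (proof_irrelevance _ Hv Hv').
    + intros ([u Hu] & Hux & HA). split; [assumption|]. exists u, Hu, Hv. now split.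
  - intros [x Hx] Ne Dj.
    destruct (zfc_choice hV (x := x)) as (c & Hc).
    + intros y Hy. destruct (Ne (to_Vκ (Vκ_trans Hx Hy)) Hy) as ([z Hz] & L). exists z; exact L.
    + intros y y' z Hy Hy' Hz Hz'.
      assert (HyV := Vκ_trans Hx Hy). assert (HyV' := Vκ_trans Hx Hy').
      assert (E := Dj (to_Vκ HyV) (to_Vκ HyV') (to_Vκ (Vκ_trans HyV Hz)) Hy Hy' Hz Hz').
      now injection E.
    + assert (H : sep hV (fun z => z ∈ c) (union hV x) ∈ Vκ).
      { assert (Hx' := Hx). apply in_Vκ, in_stage_iff in Hx' as (d & Hd & Hx'). apply in_Vκ, in_stage_iff. exists d.
        split; [assumption|]. intros z Hz. apply in_sep in Hz as [Hz _].
        apply in_union in Hz as (y & Hy & Hz).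
        exact (in_stage_trans (ordinal_elem hV Oκ Hd) (Hx' y Hy) Hz). }
      exists (to_Vκ H). intros [y Hy] L. simpl in L. destruct (Hc y L) as (z & [Hz1 Hz2] & Uz).
      exists (to_Vκ (Vκ_trans Hy Hz1)). split.
      * split; [assumption|]. simpl. apply in_sep. split; [|assumption]. apply in_union. eauto.
      * intros [w Hw] [H1 H2]. simpl in H1, H2. apply in_sep in H2 as [_ H2].
        apply sub_eq. simpl. apply Uz. now split.
Qed.

(** * Absoluteness between V_κ and V *)

Lemma Vκ_in_stage (a x : stage_structure) : in_stage a x <-> in_stage (proj1_sig a) (proj1_sig x).
Proof.
  split.
  - induction 1 as [a x c Hc _ IH]. apply in_stage_iff. exists (proj1_sig c). split; [assumption|].
    intros y Hy. exact (IH (to_Vκ (Vκ_trans (proj2_sig x) Hy)) Hy).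
  - intros H. remember (proj1_sig a) as a' eqn:Ea. remember (proj1_sig x) as x' eqn:Ex.
    revert a x Ea Ex. induction H as [a' x' c Hc _ IH]. intros a x -> ->.
    apply in_stage_iff. exists (to_Vκ (Vκ_trans (proj2_sig a) Hc)). split; [assumption|].
    intros y Hy. now apply (IH (proj1_sig y)).
Qed.

Lemma Vκ_ordinal (a : stage_structure) : ordinal (proj1_sig a) -> ordinal a.
Proof.
  intros Oa. split; [|split].
  - intros y Hy z Hz. exact (proj1 Oa _ Hy _ Hz).
  - intros y z Hy Hz. destruct (proj1 (proj2 Oa) _ _ Hy Hz) as [H|[H|H]]; auto.
    right; left. now apply sub_eq.
  - intros u _ E. destruct (zfc_foundation Vκ_universe E) as (y & Hy & N). now exists y.
Qed.

Lemma ordinal_of_Vκ (a : stage_structure) : ordinal a -> ordinal (proj1_sig a).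
Proof.
  intros (T & L & _). split; [|split].
  - intros y Hy z Hz. assert (Hy' := Vκ_trans (proj2_sig a) Hy).
    exact (T (to_Vκ Hy') Hy (to_Vκ (Vκ_trans Hy' Hz)) Hz).
  - intros y z Hy Hz.
    destruct (L (to_Vκ (Vκ_trans (proj2_sig a) Hy)) (to_Vκ (Vκ_trans (proj2_sig a) Hz)) Hy Hz)
      as [H|[H|H]]; auto. right; left. now injection H.
  - intros u _ E. destruct (zfc_foundation hV E) as (y & Hy & N). now exists y.
Qed.

Definition of_κ (x : sub κ) : stage_structure :=
  to_Vκ (proj2 (in_Vκ _) (proj2 (in_stage_ordinal hV Oκ (ordinal_elem hV Oκ (proj2_sig x))) (proj2_sig x))).

Lemma of_κ_ordinal x : ordinal (of_κ x).
Proof. apply Vκ_ordinal. exact (ordinal_elem hV Oκ (proj2_sig x)). Qed.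

Lemma of_κ_elem (x : sub κ) (y : stage_structure) : y ∈ of_κ x -> exists z : sub κ, z ∈ x /\ y = of_κ z.
Proof.
  intros H. exists (exist _ (proj1_sig y) (proj1 Oκ _ (proj2_sig x) _ H)).
  split; [exact H|]. now apply sub_eq.
Qed.

Lemma of_κ_omega (x : sub κ) : proj1_sig x = omega hV -> of_κ x = omega Vκ_universe.
Proof.
  intros E. 
  assert (N : forall n, proj1_sig (num Vκ_universe n) = num hV n).
  { induction n as [|n IH].
    - apply (set_ext hV). intros z. split; intros Hz.
      + exfalso. exact (in_empty (hU := Vκ_universe) (z := to_Vκ (Vκ_trans (proj2_sig (num Vκ_universe 0)) Hz)) Hz).
      + now apply in_empty in Hz.
    - apply (set_ext hV). intros z. change (num hV (Datatypes.S n)) with (suc hV (num hV n)).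
      rewrite in_suc, <- IH. split; intros Hz.
      + assert (H : to_Vκ (Vκ_trans (proj2_sig (num Vκ_universe (Datatypes.S n))) Hz) ∈ suc Vκ_universe (num Vκ_universe n))
          by exact Hz.
        apply in_suc in H as [H|H]; [left; exact H|right]. now rewrite <- H.
      + destruct Hz as [Hz|Hz].
        * exact (proj2 (in_suc Vκ_universe (num Vκ_universe n) (to_Vκ (Vκ_trans (proj2_sig (num Vκ_universe n)) Hz))) (or_introl Hz)).
        * rewrite Hz. exact (proj2 (in_suc Vκ_universe (num Vκ_universe n) (num Vκ_universe n)) (or_intror eq_refl)). }
  apply (set_ext Vκ_universe). intros z. rewrite in_omega. simpl. rewrite E, in_omega.
  split; intros [n En]; exists n.
  - apply sub_eq. now rewrite N.
  - now rewrite En, N.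
Qed.

(** A function of V_κ from an ordinal γ to x amounts to a map on the ordinals below κ, to which the
    abstract regularity applies. *)
Lemma of_κ_regular (x : sub κ) : omega hV ∈ proj1_sig x -> regular_at (@mem (sub κ)) x ->
  regular_uncountable (of_κ x).
Proof.
  intros Hw R. apply (regular_uncountable_intro (hU := Vκ_universe)).
  - apply of_κ_ordinal.
  - rewrite <- (of_κ_omega (x := exist (fun x => x ∈ κ) _ κ_unc) eq_refl). exact Hw.
  - intros y f Hy Hf. destruct (of_κ_elem Hy) as (γ & Hγ & ->).
    pose (F := fun ζ => epsilon (inhabits x) (fun η => of_κ η = fapp Vκ_universe f (of_κ ζ))).
    assert (HF : forall ζ, ζ ∈ γ -> of_κ (F ζ) = fapp Vκ_universe f (of_κ ζ) /\ F ζ ∈ x).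
    { intros ζ Hζ. assert (I := fapp_in Vκ_universe Hf (u := of_κ ζ) Hζ).
      destruct (of_κ_elem I) as (η & Hη & E).
      assert (E' : of_κ (F ζ) = fapp Vκ_universe f (of_κ ζ)).
      { unfold F. apply epsilon_spec. now exists η. }
      split; [assumption|]. rewrite <- E' in I. exact I. }
    destruct (R F γ Hγ) as (δ & Hδ & B); [intros; now apply HF|].
    exists (of_κ δ). split; [exact Hδ|]. intros u v Huv.
    assert (Hu := proj1 (maps_dom Vκ_universe (proj1 Hf) Huv)).
    rewrite (fapp_unique Vκ_universe Hf Huv). destruct (of_κ_elem Hu) as (ζ & Hζ & ->).
    rewrite <- (proj1 (HF ζ Hζ)). now apply (B ζ).
Qed.

End Stage_universe.

(** * Indiscernible ordinals *)

(** The witness is the rank of s, that is, the least c with s ⊆ V_c. *)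
Lemma rank_exists (V : set_structure) (hV : set_universe V) (κ : V) (Oκ : ordinal κ)
    (s : stage_structure hV κ) :
  exists c : sub κ, forall a, ordinal a -> (in_stage a (proj1_sig s) <-> proj1_sig c ∈ a).
Proof.
  destruct s as [s Hs]. simpl. apply (in_Vκ hV Oκ) in Hs.
  destruct (ordinal_least hV (P := fun c => forall y, y ∈ s -> in_stage c y)) as (c & Oc & H & Mc).
  { apply in_stage_iff in Hs as (c & Hc & H). exists c. split; [|assumption].
    exact (ordinal_elem hV Oκ Hc). }
  assert (E : forall a, ordinal a -> (in_stage a s <-> c ∈ a)).
  { intros a Oa. rewrite in_stage_iff. split; [|eauto].
    intros (d & Hd & H'). assert (Od := ordinal_elem hV Oa Hd).
    destruct (ordinal_trichotomy hV Oc Od) as [L|[->|L]]; [|assumption|].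
    - now apply (proj1 Oa d).
    - exfalso. now apply (Mc d). }
  assert (Hc : c ∈ κ) by now apply E.
  now exists (exist _ c Hc).
Qed.

Theorem indiscernible_ordinals (V : set_structure) (hV : set_universe V) (β κ : V)
    (Lβ : limit_ordinal β) (Eκ : Erdos β κ) (K : Type) (HK : countable K)
    (Ψ : K -> list (stage_structure hV κ) -> stage_structure hV κ -> Prop) :
  exists h : sub β -> stage_structure hV κ,
    increasing (@mem (sub β)) (@mem (stage_structure hV κ)) h /\
    (forall ξ, regular_uncountable (h ξ)) /\
    forall i a t a' t' s, sorted (@mem (sub β)) (a :: t) -> sorted (@mem (sub β)) (a' :: t') ->
      length t = length t' -> in_stage (h a) s -> in_stage (h a') s ->
      (Ψ i (map h (a :: t)) s <-> Ψ i (map h (a' :: t')) s).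
Proof.
  destruct (Erdos_least hV Lβ Eκ) as (Oκ & Aκ & Mκ).
  assert (Rκ := κ_regular hV Lβ Oκ Aκ Mκ). assert (Sκ := κ_strong_limit hV Lβ Oκ Aκ Mκ).
  assert (Uκ := κ_uncountable hV Lβ Oκ Aκ Mκ). assert (Lκ := κ_limit Oκ Rκ Uκ).
  destruct (limit_inhabited Lβ) as [b0 _].
  pose (rk := fun s : stage_structure hV κ => proj1_sig (constructive_indefinite_description _ (rank_exists Oκ s))).
  assert (Hrk : forall (s : stage_structure hV κ) a, ordinal a -> (in_stage a (proj1_sig s) <-> proj1_sig (rk s) ∈ a)).
  { intros s. exact (proj2_sig (constructive_indefinite_description _ (rank_exists Oκ s))). }
  clearbody rk.
  (* An ordinal below κ together with an injection of V_{ρ+1} into it. It is chosen from ρ alone, so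
     that sets of equal rank are coded by the same injection. *)
  assert (P : forall ρ : sub κ, exists p : V * (V -> V), fst p ∈ κ /\
    (forall x, x ∈ stage hV (suc hV (proj1_sig ρ)) -> snd p x ∈ fst p) /\
    (forall x y, x ∈ stage hV (suc hV (proj1_sig ρ)) -> y ∈ stage hV (suc hV (proj1_sig ρ)) ->
       snd p x = snd p y -> x = y)).
  { intros [ρ Hρ]. simpl. destruct (small_injection Oκ Uκ
      (small_stage Oκ Rκ Sκ Uκ (limit_suc hV Lκ Hρ))) as (η & j & H1 & H2 & H3).
    now exists (η, j). }
  pose (p := fun ρ => proj1_sig (constructive_indefinite_description _ (P ρ))).
  assert (Hp : forall ρ, fst (p ρ) ∈ κ /\
    (forall x, x ∈ stage hV (suc hV (proj1_sig ρ)) -> snd (p ρ) x ∈ fst (p ρ)) /\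
    (forall x y, x ∈ stage hV (suc hV (proj1_sig ρ)) -> y ∈ stage hV (suc hV (proj1_sig ρ)) ->
       snd (p ρ) x = snd (p ρ) y -> x = y)).
  { intros ρ. exact (proj2_sig (constructive_indefinite_description _ (P ρ))). }
  clearbody p.
  assert (Hs : forall s : stage_structure hV κ, proj1_sig s ∈ stage hV (suc hV (proj1_sig (rk s)))).
  { intros s. assert (O1 := ordinal_suc hV (ordinal_elem hV Oκ (proj2_sig (rk s)))).
    apply in_stage_set; [assumption|]. apply Hrk; [assumption|]. apply in_suc. now right. }
  pose (bd := fun ρ => exist (fun x => x ∈ κ) (fst (p ρ)) (proj1 (Hp ρ)) : sub κ).
  pose (code := fun s => exist (fun x => x ∈ κ) (snd (p (rk s)) (proj1_sig s))
    (proj1 Oκ _ (proj1 (Hp (rk s))) _ (proj1 (proj2 (Hp (rk s))) _ (Hs s))) : sub κ).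
  (* The lower bound ω + 1 makes ω an element of every term of h. *)
  assert (Hu0 : suc hV (omega hV) ∈ κ) by now apply (limit_suc hV Lκ).
  destruct (good_indiscernibles (sub_well_order hV Oκ) (sub_well_order hV (proj1 Lβ)) b0
    (limit_no_max Lβ) (κ_arrow hV Lβ Oκ Aκ) (not_arrow_coloring hV Oκ Lβ Mκ) HK
    (of_κ hV Oκ (exist (fun x => x ∈ κ) _ Uκ)) (rk := rk) (code := code) (bd := bd)) with
    (u0 := exist (fun x => x ∈ κ) _ Hu0 : sub κ)
    (Ψ := fun i l s => Ψ i (map (of_κ hV Oκ) l) s) as (h & I & H0 & HR & HΨ).
  - intros s. apply (proj1 (proj2 (Hp (rk s)))). apply Hs.
  - intros s s' E E'. apply sub_eq. apply (f_equal (@proj1_sig _ _)) in E'. simpl in E'.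
    rewrite <- E in E'. apply (proj2 (proj2 (Hp (rk s)))); auto. rewrite E. apply Hs.
  - assert (Hst : forall a s, in_stage (of_κ hV Oκ (h a)) s <-> rk s ∈ h a).
    { intros a s. rewrite (Vκ_in_stage Oκ). simpl. apply Hrk.
      exact (ordinal_elem hV Oκ (proj2_sig (h a))). }
    exists (fun ξ => of_κ hV Oκ (h ξ)). split; [|split].
    + intros x y L. exact (I x y L).
    + intros ξ. apply (of_κ_regular Oκ Rκ Sκ Uκ); [|apply HR].
      apply NNPP. intros N. apply (H0 ξ). simpl.
      assert (Oh := ordinal_elem hV Oκ (proj2_sig (h ξ))).
      apply (ordinal_not_in hV (omega_ordinal hV) Oh) in N.
      apply (ordinal_subset hV Oh (omega_ordinal hV)) in N. now apply in_suc.
    + intros i a t a' t' s S1 S2 El H1 H2.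
      assert (G := HΨ i a t a' t' s S1 S2 El (proj1 (Hst a s) H1) (proj1 (Hst a' s) H2)).
      cbv beta in G. now rewrite !map_map in G.
Qed.

(** * Relativization of formulas to a stage of the cumulative hierarchy *)

Definition fex (φ : formula unit) : formula unit := FNot (FAll (FNot φ)).
Definition fimp (φ ψ : formula unit) : formula unit := FNot (FAnd φ (FNot ψ)).
Definition fiff (φ ψ : formula unit) : formula unit := FAnd (fimp φ ψ) (fimp ψ φ).
Definition f_or (φ ψ : formula unit) : formula unit := fimp (FNot φ) ψ.

Section Connectives.
Context (S : set_structure) (D : S -> Prop) (P : unit -> S -> Prop).

Lemma sat_fex e φ : sat D P e (fex φ) <-> exists x, D x /\ sat D P (scons x e) φ.
Proof.
  simpl. split.
  - intros H. apply NNPP. intros N. apply H. intros x Hx Hs. apply N. eauto.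
  - intros (x & Hx & Hs) H. exact (H x Hx Hs).
Qed.

Lemma sat_fimp e φ ψ : sat D P e (fimp φ ψ) <-> (sat D P e φ -> sat D P e ψ).
Proof. simpl. split; [intros H H1; apply NNPP; tauto|tauto]. Qed.

Lemma sat_fiff e φ ψ : sat D P e (fiff φ ψ) <-> (sat D P e φ <-> sat D P e ψ).
Proof.
  change (sat D P e (fimp φ ψ) /\ sat D P e (fimp ψ φ) <-> (sat D P e φ <-> sat D P e ψ)).
  rewrite !sat_fimp. tauto.
Qed.

Lemma sat_f_or e φ ψ : sat D P e (f_or φ ψ) <-> (sat D P e φ \/ sat D P e ψ).
Proof. unfold f_or. rewrite sat_fimp. simpl. tauto. Qed.

Lemma sat_fall_fiff e φ ψ : sat D P e (FAll (fiff φ ψ)) <->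
  forall x, D x -> (sat D P (scons x e) φ <-> sat D P (scons x e) ψ).
Proof.
  change (sat D P e (FAll (fiff φ ψ))) with (forall x, D x -> sat D P (scons x e) (fiff φ ψ)).
  split; intros H x Hx; specialize (H x Hx); now apply sat_fiff.
Qed.

Lemma sat_fall_fimp e φ ψ : sat D P e (FAll (fimp φ ψ)) <->
  forall x, D x -> sat D P (scons x e) φ -> sat D P (scons x e) ψ.
Proof.
  change (sat D P e (FAll (fimp φ ψ))) with (forall x, D x -> sat D P (scons x e) (fimp φ ψ)).
  split; intros H x Hx; specialize (H x Hx); now apply sat_fimp.
Qed.

Lemma sat_coincide φ k e e' : free_below k φ -> (forall i, i < k -> e i = e' i) ->
  (sat D P e φ <-> sat D P e' φ).
Proof.
  revert k e e'. induction φ as [i j|i j|q i|φ IH|φ IH ψ IH2|φ IH]; simpl; intros k e e' Hk He.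
  - now rewrite !He.
  - now rewrite !He.
  - now rewrite !He.
  - now rewrite (IH k e e').
  - now rewrite (IH k e e'), (IH2 k e e').
  - split; intros H x Hx; specialize (H x Hx); revert H;
      apply (IH (Datatypes.S k)); auto; intros [|i] Hi; simpl; auto; [symmetry|]; apply He; lia.
Qed.

End Connectives.

Lemma sat_ext (S : set_structure) (D : S -> Prop) (P P' : unit -> S -> Prop) φ e :
  (forall q x, D x -> (P q x <-> P' q x)) -> (forall i, D (e i)) ->
  (sat D P e φ <-> sat D P' e φ).
Proof.
  intros HP. revert e. induction φ as [i j|i j|q i|φ IH|φ IH ψ IH2|φ IH]; simpl; intros e He.
  - tauto.
  - tauto.
  - now apply HP.
  - now rewrite IH.
  - now rewrite IH, IH2.
  - split; intros H x Hx; specialize (H x Hx); revert H; apply IH; intros [|i]; simpl; auto.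
Qed.

Definition fsub (i j : nat) : formula unit :=
  FAll (fimp (FIn _ 0 (Datatypes.S i)) (FIn _ 0 (Datatypes.S j))).

(* The variable h denotes a set of stages closed under predecessors: every x in h is
   {y | y ⊆ d for some d in both x and h}. *)
Definition fhist (h : nat) : formula unit :=
  FAll (fimp (FIn _ 0 (Datatypes.S h)) (FAll (fiff (FIn _ 0 1)
    (fex (FAnd (FIn _ 0 2) (FAnd (FIn _ 0 (3 + h)) (fsub 1 0))))))).

(* The value of i belongs to V_c, where c is the value of j. *)
Definition fstage (i j : nat) : formula unit :=
  fex (FAnd (fhist 0) (FAnd (fex (FAnd (FIn _ 0 1) (fsub (2 + i) 0)))
    (FNot (fex (FAnd (FIn _ 0 1) (fsub (2 + j) 0)))))).

Definition fpair (p x y : nat) : formula unit :=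
  FAll (fiff (FIn _ 0 (Datatypes.S p))
    (f_or (FAll (fiff (FIn _ 0 1) (f_or (FEq _ 0 (2 + x)) (FEq _ 0 (2 + x)))))
          (FAll (fiff (FIn _ 0 1) (f_or (FEq _ 0 (2 + x)) (FEq _ 0 (2 + y))))))).

(* The quantifiers of φ are restricted to V_c, where c is a variable. *)
Fixpoint relativize (c : nat) (φ : formula unit) : formula unit :=
  match φ with
  | FNot φ => FNot (relativize c φ)
  | FAnd φ ψ => FAnd (relativize c φ) (relativize c ψ)
  | FAll φ => FAll (fimp (fstage 0 (Datatypes.S c)) (relativize (Datatypes.S c) φ))
  | _ => φ
  end.

(* The second variable is a pair (x, y), and V_c satisfies φ(x, y), where c is the first. *)
Definition fsat_at (φ : formula unit) : formula unit := fex (fex (FAnd (fpair 3 0 1) (relativize 2 φ))).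

Lemma relativize_free φ c k : c < k -> free_below k φ -> free_below k (relativize c φ).
Proof.
  revert c k. induction φ as [i j|i j|q i|φ IH|φ IH ψ IH2|φ IH]; simpl; intros c k Hc Hf; auto.
  - destruct Hf; auto.
  - repeat split; try lia. apply IH; [lia|assumption].
Qed.

Lemma fsat_at_free φ : free_below 2 φ -> free_below 2 (fsat_at φ).
Proof.
  intros H. unfold fsat_at.
  assert (H' : free_below 4 (relativize 2 φ)).
  { apply relativize_free; [lia|]. 
    assert (mono : forall φ k k', k <= k' -> free_below (Q := unit) k φ -> free_below k' φ).
    { clear. induction φ; simpl; intros k k' L; try lia.
      - now apply IHφ.
      - intros [H1 H2]. split; [eapply IHφ1|eapply IHφ2]; eauto.
      - apply IHφ. lia. }
    apply mono with 2; [lia|assumption]. }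
  simpl. repeat split; (lia || assumption).
Qed.

Definition env2 (A : Type) (x y : A) (i : nat) : A := match i with 0 => x | _ => y end.

Section Relativization.
Context (U : set_structure) (hU : set_universe U).
Context (i : U) (Li : limit_ordinal i) (P : unit -> U -> Prop).
Let D := in_stage i.

Lemma limit_stage_elem x y : D x -> y ∈ x -> D y.
Proof. apply in_stage_trans, Li. Qed.

Lemma sat_fsub e m n : D (e m) -> (sat D P e (fsub m n) <-> e m ⊆ e n).
Proof.
  intros Hm. unfold fsub. rewrite sat_fall_fimp. simpl. split.
  - intros H z Hz. exact (H z (limit_stage_elem Hm Hz) Hz).
  - intros H z _. exact (H z).
Qed.

Lemma sat_fpair e p x y : D (e p) -> D (e x) -> D (e y) ->
  (sat D P e (fpair p x y) <-> e p = opair hU (e x) (e y)).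
Proof.
  intros Hp Hx Hy. unfold fpair.
  assert (A1 : forall z u v, D (e u) -> D (e v) -> D z ->
    (sat D P (scons z e) (FAll (fiff (FIn unit 0 1) (f_or (FEq unit 0 (2 + u)) (FEq unit 0 (2 + v)))))
     <-> z = upr hU (e u) (e v))).
  { intros z u v Hu Hv Hz. rewrite sat_fall_fiff.
    assert (B : forall w, sat D P (scons w (scons z e)) (f_or (FEq unit 0 (2 + u)) (FEq unit 0 (2 + v)))
      <-> w = e u \/ w = e v) by (intros w; apply sat_f_or).
    split.
    - intros H. apply (set_ext hU). intros w. rewrite in_upr. split; intros Hw.
      + apply B. apply (H w (limit_stage_elem Hz Hw)). exact Hw.
      + assert (Dw : D w) by (destruct Hw; now subst). apply (H w Dw). now apply B.
    - intros -> w Hw. rewrite B. apply in_upr. }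
  assert (A2 : sat D P e (fpair p x y) <-> forall z, D z ->
     (z ∈ e p <-> z = upr hU (e x) (e x) \/ z = upr hU (e x) (e y))).
  { unfold fpair. rewrite sat_fall_fiff.
    split; intros H z Hz; specialize (H z Hz); rewrite sat_f_or, !A1 in *; auto. }
  fold (fpair p x y). rewrite A2. split.
  - intros H. apply (set_ext hU). intros z. unfold opair. rewrite in_upr. split; intros Hz.
    + apply H; [exact (limit_stage_elem Hp Hz)|assumption].
    + apply H; [|assumption]. destruct Hz as [->| ->]; now apply (in_stage_upr hU Li).
  - intros -> z _. unfold opair. apply in_upr.
Qed.

Definition history (h : U) : Prop :=
  forall x, x ∈ h -> forall y, y ∈ x <-> exists d, d ∈ x /\ d ∈ h /\ y ⊆ d.

Lemma sat_fhist e m : D (e m) -> (sat D P e (fhist m) <-> history (e m)).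
Proof.
  intros Hm.
  assert (A1 : forall x y, D x -> D y ->
    (sat D P (scons y (scons x e)) (fex (FAnd (FIn _ 0 2) (FAnd (FIn _ 0 (3 + m)) (fsub 1 0))))
     <-> exists d, d ∈ x /\ d ∈ e m /\ y ⊆ d)).
  { intros x y Hx Hy. rewrite sat_fex. split.
    - intros (d & Hd & H1 & H2 & H3). apply sat_fsub in H3; [|exact Hy]. simpl in H1, H2, H3. eauto.
    - intros (d & H1 & H2 & H3). exists d. split; [exact (limit_stage_elem Hx H1)|].
      split; [exact H1|]. split; [exact H2|]. apply sat_fsub; [exact Hy|exact H3]. }
  unfold fhist. rewrite sat_fall_fimp. split.
  - intros H x Hx y. assert (Dx := limit_stage_elem Hm Hx). specialize (H x Dx Hx).
    rewrite sat_fall_fiff in H.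
    assert (C : D y -> (y ∈ x <-> exists d, d ∈ x /\ d ∈ e m /\ y ⊆ d)).
    { intros Dy. specialize (H y Dy). now rewrite A1 in H. }
    split.
    + intros Hy. apply C; [exact (limit_stage_elem Dx Hy)|assumption].
    + intros E. apply C; [|assumption]. destruct E as (d & H1 & _ & H3).
      exact (in_stage_subset (limit_stage_elem Dx H1) H3).
  - intros H x Dx Hx. apply sat_fall_fiff. intros y Dy. rewrite A1; auto.
    exact (H x Hx y).
Qed.

(** By ∈-induction: x is the union of the power sets of those members of h that lie in x, and these
    are stages by induction. The index of x is the set of ordinals in x. Histories thus describe the
    hierarchy by ∈ and ⊆ alone, without functions or pairs in the formula. *)
Lemma history_stage h : history h -> forall x, x ∈ h ->
  exists b, ordinal b /\ forall y, y ∈ x <-> in_stage b y.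
Proof.
  intros Hh. apply NNPP. intros N.
  destruct (zfc_foundation hU (x := sep hU (fun x => ~ exists b, ordinal b /\ forall y, y ∈ x <-> in_stage b y) h))
    as (x & Hx & M).
  { apply NNPP. intros N2. apply N. intros x Hx. apply NNPP. intros N3. apply N2.
    exists x. apply in_sep. now split. }
  apply in_sep in Hx as [Hx Nx]. apply Nx.
  assert (G : forall d, d ∈ x -> d ∈ h -> exists b, ordinal b /\ forall y, y ∈ d <-> in_stage b y).
  { intros d H1 H2. apply NNPP. intros N2. apply (M d); [|assumption]. apply in_sep. now split. }
  assert (T : forall y d, d ∈ x -> d ∈ h -> y ⊆ d -> y ∈ x).
  { intros y d H1 H2 H3. apply (Hh x Hx). eauto. }
  assert (O : ordinal (sep hU (@ordinal U) x)).
  { apply (transitive_ordinals hU); [|intros y Hy; now apply in_sep in Hy].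
    intros y Hy z Hz. apply in_sep in Hy as [Hy Oy]. apply in_sep.
    assert (Oz := ordinal_elem hU Oy Hz). split; [|assumption].
    apply (Hh x Hx) in Hy as (d & H1 & H2 & H3). apply (T z d); auto.
    destruct (G d H1 H2) as (b & Ob & Hb). intros w Hw. apply Hb.
    apply in_stage_trans with z; auto. apply Hb, H3, Hz. }
  exists (sep hU (@ordinal U) x). split; [assumption|]. intros y. split.
  - intros Hy. apply (Hh x Hx) in Hy as (d & H1 & H2 & H3).
    destruct (G d H1 H2) as (b & Ob & Hb). apply in_stage_iff. exists b. split.
    + apply in_sep. split; [|assumption]. apply (T b d); auto.
      intros c Hc. apply Hb. apply (in_stage_ordinal hU); auto. exact (ordinal_elem hU Ob Hc).
    + intros z Hz. apply Hb. auto.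
  - intros Hy. apply in_stage_iff in Hy as (c & Hc & Hy). apply in_sep in Hc as [Hc Oc].
    apply (Hh x Hx) in Hc as (d & H1 & H2 & H3). apply (T y d); auto.
    destruct (G d H1 H2) as (b & Ob & Hb). intros z Hz. apply Hb.
    apply in_stage_mono with c; [|auto].
    intros w Hw. apply (in_stage_ordinal hU); auto; [exact (ordinal_elem hU Oc Hw)|].
    apply Hb, H3, Hw.
Qed.

(** For a stage, c ⊆ V_b means c ≤ b. So if no member of h includes c, the member V_b that includes
    x has b < c. *)
Lemma in_stage_of_history (c x h : U) : ordinal c -> history h ->
  (exists d, d ∈ h /\ x ⊆ d) -> ~ (exists d, d ∈ h /\ c ⊆ d) -> in_stage c x.
Proof.
  intros Oc Hh (d & Hd & Hxd) N.
  destruct (history_stage Hh Hd) as (b & Ob & Hb). apply in_stage_iff. exists b. split.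
  - apply NNPP. intros N2. apply N. exists d. split; [assumption|].
    apply (ordinal_not_in hU Ob Oc) in N2. intros z Hz. apply Hb.
    apply (in_stage_ordinal hU Ob); [exact (ordinal_elem hU Oc Hz)|]. auto.
  - intros y Hy. apply Hb. auto.
Qed.

(** The history consists of all V_b with b < c. It lies in V_{c+1}, hence in V_i for every limit i >
    c, where [fstage] is evaluated. *)
Lemma history_of_in_stage (c x : U) : ordinal c -> in_stage c x ->
  exists h, in_stage (suc hU c) h /\ history h /\
     (exists d, d ∈ h /\ x ⊆ d) /\ ~ exists d, d ∈ h /\ c ⊆ d.
Proof.
  intros Oc Hx. set (h := image hU (stage hU) c).
  assert (Sb : forall b, b ∈ c -> forall z, z ∈ stage hU b <-> in_stage b z).
  { intros b Hb z. apply in_stage_set. exact (ordinal_elem hU Oc Hb). }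
  assert (In_st : forall b d, b ∈ c -> d ∈ b -> stage hU d ∈ stage hU b).
  { intros b d Hb Hd. apply Sb; [assumption|]. apply in_stage_iff. exists d.
    split; [assumption|]. intros y. apply (Sb d). exact (proj1 Oc _ Hb _ Hd). }
  exists h. split; [|split; [|split]].
  - apply in_stage_iff. exists c. split; [apply in_suc; auto|]. intros y Hy.
    apply in_image in Hy as (b & Hb & ->). apply in_stage_iff. exists b.
    split; [assumption|]. intros z. now apply Sb.
  - intros y Hy z. apply in_image in Hy as (b & Hb & ->). rewrite Sb; [|assumption].
    rewrite in_stage_iff. split.
    + intros (d & Hd & H). exists (stage hU d). assert (Hdc := proj1 Oc _ Hb _ Hd).
      split; [auto|]. split; [apply in_image; eauto|]. intros w Hw. apply Sb; auto.
    + intros (w & H1 & H2 & H3). apply in_image in H2 as (d & Hd & ->). exists d. split.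
      * assert (Od := ordinal_elem hU Oc Hd). assert (Ob := ordinal_elem hU Oc Hb).
         apply Sb in H1; [|assumption]. apply (in_stage_ordinal hU Ob Od).
         apply in_stage_iff in H1 as (g & Hg & H1). apply in_stage_iff. exists g.
         split; [assumption|]. intros w Hw. apply H1. apply Sb; [assumption|].
         apply (in_stage_ordinal hU Od); [exact (ordinal_elem hU Od Hw)|assumption].
      * intros y Hy. apply Sb; auto.
  - apply in_stage_iff in Hx as (b & Hb & Hx). exists (stage hU b).
    split; [apply in_image; eauto|]. intros z Hz. apply Sb; auto.
  - intros (d & Hd & H). apply in_image in Hd as (b & Hb & ->).
    assert (Ob := ordinal_elem hU Oc Hb). specialize (H b Hb).
    apply Sb in H; [|assumption]. apply (in_stage_ordinal hU Ob Ob) in H. now apply (not_self hU) in H.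
Qed.

Lemma sat_fstage e m n : e n ∈ i -> D (e m) ->
  (sat D P e (fstage m n) <-> in_stage (e n) (e m)).
Proof.
  intros Hc Hm. assert (Oc := ordinal_elem hU (proj1 Li) Hc).
  assert (Dn : D (e n)) by (apply (in_stage_ordinal hU (proj1 Li) Oc); assumption).
  unfold fstage. rewrite sat_fex.
  assert (A1 : forall h k, D h -> D (e k) ->
    (sat D P (scons h e) (fex (FAnd (FIn _ 0 1) (fsub (2 + k) 0))) <-> exists d, d ∈ h /\ e k ⊆ d)).
  { intros h k Hh Hk. rewrite sat_fex. split.
    - intros (d & Hd & H1 & H2). apply sat_fsub in H2; [|exact Hk]. exists d. now split.
    - intros (d & H1 & H2). exists d. split; [exact (limit_stage_elem Hh H1)|]. split; [exact H1|].
      apply sat_fsub; [exact Hk|exact H2]. }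
  split.
  - intros (h & Hh & H1 & H2 & H3). apply sat_fhist in H1; [|exact Hh]. apply A1 in H2; auto.
    change (~ sat D P (scons h e) (fex (FAnd (FIn _ 0 1) (fsub (2 + n) 0)))) in H3.
    rewrite A1 in H3; auto.
    now apply (in_stage_of_history (h := h)).
  - intros Hx. destruct (history_of_in_stage Oc Hx) as (h & Hh & H1 & H2 & H3). exists h.
    assert (Dh : D h).
    { unfold D. apply in_stage_mono with (suc hU (e n)); [|assumption].
      apply (proj1 (proj1 Li)). now apply (limit_suc hU Li). }
    split; [assumption|]. split; [apply sat_fhist; assumption|]. split; [now apply A1|].
    change (~ sat D P (scons h e) (fex (FAnd (FIn _ 0 1) (fsub (2 + n) 0)))).
    now rewrite A1.
Qed.

Lemma sat_relativize c φ : c ∈ i -> forall n e, e n = c ->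
  (sat D P e (relativize n φ) <-> sat (in_stage c) P e φ).
Proof.
  intros Hc. induction φ as [m j|m j|q m|φ IH|φ IH ψ IH2|φ IH]; intros n e E; try tauto.
  - simpl. now rewrite IH.
  - simpl. now rewrite IH, IH2.
  - assert (Mono : forall x, in_stage c x -> D x).
    { intros x. apply in_stage_mono. now apply (proj1 (proj1 Li)). }
    simpl relativize. rewrite sat_fall_fimp. split.
    + intros H x Hx. apply (IH (Datatypes.S n)); [assumption|]. apply H; [auto|].
      apply sat_fstage; simpl; rewrite ?E; auto.
    + intros H x Dx Hs. apply (IH (Datatypes.S n)); [assumption|]. apply H.
      apply sat_fstage in Hs; simpl in Hs |- *; rewrite ?E in *; auto.
Qed.

(** The arguments x and y are packed into one pair because the formulas in the reflection property
    have two free variables, one of which is taken by c. Since c is a limit, the pair lies in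
    V_c. *)
Lemma sat_fsat_at c x y φ : limit_ordinal c -> c ∈ i -> free_below 2 φ ->
  in_stage c x -> in_stage c y ->
  (sat D P (env2 c (opair hU x y)) (fsat_at φ) <-> sat (in_stage c) P (env2 x y) φ).
Proof.
  intros Lc Hc Hφ Hx Hy.
  assert (Mono : forall x, in_stage c x -> D x).
  { intros z. apply in_stage_mono. now apply (proj1 (proj1 Li)). }
  assert (Hp := Mono _ (in_stage_opair hU Lc Hx Hy)).
  assert (E : sat D P (scons x (scons y (env2 c (opair hU x y)))) (relativize 2 φ) <->
     sat (in_stage c) P (env2 x y) φ).
  { rewrite (sat_relativize (c := c)); auto. apply (sat_coincide _ _ (k := 2)); [assumption|].
    intros [|[|k]] Hk; [reflexivity|reflexivity|lia]. }
  unfold fsat_at. rewrite sat_fex. split.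
  - intros (y' & Hy' & H). apply sat_fex in H as (x' & Hx' & H1 & H2).
    apply sat_fpair in H1; auto. simpl in H1. apply opair_inj in H1 as [<- <-]. now apply E.
  - intros H. exists y. split; [auto|]. apply sat_fex. exists x. split; [auto|].
    split; [|now apply E]. apply sat_fpair; auto.
Qed.

End Relativization.

(** * Reflective cardinals from indiscernibles *)

(* For an increasing list l = i0, …, in, [reflective_below n l] is R_n below i0. *)
Fixpoint reflective_below (U : set_structure) (n : nat) (l : list U) (a : U) : Prop :=
  match n with
  | 0 => regular_uncountable a
  | Datatypes.S n =>
    match l with
    | i :: ((j :: _) as l') =>
      ordinal a /\ positive a /\ a ∈ i /\
      forall φ, free_below 2 φ -> forall s, in_stage a s ->
        (sat (in_stage i) (fun _ : unit => reflective_below n (firstn (Datatypes.S n) l)) (env2 a s) φ <->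
         sat (in_stage j) (fun _ : unit => reflective_below n l') (env2 i s) φ)
    | _ => False
    end
  end.

(** The conditions for which I has to be indiscernible: with [None], membership of s in R_n; with
    [Some φ], truth of φ(i, s) in V_j, where R_n is computed from the list that starts at j. Lists
    too short for the second kind get the value [True]. *)
Definition reflection_family (U : set_structure) (k : nat * option (formula unit)) (l : list U) (s : U) : Prop :=
  match snd k, l with
  | None, _ => reflective_below (fst k) l s
  | Some φ, i :: ((j :: _) as l') => sat (in_stage j) (fun _ : unit => reflective_below (fst k) l') (env2 i s) φ
  | _, _ => True
  end.

Section Reflective.
Context (U : set_structure) (hU : set_universe U).
Context (B : Type) (ltB : B -> B -> Prop) (WB : well_order ltB)
  (limB : forall x, exists y, ltB x y).
Context (h : B -> U) (Ih : increasing ltB (@mem U) h) (Rh : forall x, regular_uncountable (h x)).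
Context (Gh : forall k a t a' t' s, sorted ltB (a :: t) -> sorted ltB (a' :: t') ->
  length t = length t' -> in_stage (h a) s -> in_stage (h a') s ->
  (reflection_family k (map h (a :: t)) s <-> reflection_family k (map h (a' :: t')) s)).

(* The range of h may be bounded, hence the separate clause for R_0. *)
Definition n_reflective (n : nat) (a : U) : Prop :=
  match n with
  | 0 => regular_uncountable a
  | _ => exists x t,
      sorted ltB (x :: t) /\ length t = n /\ in_stage (h x) a /\ reflective_below n (map h (x :: t)) a
  end.

Lemma h_limit x : limit_ordinal (h x).
Proof. exact (regular_uncountable_limit hU (Rh x)). Qed.

Lemma h_ordinal x : ordinal (h x).
Proof. apply h_limit. Qed.

Lemma h_mono x y a : ltB x y -> in_stage (h x) a -> in_stage (h y) a.
Proof.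
  intros L. apply in_stage_mono. apply (proj1 (h_ordinal y)). now apply Ih.
Qed.

Lemma h_in_stage x y : ltB x y -> in_stage (h y) (h x).
Proof. intros L. apply (in_stage_ordinal hU); auto using h_ordinal. Qed.

Lemma stage_trans x a s : in_stage (h x) a -> ordinal a -> in_stage a s -> in_stage (h x) s.
Proof.
  intros H Oa. apply in_stage_mono. apply (proj1 (h_ordinal x)).
  now apply (in_stage_ordinal hU (h_ordinal x) Oa).
Qed.

(** By the instance [None] of indiscernibility, all lists that start above a decide membership of a
    in the same way. *)
Lemma reflective_below_iff n x t a : sorted ltB (x :: t) -> length t = n -> in_stage (h x) a ->
  (reflective_below n (map h (x :: t)) a <-> n_reflective n a).
Proof.
  intros Sx L Ha. destruct n as [|n]; [reflexivity|].
  split; [intros H; exists x, t; auto|]. intros (x' & t' & Sx' & L' & Ha' & H). 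
  exact (proj2 (Gh (Datatypes.S n, None) Sx Sx' (eq_trans L (eq_sym L')) Ha Ha') H).
Qed.

Lemma env2_in (D : U -> Prop) a s k : D a -> D s -> D (env2 a s k).
Proof. now destruct k. Qed.

Lemma sat_reflective_below n x t a s φ : sorted ltB (x :: t) -> length t = n ->
  in_stage (h x) a -> in_stage (h x) s ->
  (sat (in_stage (h x)) (fun _ : unit => reflective_below n (map h (x :: t))) (env2 a s) φ <->
   sat (in_stage (h x)) (fun _ : unit => n_reflective n) (env2 a s) φ).
Proof.
  intros Sx L Ha Hs. apply sat_ext.
  - intros _ y Hy. now apply reflective_below_iff.
  - intros k. now apply env2_in.
Qed.

(** Each pair is extended to an increasing list, so that R_n is given by [reflective_below] and the
    instance [Some φ] of indiscernibility applies. *)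
Lemma sat_self n x y x' y' s φ : ltB x y -> ltB x' y' -> in_stage (h x) s -> in_stage (h x') s ->
  (sat (in_stage (h y)) (fun _ : unit => n_reflective n) (env2 (h x) s) φ <->
   sat (in_stage (h y')) (fun _ : unit => n_reflective n) (env2 (h x') s) φ).
Proof.
  assert (A1 : forall x y, ltB x y -> exists t, length t = n /\ sorted ltB (x :: y :: t)).
  { clear x y x' y'. intros x y L. destruct (sorted_from WB limB y n) as (t & Lt & St).
    exists t. split; [assumption|]. constructor; [assumption|].
    inversion St as [|? ? St' Ft]; subst. constructor; [assumption|].
    eapply Forall_impl; [|exact Ft]. intros z Hz. eapply wo_trans; eauto. }
  intros L L' Hs Hs'.
  destruct (A1 x y L) as (t & Lt & St), (A1 x' y' L') as (t' & Lt' & St').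
  assert (St2 := St). assert (St2' := St').
  apply StronglySorted_inv in St2 as [St2 _], St2' as [St2' _].
  rewrite <- (sat_reflective_below φ St2 Lt (h_in_stage L) (h_mono L Hs)).
  rewrite <- (sat_reflective_below φ St2' Lt' (h_in_stage L') (h_mono L' Hs')).
  apply (Gh (n, Some φ) St St'); auto. simpl. congruence.
Qed.

Definition reflects n a x y : Prop := forall φ, free_below 2 φ -> forall s, in_stage a s ->
  (sat (in_stage (h x)) (fun _ : unit => n_reflective n) (env2 a s) φ <->
   sat (in_stage (h y)) (fun _ : unit => n_reflective n) (env2 (h x) s) φ).

Lemma n_reflective_succ n a x y : ltB x y -> in_stage (h x) a ->
  (n_reflective (Datatypes.S n) a <-> ordinal a /\ positive a /\ reflects n a x y).
Proof.
  intros L Ha. destruct (sorted_from WB limB y n) as (t & Lt & St).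
  assert (Sx : sorted ltB (x :: y :: t)).
  { constructor; [assumption|]. inversion St as [|? ? St' Ft]; subst. constructor; [assumption|].
    eapply Forall_impl; [|exact Ft]. intros z Hz. eapply wo_trans; eauto. }
  rewrite <- (reflective_below_iff (n := Datatypes.S n) Sx); [|simpl; lia|assumption].
  assert (Sf : sorted ltB (x :: firstn n (y :: t))).
  { rewrite <- (firstn_skipn (Datatypes.S n) (x :: y :: t)) in Sx. now apply sorted_app in Sx. }
  assert (Lf : length (firstn n (y :: t)) = n) by (rewrite length_firstn; simpl; lia).
  change (reflective_below (Datatypes.S n) (map h (x :: y :: t)) a) with
    (ordinal a /\ positive a /\ a ∈ h x /\ forall φ, free_below 2 φ -> forall s, in_stage a s ->
        (sat (in_stage (h x)) (fun _ : unit => reflective_below n (h x :: firstn n (map h (y :: t)))) (env2 a s) φ <->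
         sat (in_stage (h y)) (fun _ : unit => reflective_below n (map h (y :: t))) (env2 (h x) s) φ)).
  rewrite firstn_map.
  assert (E : ordinal a -> forall φ s, in_stage a s ->
    ((sat (in_stage (h x)) (fun _ : unit => reflective_below n (h x :: map h (firstn n (y :: t)))) (env2 a s) φ <->
      sat (in_stage (h y)) (fun _ : unit => reflective_below n (map h (y :: t))) (env2 (h x) s) φ) <->
     (sat (in_stage (h x)) (fun _ : unit => n_reflective n) (env2 a s) φ <->
      sat (in_stage (h y)) (fun _ : unit => n_reflective n) (env2 (h x) s) φ))).
  { intros Oa φ s Hs. assert (Hxs := stage_trans Ha Oa Hs).
    rewrite <- (sat_reflective_below φ Sf Lf Ha Hxs), <- (sat_reflective_below φ St Lt (h_in_stage L) (h_mono L Hxs)).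
    reflexivity. }
  split.
  - intros (Oa & Pa & _ & H). split; [assumption|]. split; [assumption|].
    intros φ Hφ s Hs. apply E; auto.
  - intros (Oa & Pa & H). split; [assumption|]. split; [assumption|].
    split; [now apply (in_stage_ordinal hU (h_ordinal x) Oa)|].
    intros φ Hφ s Hs. apply E; auto.
Qed.

Lemma n_reflective_bound n a : n_reflective (Datatypes.S n) a -> exists x, in_stage (h x) a.
Proof. intros (x & t & _ & _ & H & _). eauto. Qed.

Lemma n_reflective_h n x : n_reflective n (h x).
Proof.
  destruct (limB x) as [y Ly]. destruct (limB y) as [z Lz].
  destruct n as [|n].
  - apply Rh.
  - apply (n_reflective_succ n Lz (h_in_stage Ly)). split; [apply h_ordinal|]. split; [apply h_limit|].
    (* For a = h x the two sides of reflection are truth at the increasing pairs x < y and y < z. *)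
    intros φ Hφ s Hs. apply sat_self; auto. now apply h_mono with x.
Qed.

(** Reflecting the atomic formula for R_n shows that a ∈ R_n is equivalent to h y ∈ R_n, which
    holds. The parameter is the empty set, an element of V_a because a > 0. *)
Lemma n_reflective_pred n a : n_reflective (Datatypes.S n) a -> n_reflective n a.
Proof.
  intros H. destruct (n_reflective_bound H) as [x Hx]. destruct (limB x) as [y Ly].
  destruct (proj1 (n_reflective_succ n Ly Hx) H) as (Oa & Pa & Hr).
  apply (Hr (FPred tt 0)) with (s := empty hU).
  - simpl. lia.
  - apply (in_stage_ordinal hU Oa); [apply (num_ordinal hU 0)|]. now apply (positive_iff hU).
  - apply n_reflective_h.
Qed.

Lemma n_reflective_regular n a : n_reflective n a -> regular_uncountable a.
Proof. induction n as [|n IH]; [auto|]. intros H. now apply IH, n_reflective_pred. Qed.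

(** Reflection for b is applied to [fsat_at φ] with parameter (a, s), which lies in V_b because b is
    a limit; it turns truth in V_b into truth in V_{h x}. *)
Lemma sat_n_reflective_stage n b x a s φ : n_reflective (Datatypes.S n) b -> in_stage (h x) b -> free_below 2 φ ->
  in_stage b a -> in_stage b s ->
  (sat (in_stage b) (fun _ : unit => n_reflective n) (env2 a s) φ <->
   sat (in_stage (h x)) (fun _ : unit => n_reflective n) (env2 a s) φ).
Proof.
  intros Rb Hb Hφ Ha Hs. assert (Lb := regular_uncountable_limit hU (n_reflective_regular Rb)).
  destruct (limB x) as [y Ly].
  destruct (proj1 (n_reflective_succ n Ly Hb) Rb) as (Ob & _ & H).
  specialize (H (fsat_at φ) (fsat_at_free Hφ) (opair hU a s) (in_stage_opair hU Lb Ha Hs)).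
  apply (in_stage_ordinal hU (h_ordinal x) Ob) in Hb as Hbx.
  rewrite (sat_fsat_at hU (h_limit x) (fun _ => n_reflective n) Lb Hbx Hφ Ha Hs) in H.
  rewrite H. apply sat_fsat_at; auto using h_limit;
    apply in_stage_mono with b; auto; now apply (proj1 (h_ordinal x)).
Qed.

(** Take x with c below h x, and y above x. Then φ(a, s) has the same truth value in V_b and V_{h
    x}, and φ(b, s) in V_c and V_{h x}; by b ∈ R_{n+1} the latter is that of φ(h x, s) in V_{h y}.
    So the condition on b and c is the one that defines a ∈ R_{n+1}. *)
Lemma n_reflective_reflection n a b c : ordinal a -> positive a -> n_reflective (Datatypes.S n) b -> n_reflective (Datatypes.S n) c ->
  a ∈ b -> b ∈ c ->
  (n_reflective (Datatypes.S n) a <-> forall φ, free_below 2 φ -> forall s, in_stage a s ->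
    (sat (in_stage b) (fun _ : unit => n_reflective n) (env2 a s) φ <->
     sat (in_stage c) (fun _ : unit => n_reflective n) (env2 b s) φ)).
Proof.
  intros Oa Pa Rb Rc Hab Hbc.
  assert (Ob := proj1 (regular_uncountable_limit hU (n_reflective_regular Rb))).
  assert (Oc := proj1 (regular_uncountable_limit hU (n_reflective_regular Rc))).
  destruct (n_reflective_bound Rc) as [x Hc]. destruct (limB x) as [y Ly].
  assert (Hb' : in_stage c b) by now apply (in_stage_ordinal hU Oc Ob).
  assert (Ha' : in_stage b a) by now apply (in_stage_ordinal hU Ob Oa).
  assert (Hb := stage_trans Hc Oc Hb'). assert (Ha := stage_trans Hb Ob Ha').
  rewrite (n_reflective_succ n Ly Ha).
  destruct (proj1 (n_reflective_succ n Ly Hb) Rb) as (_ & _ & Eb).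
  assert (E : forall φ, free_below 2 φ -> forall s, in_stage a s ->
    (((sat (in_stage (h x)) (fun _ : unit => n_reflective n) (env2 a s) φ <->
       sat (in_stage (h y)) (fun _ : unit => n_reflective n) (env2 (h x) s) φ)) <->
     (sat (in_stage b) (fun _ : unit => n_reflective n) (env2 a s) φ <->
      sat (in_stage c) (fun _ : unit => n_reflective n) (env2 b s) φ))).
  { intros φ Hφ s Hs.
    assert (Hsb : in_stage b s) by (apply in_stage_mono with a; auto; now apply (proj1 Ob)).
    assert (Hsc : in_stage c s) by (apply in_stage_mono with b; auto; now apply (proj1 Oc)).
    rewrite (sat_n_reflective_stage Rb Hb Hφ Ha' Hsb), (sat_n_reflective_stage Rc Hc Hφ Hb' Hsc), (Eb φ Hφ s Hsb).
    reflexivity. }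
  split.
  - intros (_ & _ & H) φ Hφ s Hs. apply E; auto.
  - intros H. split; [assumption|]. split; [assumption|]. intros φ Hφ s Hs. apply E; auto.
Qed.

(* R_n for n ≤ ω; no ordinal is n-reflective for n > ω. *)
Definition reflective (n a : U) : Prop :=
  (exists k, n = num hU k /\ n_reflective k a) \/ (n = omega hU /\ forall k, n_reflective k a).

Lemma reflective_num k a : reflective (num hU k) a <-> n_reflective k a.
Proof.
  split; [|left; eauto]. intros [(j & E & H)|[E _]].
  - apply num_inj in E. now subst.
  - exfalso. apply (num_not_limit (hU := hU) (n := k)). rewrite E. apply omega_limit.
Qed.

Lemma reflective_omega a : reflective (omega hU) a <-> forall k, n_reflective k a.
Proof.
  split; [|right; auto]. intros [(j & E & H)|[_ H]]; [|assumption].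
  exfalso. apply (num_not_limit (hU := hU) (n := j)). rewrite <- E. apply omega_limit.
Qed.

Theorem reflective_B_axioms : B_axioms reflective.
Proof.
  assert (Ord : forall n a, reflective n a -> ordinal n /\ ordinal a).
  { assert (O : forall k a, n_reflective k a -> ordinal a).
    { intros k a H. exact (proj1 (regular_uncountable_limit hU (n_reflective_regular H))). }
    intros n a [(k & -> & H)|[-> H]].
    - split; [apply num_ordinal|eauto].
    - split; [apply omega_ordinal|exact (O 0 a (H 0))]. }
  split.
  (* Definable classes are among the classes that a [set_universe] allows in its schemas. *)
  - destruct hU; split; auto.
  - intros x. exists (sep hU (fun p => exists y z, is_pair p y z /\ reflective y z) x).
    intros p. apply in_sep.
  - exact Ord.
  - intros o x Ho. apply (empty_unique hU) in Ho. subst o. exact (reflective_num 0 x).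
  - intros n n' a Hn Ha. apply (is_succ_iff hU) in Hn. subst n'.
    destruct Ha as [(k & E & H)|[E _]].
    + destruct k as [|k].
      * exfalso. apply (in_empty (hU := hU) (z := n)). change (n ∈ num hU 0). rewrite <- E.
        apply in_suc. auto.
      * assert (n = num hU k) as ->.
        { assert (I : n ∈ num hU (Datatypes.S k)) by (rewrite <- E; apply in_suc; auto).
          apply in_num in I as (m & Hm & ->).
          change (suc hU (num hU m)) with (num hU (Datatypes.S m)) in E.
          apply num_inj in E. f_equal. lia. }
        apply reflective_num. now apply n_reflective_pred.
    (* ω is not a successor. *)
    + exfalso. assert (I : n ∈ omega hU) by (rewrite <- E; apply in_suc; auto).
      apply in_omega in I as [k ->]. apply (num_not_limit (hU := hU) (n := Datatypes.S k)).
      change (num hU (Datatypes.S k)) with (suc hU (num hU k)). rewrite E. apply omega_limit.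
  - intros n a Ln. destruct (limit_omega_le hU Ln) as [->|Hn].
    + rewrite reflective_omega. split.
      * intros H m Hm. apply in_omega in Hm as [k ->]. now apply reflective_num.
      * intros H k. apply reflective_num, H, in_omega. eauto.
    + split.
      * intros [(k & -> & _)|[-> _]].
        -- exfalso. now apply (num_not_limit (hU := hU) (n := k)).
        -- exfalso. now apply (not_self hU) in Hn.
      (* A limit n > ω is also above ω + 1, and nothing is (ω + 1)-reflective. *)
      * intros H. exfalso. specialize (H _ (limit_suc hU Ln Hn)).
        destruct H as [(k & E & _)|[E _]].
        -- assert (I : omega hU ∈ num hU k) by (rewrite <- E; apply in_suc; auto).
           apply in_num in I as (m & _ & E').
           apply (num_not_limit (hU := hU) (n := m)). rewrite <- E'. apply omega_limit.
        -- apply (not_self hU (x := omega hU)). rewrite <- E at 2. apply in_suc. auto.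
  - intros n n' a b c va vb vc On Oa Hn Rb Rc Pa Hab Hbc Sa Sb Sc.
    apply (is_succ_iff hU) in Hn. subst n'.
    apply (is_stage_iff hU) in Sa as [_ ->], Sb as [Ob ->], Sc as [Oc ->].
    (* Since b is (n + 1)-reflective, n + 1 ≤ ω, and so n is finite. *)
    assert (E : exists k, n = num hU k).
    { destruct Rb as [(k & E & _)|[E _]].
      - assert (I : n ∈ num hU k) by (rewrite <- E; apply in_suc; auto).
        apply in_num in I as (m & _ & ->). eauto.
      - apply in_omega. rewrite <- E. apply in_suc. auto. }
    destruct E as [k ->]. change (suc hU (num hU k)) with (num hU (Datatypes.S k)) in *.
    rewrite reflective_num in *. rewrite (n_reflective_reflection Oa Pa Rb Rc Hab Hbc).
    assert (P1 : (fun (_ : unit) z => reflective (num hU k) z) = (fun _ => n_reflective k)).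
    { apply functional_extensionality. intros _. apply functional_extensionality. intros z.
      apply propositional_extensionality, reflective_num. }
    assert (P2 : forall d, ordinal d -> (fun z => z ∈ stage hU d) = in_stage d).
    { intros d Od. apply functional_extensionality. intros z.
      apply propositional_extensionality. now apply in_stage_set. }
    unfold stage_sat. rewrite P1, !P2; auto.
    split; intros H φ Hφ s Hs; (apply H; [assumption|]);
      now apply (in_stage_set hU s Oa).
Qed.

End Reflective.

Theorem theorem11 (V : set_structure) (hV : set_universe V) (α κ : V)
  (hα : limit_ordinal α) (hκ : ge_Erdos α κ) :
  exists vκ r : V,
    is_stage κ vκ /\
    is_relation r vκ vκ /\
    B_axioms (coded_relation (d := vκ) r) /\
    exists X : V,
      (forall x, x ∈ X <->
         exists a : sub vκ,
           proj1_sig a = x /\ omega_reflective (coded_relation r) a) /\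
      order_type_at_least X α.
Proof.
  destruct hκ as (β & Lβ & Hαβ & Eκ).
  destruct (Erdos_least hV Lβ Eκ) as (Oκ & Aκ & Mκ).
  assert (Rκ := κ_regular hV Lβ Oκ Aκ Mκ). assert (Sκ := κ_strong_limit hV Lβ Oκ Aκ Mκ).
  assert (Uκ := κ_uncountable hV Lβ Oκ Aκ Mκ).
  assert (hM := Vκ_universe Oκ Rκ Sκ Uκ).
  destruct (indiscernible_ordinals Lβ Eκ
    (countable_prod countable_nat (countable_option countable_formula))
    (@reflection_family (stage_structure hV κ))) as (h & Ih & Rh & Gh).
  destruct (limit_inhabited Lβ) as [b0 _].
  assert (Wβ := sub_well_order hV (proj1 Lβ)). assert (Nβ := limit_no_max Lβ).
  pose (ρ := reflective hM (@mem (sub β)) h).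
  assert (Bρ := reflective_B_axioms hM Wβ Nβ Ih Rh Gh).
  pose (r := rel hV (fun x y => exists Hx Hy, ρ (exist _ x Hx) (exist _ y Hy)) (Vκ hV κ) (Vκ hV κ)).
  assert (Er : coded_relation (d := Vκ hV κ) r = ρ).
  { apply functional_extensionality. intros [x Hx]. apply functional_extensionality. intros [y Hy].
    apply propositional_extensionality. unfold coded_relation, r. rewrite maps_rel. simpl. split.
    - intros (_ & _ & Hx' & Hy' & H).
      now rewrite (proof_irrelevance _ Hx Hx'), (proof_irrelevance _ Hy Hy').
    - intros H. split; [assumption|]. split; [assumption|]. now exists Hx, Hy. }
  exists (Vκ hV κ), r. split; [|split; [|split]].
  - apply (is_stage_iff hV). now split.
  - apply is_relation_rel.
  - rewrite Er. exact Bρ.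
  - exists (sep hV (fun x => exists a : stage_structure hV κ, proj1_sig a = x /\
      omega_reflective (coded_relation (d := Vκ hV κ) r) a) (Vκ hV κ)).
    split.
    + intros x. rewrite in_sep. split; [tauto|]. intros (a & <- & H). split; [apply proj2_sig|eauto].
    + rewrite Er.
      pose (g := fun ξ => match excluded_middle_informative (ξ ∈ β) with
        | left p => proj1_sig (h (exist _ ξ p)) | right _ => ξ end).
      assert (Hg : forall ξ (Hξ : ξ ∈ β), g ξ = proj1_sig (h (exist _ ξ Hξ))).
      { intros ξ Hξ. unfold g. destruct (excluded_middle_informative _); [|contradiction].
        do 3 f_equal. apply proof_irrelevance. }
      (* The order type is taken in V, because the set of ω-reflective cardinals may be unbounded in
         κ and is then not an element of V_κ. *)
      destruct (order_type_ge hV (X := sep hV (fun x => exists a : stage_structure hV κ, proj1_sig a = x /\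
        omega_reflective ρ a) (Vκ hV κ)) (b := β) (g := g)) as (δ & Hδ & L).
      * apply Lβ.
      * intros x Hx. apply in_sep in Hx as [_ (a & <- & w & _ & Ha)].
        apply (ordinal_of_Vκ Oκ). now apply (B3 Bρ) in Ha.
      * intros ξ Hξ. rewrite (Hg ξ Hξ). apply in_sep. split; [apply proj2_sig|].
        eexists. split; [reflexivity|]. exists (omega hM). split; [now apply (is_omega_iff hM)|].
        apply reflective_omega. intros k. apply (n_reflective_h hM Wβ Nβ Ih Rh Gh).
      * intros ξ ζ Hξ Hζ H. rewrite (Hg ξ Hξ), (Hg ζ Hζ). exact (Ih (exist _ ξ Hξ) (exist _ ζ Hζ) H).
      * exists δ. split; [assumption|].
        destruct Hαβ as [Hαβ| ->]; [|assumption]. left. destruct L as [L| <-]; [|assumption].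
        exact (proj1 (proj1 Hδ) _ L _ Hαβ).
Qed.
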